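(* Let $m\ge4$ and for $\vec t=(t_1,\dots,t_m)\in\mathbb R^m$ write $V_{\vec t}(x)=x^4-4x^2+\sum_{j=1}^m t_jx^j$. Suppose $V_{\vec t}\in P_m^{(2)}$. Then there exists a continuous path $\tau\mapsto\vec t(\tau)$, $[0,1]\to\mathbb R^m$, with $\vec t(0)=0$ (so $V_{\vec t(0)}(x)=x^4-4x^2$), $\vec t(1)=\vec t$, and $V_{\vec t(\tau)}\in P_m^{(2)}$ for all $\tau\in[0,1]$.
   Context: $P_m$ is the set of real polynomials of even degree $\le m$ with positive leading coefficient and $V(0)=0$. For $V\in P_m$, $\mu_V$ is the unique Borel probability measure on $\mathbb R$ minimizing $\iint\log|x-y|^{-1}d\mu(x)d\mu(y)+\int Vd\mu$; it satisfies $2\int\log|x-y|d\mu_V(y)-V(x)=\ell_V$ on $\operatorname{supp}\mu_V$ and $\le \ell_V$ on $\mathbb R$ for a constant $\ell_V$. $V$ is $k$-cut regular if $\operatorname{supp}\mu_V$ is a union of exactly $k$ disjoint compact intervals $\cup_j[\alpha_j,\beta_j]$, the density of $\mu_V$ equals $\frac1c\sqrt{|\prod_j(x-\alpha_j)(x-\beta_j)|}\,|h(x)|$ with $h$ a polynomial without zeros on $\operatorname{supp}\mu_V$, and the inequality is strict on $\mathbb R\setminus\operatorname{supp}\mu_V$. $P_m^{(k)}\subset P_m$ denotes the $k$-cut regular elements. *)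

(* Defs.v *)
From HB Require Import structures.
From mathcomp Require Import all_boot all_order all_algebra.
From mathcomp Require Import all_classical all_reals all_analysis.
Set Implicit Arguments. Unset Strict Implicit. Unset Printing Implicit Defensive.
Import Order.TTheory GRing.Theory Num.Theory.
Import numFieldNormedType.Exports.
Local Open Scope classical_set_scope.
Local Open Scope ring_scope.

Definition in_P (R : realType) (m : nat) (V : {poly R}) : Prop :=
  [/\ ~~ odd (size V).-1, (size V <= m.+1)%N, 0 < lead_coef V & V.[0] = 0].

Definition logker (R : realType) (x y : R) : \bar R :=
  if x == y then +oo%E else (- ln `|x - y|)%:E.

Definition logabs (R : realType) (x y : R) : \bar R :=
  if x == y then -oo%E else (ln `|x - y|)%:E.

(* I_V(mu) = \iint log|x-y|^{-1} dmu dmu + \int V dmu, written as the integral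
   of the kernel log|x-y|^{-1} + V(x)/2 + V(y)/2 (bounded below for V in P_m),
   which is well defined in the extended reals. *)
Definition energy (R : realType) (V : {poly R}) (mu : probability R R) : \bar R :=
  (\int[mu]_x \int[mu]_y
      (logker x y + (V.[x] / 2)%:E + (V.[y] / 2)%:E))%E.

Definition is_equilibrium (R : realType) (V : {poly R}) (mu : probability R R) : Prop :=
  forall nu : probability R R, (energy V mu <= energy V nu)%E.

Definition msupp (R : realType) (mu : probability R R) : set R :=
  [set x | forall e : R, 0 < e -> (0 < mu (ball x e))%E].

Definition logpot (R : realType) (mu : probability R R) (x : R) : \bar R :=
  (\int[mu]_y logabs x y)%E.

Definition k_cut_regular (R : realType) (k : nat) (V : {poly R}) : Prop :=
  exists mu : probability R R, is_equilibrium V mu /\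
  exists (a b : 'I_k -> R) (c : R) (h : {poly R}) (l : R),
    let S := \bigcup_(j in [set: 'I_k]) `[a j, b j]%classic in
    [/\ (forall j, a j < b j),
        (forall i j, i != j -> b i < a j \/ b j < a i),
        msupp mu = S,
        0 < c &
        (forall x, S x -> h.[x] != 0)] /\
    [/\
        (forall A : set R, measurable A ->
           mu A = (\int[lebesgue_measure]_(x in A `&` S)
                     (c^-1 * Num.sqrt `|\prod_(j < k) ((x - a j) * (x - b j))|
                        * `|h.[x]|)%:E)%E),
        (forall x, S x -> (2%:E * logpot mu x - (V.[x])%:E = l%:E)%E) &
        (forall x, ~ S x -> (2%:E * logpot mu x - (V.[x])%:E < l%:E)%E)].

Definition in_Pk (R : realType) (m k : nat) (V : {poly R}) : Prop :=
  in_P m V /\ k_cut_regular k V.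

(* V_t(x) = x^4 - 4x^2 + sum_{j=1}^m t_j x^j, with t_j stored at index j-1 *)
Definition Vt (R : realType) (m : nat) (t : 'rV[R]_m) : {poly R} :=
  'X^4 - 4%:R *: 'X^2 + \sum_(j < m) t ord0 j *: 'X^(j.+1).

(* Main.v *)
Require Import Defs.
From HB Require Import structures.
From mathcomp Require Import all_boot all_order all_algebra.
From mathcomp Require Import all_classical all_reals all_analysis.
From mathcomp Require Import measurable_realfun ring lra polyrcf.
Import Order.TTheory GRing.Theory Num.Theory.
Import numFieldNormedType.Exports.
Local Open Scope classical_set_scope.
Local Open Scope ring_scope.
Set Implicit Arguments. Unset Strict Implicit. Unset Printing Implicit Defensive.

(** Write the support of the given potential V as [a1, b1] and [a2, b2], and let Q be the monic
    quartic vanishing at the four endpoints. The path has two legs. On the first, the endpoints move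
    affinely from -sqrt 3, -1, 1, sqrt 3 to those of V; for each position there is an explicit
    quartic potential that is two-cut regular with exactly these bands, and for the initial position
    it is x^4 - 4 x^2 ([path_start]). The second leg is the straight segment from the last quartic
    to V, whose members all keep the support of V.

    The quartic ([quartic_two_cut]) has density proportional to |x - c| sqrt |Q|, where c lies in
    the gap and makes the integral of (x - c) sqrt Q over the gap vanish ([gapc]). The effective
    potential then has zero derivative on the bands and derivative proportional to (x - c) sqrt Q,
    up to sign, elsewhere. Hence it is constant on each band, takes the same value on both, and is
    strictly smaller off them.

    On the segment ([two_cut_convex]) the Euler-Lagrange conditions are affine in the pair (density,
    potential), so averaged densities solve them. The averaged density must still be sqrt |Q| times
    the absolute value of a polynomial. This follows because the polynomial factor has opposite
    signs on the two bands ([opposite_sign]). If the signs agreed, the logarithmic potential of the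
    second band alone would be a polynomial on the first band; this is impossible, since a Stieltjes
    transform of a positive density has all derivatives positive there ([stieltjes_not_poly]).

    Potentials are computed without contour integrals. Let L(g) be the integral of g / sqrt |Q| over
    the second band minus the one over the first ([arcs]). Integration by parts gives a first-order
    linear equation for the resolvent r(z) = L(1 / (z - y)). It becomes homogeneous because L(1) = 0
    (equal periods, by a Moebius substitution, [arcs_moment0]) and L(y^2) is half the sum of the
    endpoints times L(y) (a bilinear relation, [arcs_moment2]). So Q r^2 is constant ([Phi_const]),
    which yields the boundary values of r on the real line ([Qkre_cvg]). Integrating in x gives the
    potential of any signed density p sqrt |Q| ([upot_formula]).

    Regularity also demands that the measure minimise the energy. The logarithmic kernel is
    approximated by a superposition of products of interval indicators ([logtent]), a positive
    definite kernel. Completing the square and letting the cutoff tend to infinity turns the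
    Euler-Lagrange conditions into minimality ([equilibrium]). [two_cut_of_k_cut] and
    [k_cut_of_two_cut] translate between measures and densities. *)

Section Int.
Context {R : realType}.
Implicit Types (a b c x y : R) (f g : R -> R).
Notation leb := (@lebesgue_measure R).

(** * Integration on segments *)

Definition der (x : R) (f : R -> R) (df : R) : Prop := is_derive x (1 : R) f df.

Definition Int a b f : R := (\int[leb]_(x in `[a, b]) f x)%R.
Definition intg a b f := leb.-integrable `[a, b] (EFin \o f).
Definition cts a b f := forall x, a <= x <= b -> {for x, continuous f}.

Lemma cts_within a b f : cts a b f -> {within `[a, b], continuous f}.
Proof.
by move=> cf; apply: continuous_in_subspaceT => x /set_mem/=; rewrite in_itv/=; exact: cf.
Qed.

Lemma cts_intg a b f : cts a b f -> intg a b f.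
Proof.
move=> cf; apply: continuous_compact_integrable; first exact: segment_compact.
exact: cts_within.
Qed.

Lemma intgE a b f : intg a b f -> (\int[leb]_(x in `[a, b]) (f x)%:E)%E = (Int a b f)%:E.
Proof. by move=> fi; rewrite /Int /Rintegral fineK//; exact: integrable_fin_num. Qed.

Lemma eq_Int a b f g : (forall x, a <= x <= b -> f x = g x) -> Int a b f = Int a b g.
Proof. by move=> fg; apply: eq_Rintegral => x /set_mem/=; rewrite in_itv/= => /fg. Qed.

Lemma eq_intg a b f g : (forall x, a <= x <= b -> f x = g x) -> intg a b f -> intg a b g.
Proof.
move=> fg; apply: eq_integrable => // x /set_mem/=; rewrite in_itv/= => /fg /= ->//.
Qed.

Lemma intgD a b f g : intg a b f -> intg a b g -> intg a b (fun x => f x + g x).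
Proof.
move=> fi gi; apply: (@eq_integrable _ _ _ _ _ _ _ _ _ (integrableD _ fi gi)) => // x _.
Qed.

Lemma intgZ a b k f : intg a b f -> intg a b (fun x => k * f x).
Proof.
move=> fi; apply: (@eq_integrable _ _ _ _ _ _ _ _ _ (integrableZl _ k fi)) => // x _.
Qed.

Lemma intgB a b f g : intg a b f -> intg a b g -> intg a b (fun x => f x - g x).
Proof.
move=> fi gi; apply: (@eq_integrable _ _ _ _ _ _ _ _ _ (integrableB _ fi gi)) => // x _.
Qed.

Lemma IntD a b f g : intg a b f -> intg a b g ->
  Int a b (fun x => f x + g x) = Int a b f + Int a b g.
Proof. by move=> fi gi; rewrite /Int RintegralD. Qed.

Lemma IntB a b f g : intg a b f -> intg a b g ->
  Int a b (fun x => f x - g x) = Int a b f - Int a b g.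
Proof. by move=> fi gi; rewrite /Int RintegralB. Qed.

Lemma IntZ a b k f : intg a b f -> Int a b (fun x => k * f x) = k * Int a b f.
Proof. by move=> fi; rewrite /Int RintegralZl. Qed.

Lemma Int_le a b f g : intg a b f -> intg a b g ->
  (forall x, a <= x <= b -> f x <= g x) -> Int a b f <= Int a b g.
Proof.
by move=> fi gi fg; apply: le_Rintegral => // x; rewrite /= in_itv/=; exact: fg.
Qed.

Lemma Int_ge0 a b f : (forall x, a <= x <= b -> 0 <= f x) -> 0 <= Int a b f.
Proof. by move=> f0; apply: Rintegral_ge0 => x; rewrite /= in_itv/=; exact: f0. Qed.

Lemma Int_cst a b k : a <= b -> Int a b (fun=> k) = k * (b - a).
Proof.
move=> ab; rewrite /Int Rintegral_cst//= lebesgue_measure_itv/= lte_fin.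
case: ltP => // ba; have -> : b = a by apply/le_anti; rewrite ab ba.
by rewrite subrr.
Qed.

Lemma intg_cst a b k : intg a b (fun=> k).
Proof. by apply: cts_intg => x _; exact: cvg_cst. Qed.

Lemma Int_abs a b f : intg a b f -> `|Int a b f| <= Int a b (fun x => `|f x|).
Proof. by move=> fi; exact: le_normr_Rintegral. Qed.

Lemma Int_FTC a b f F : a <= b -> cts a b f -> cts a b F ->
  (forall x, a < x < b -> der x F (f x)) -> Int a b f = F b - F a.
Proof.
rewrite le_eqVlt => /predU1P[<- _ _ _|ab cf cF dF].
  by rewrite /Int set_itv1 Rintegral_set1 subrr.
have := @continuous_FTC2 R f F a b ab (cts_within cf).
rewrite (intgE (cts_intg cf)) -EFinB => H; apply: EFin_inj; apply: H.
  split.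
  - by move=> x; rewrite in_itv/= => /dF[].
  - by apply: cvg_at_right_filter; apply: cF; rewrite lexx ltW.
  - by apply: cvg_at_left_filter; apply: cF; rewrite lexx ltW.
by move=> x; rewrite in_itv/= => /dF dFx; rewrite derive1E; exact: derive_val.
Qed.

Lemma Int_split a b c f : a <= b -> b <= c -> intg a c f ->
  Int a c f = Int a b f + Int b c f.
Proof.
move=> ab bc fi.
have := @Rintegral_itvB R f (BLeft a) (BRight c) b fi.
rewrite !bnd_simp => /(_ ab bc) => /eqP; rewrite subr_eq addrC => /eqP H.
rewrite [LHS]H /Int; congr +%R; rewrite Rintegral_itv_obnd_cbnd//.
apply: integrableS fi => //; apply: subset_itvr.
by rewrite bnd_simp.
Qed.

Lemma intg_sub a b c d f : a <= b -> c <= d -> intg a d f -> intg b c f.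
Proof.
move=> ab cd; apply: integrableS => //.
by move=> x /=; rewrite !in_itv/= => /andP[bx xc]; rewrite (le_trans ab bx) (le_trans xc cd).
Qed.

Lemma Int_gt0 a b f : a < b -> cts a b f -> (forall x, a < x < b -> 0 < f x) ->
  0 < Int a b f.
Proof.
move=> ab cf f0.
have f0' x : a <= x <= b -> 0 <= f x.
  move=> /andP[]; rewrite le_eqVlt => /predU1P[<- _|ax].
    have cfa : f x @[x --> a^'+] --> f a by apply: cvg_at_right_filter; apply: cf; rewrite lexx ltW.
    rewrite -(cvg_lim _ cfa)//.
    apply: limr_ge; first by apply/cvg_ex; exists (f a).
    near=> y; apply/ltW/f0; apply/andP; split; first by near: y; exact: nbhs_right_gt.
    by near: y; exact: nbhs_right_lt.
  rewrite le_eqVlt => /predU1P[->|xb]; last by apply/ltW/f0; rewrite ax xb.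
  have cfa : f x @[x --> b^'-] --> f b by apply: cvg_at_left_filter; apply: cf; rewrite lexx ltW.
  rewrite -(cvg_lim _ cfa)//.
  apply: limr_ge; first by apply/cvg_ex; exists (f b).
  near=> y; apply/ltW/f0; apply/andP; split; last by near: y; exact: nbhs_left_lt.
  by near: y; exact: nbhs_left_gt.
pose m := (a + b) / 2.
have am : a < m < b by rewrite midf_lt//= midf_lt.
have fm : 0 < f m by exact: f0.
have : \forall y \near m, f m / 2 < f y.
  have /cvgr_gt : f y @[y --> m] --> f m by apply: cf; case/andP: am => /ltW -> /ltW ->.
  by apply; rewrite ltr_pdivrMr// mulr2n mulrDr mulr1 ltrDl.
move=> /nbhs_ballP[e /= e0 he].
pose d := Num.min (e / 2) ((b - a) / 4).
have d0 : 0 < d.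
  by rewrite lt_min divr_gt0//= divr_gt0// subr_gt0.
have dle : d <= e / 2 by rewrite ge_min lexx.
have dle2 : d <= (b - a) / 4 by rewrite ge_min lexx orbT.
have h1 : a <= m - d by rewrite /m; lra.
have h2 : m + d <= b by rewrite /m; lra.
have h3 : m - d <= m + d by lra.
have fi := cts_intg cf.
rewrite (Int_split h1 _ fi) ?(le_trans h3)//.
rewrite (@Int_split (m - d) (m + d))//; last first.
  by apply: intg_sub fi; rewrite ?lexx.
apply: ltr_wpDl.
  by apply: Int_ge0 => x /andP[? ?]; apply: f0'; apply/andP; split=> //; lra.
apply: ltr_wpDr.
  by apply: Int_ge0 => x /andP[? ?]; apply: f0'; apply/andP; split=> //; lra.
have : Int (m - d) (m + d) (fun=> f m / 2) <= Int (m - d) (m + d) f.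
  apply: Int_le; first exact: intg_cst.
    by apply: intg_sub fi.
  move=> x /andP[x1 x2]; apply/ltW/he; rewrite /ball/= ltr_norml; apply/andP; split; lra.
rewrite Int_cst// => /lt_le_trans; apply; apply: mulr_gt0; first by rewrite divr_gt0.
by lra.
Unshelve. all: by end_near. Qed.



Let mitv a b : measurable (`[a, b]%classic : set (measurableTypeR R)).
Proof. exact: measurable_itv. Qed.

Lemma Int_derive a b (u v x0 K : R) (f df : R -> R -> R) : u < x0 < v ->
  (forall x, u < x < v -> cts a b (f x)) ->
  (forall x y, u < x < v -> a <= y <= b -> der x (f^~ y) (df x y)) ->
  (forall x y, u < x < v -> a <= y <= b -> `|df x y| <= K) ->
  der x0 (fun x => Int a b (f x)) (Int a b (df x0)).
Proof.
move=> ux cf dff dfK.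
have Ia : `]u, v[%classic x0 by rewrite /= in_itv.
have h1 x : `]u, v[%classic x -> leb.-integrable `[a, b] (EFin \o f x).
  by rewrite /= in_itv/= => xuv; exact/cts_intg/cf.
have h2 x y : `]u, v[%classic x -> `[a, b]%classic y -> derivable (f^~ y) x 1.
  by rewrite /= !in_itv/= => xuv yab; have [] := dff _ _ xuv yab.
(* The majorant must be nonnegative, and [K] could be negative when the segment is empty. *)
have h3 (y : R) : 0 <= (fun=> Num.max K 0) y by rewrite le_max lexx orbT.
have h4 : leb.-integrable `[a, b] (EFin \o (fun=> Num.max K 0)) by exact: intg_cst.
have E x y : u < x < v -> a <= y <= b -> partial1of2 f x y = df x y.
  move=> xuv yab; rewrite partial1of2E.
  by apply: derive_val; exact: dff.
have h5 x y : `]u, v[%classic x -> `[a, b]%classic y ->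
    `|partial1of2 f x y| <= (fun=> Num.max K 0) y.
  rewrite /= !in_itv/= => xuv yab; rewrite E// le_max; apply/orP; left.
  exact: dfK.
have D1 := derivable_under_integral (mitv a b) Ia h1 h2 h3 h4 h5.
have D2 := differentiation_under_integral (mitv a b) Ia h1 h2 h3 h4 h5.
apply: DeriveDef; first exact: D1.
rewrite -derive1E D2; apply: eq_Rintegral => y /set_mem/=; rewrite in_itv/= => yab.
exact: E.
Qed.

Lemma Int_continuous a b (u v x0 K : R) (f : R -> R -> R) : u < x0 < v ->
  (forall x, u < x < v -> cts a b (f x)) ->
  (forall x y, u < x < v -> a <= y <= b -> {for x, continuous (f^~ y)}) ->
  (forall x y, u < x < v -> a <= y <= b -> `|f x y| <= K) ->
  {for x0, continuous (fun x => Int a b (f x))}.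
Proof.
move=> ux cf cfx fK.
have h1 x : `]u, v[%classic x -> leb.-integrable `[a, b] (EFin \o f x).
  by rewrite /= in_itv/= => xuv; exact/cts_intg/cf.
have h2 : \forall y \ae leb, `[a, b]%classic y -> {in `]u, v[%classic, continuous (f^~ y)}.
  apply: aeW => y /=; rewrite in_itv/= => yab x /set_mem/=; rewrite in_itv/= => xuv.
  exact: cfx.
have h4 : leb.-integrable `[a, b] (EFin \o (fun=> K)) by exact: intg_cst.
have h5 x : `]u, v[%classic x -> \forall y \ae leb, `[a, b]%classic y -> `|f x y| <= (fun=> K) y.
  rewrite /= in_itv/= => xuv; apply: aeW => y /=; rewrite in_itv/= => yab.
  exact: fK.
apply: (continuity_under_integral (mitv a b) h1 h2 h4 h5).
by apply/mem_set; rewrite /= in_itv.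
Qed.

Lemma intg_measurable a b f : intg a b f -> measurable_fun `[a, b] f.
Proof. by move=> /integrableP[/measurable_EFinP]. Qed.

(** The exceptional point [c] absorbs the singularity of a kernel at y = x, where pointwise
    convergence fails. *)
Lemma Int_dominated a b c (f_ : nat -> R -> R) f g :
  (forall n, intg a b (f_ n)) -> measurable_fun `[a, b] f -> intg a b g ->
  (forall x, a <= x <= b -> x != c -> f_ n x @[n --> \oo] --> f x) ->
  (forall n x, a <= x <= b -> x != c -> `|f_ n x| <= g x) ->
  intg a b f /\ Int a b (f_ n) @[n --> \oo] --> Int a b f.
Proof.
move=> fi mf gi fcv fg.
have neg (P : R -> Prop) : (forall x, x != c -> P x) -> {ae leb, forall x, P x}.
  move=> H; exists [set c]; split=> //; first by rewrite lebesgue_measure_set1.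
  by move=> x /=; apply: contra_notP => /eqP; exact: H.
have h1 n : measurable_fun `[a, b] (EFin \o f_ n).
  by have /integrableP[] := fi n.
have h2 : measurable_fun `[a, b] (EFin \o f) by exact/measurable_EFinP.
have h3 : \forall x \ae leb, `[a, b]%classic x ->
    (EFin \o f_ n) x @[n --> \oo] --> (EFin \o f) x.
  apply: neg => x xc /=; rewrite in_itv/= => xab.
  by apply: cvg_EFin; [exact: nearW|exact: fcv].
have h4 : \forall x \ae leb, forall n, `[a, b]%classic x ->
    (`|(EFin \o f_ n) x| <= (EFin \o g) x)%E.
  apply: neg => x xc n /=; rewrite in_itv/= => xab.
  by rewrite lee_fin fg.
have [H1 _ H2] := dominated_convergence (mitv a b) h1 h2 h3 gi h4.
split=> //; apply: fine_cvg.
by rewrite -intgE.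
Qed.

Lemma Int_FTC1 a b x f : a < x < b -> cts a b f ->
  der x (fun x => Int a x f) (f x).
Proof.
move=> /andP[ax xb] cf.
have [|||D E] := @continuous_FTC1 R f (BLeft a) x b xb.
- exact: cts_intg.
- by [].
- by apply: cf; rewrite !ltW.
by apply: DeriveDef => //; rewrite -derive1E E.
Qed.

(** Positivity of [dF] is asked only in the interior because the trigonometric parametrisation of a
    band has zero speed at both ends. *)
Lemma Int_subst a b (F dF G : R -> R) : a < b ->
  cts a b F -> cts a b dF -> (forall x, a < x < b -> der x F (dF x)) ->
  (forall x, a < x < b -> 0 < dF x) -> cts (F a) (F b) G ->
  Int (F a) (F b) G = Int a b (fun x => G (F x) * dF x).
Proof.
move=> ab cF cdF dFF dF0 cG.
have incF : {in `[a, b] &, {homo F : x y / x < y}}.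
  apply: gtr0_derive1_lt_cc.
  - by move=> x; rewrite in_itv/= => /dFF[].
  - by move=> x; rewrite in_itv/= => xab; rewrite derive1E; have := dFF _ xab => -[_ ->]; exact: dF0.
  - exact: cts_within.
have dE x : a < x < b -> F^`()%classic x = dF x.
  by move=> /dFF[_ H]; rewrite derive1E.
have nearab x : a < x < b -> \forall y \near x, a < y < b.
  move=> /andP[ax xb]; near=> y; apply/andP; split.
    by near: y; exact: lt_nbhsr.
  by near: y; exact: lt_nbhsl.
have ha : F^`()%classic x @[x --> a^'+] --> dF a.
  have : dF x @[x --> a^'+] --> dF a.
    by apply: cvg_at_right_filter; apply: cdF; rewrite lexx ltW.
  apply: cvg_trans; apply: near_eq_cvg; near=> x; apply/esym/dE; apply/andP; split.
    by near: x; exact: nbhs_right_gt.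
  by near: x; exact: nbhs_right_lt.
have hb : F^`()%classic x @[x --> b^'-] --> dF b.
  have : dF x @[x --> b^'-] --> dF b.
    by apply: cvg_at_left_filter; apply: cdF; rewrite lexx ltW.
  apply: cvg_trans; apply: near_eq_cvg; near=> x; apply/esym/dE; apply/andP; split.
    by near: x; exact: nbhs_left_gt.
  by near: x; exact: nbhs_left_lt.
have FcF : {within `[F a, F b], continuous G} by exact: cts_within.
rewrite /Int /Rintegral (@integration_by_substitution_increasing R F G a b)//.
- have mGF : measurable_fun `]a, b[ (fun x => (G (F x) * dF x)%:E).
    apply/measurable_EFinP; apply: subspace_continuous_measurable_fun => //.
    apply: continuous_in_subspaceT => x /set_mem/=; rewrite in_itv/= => xab.
    have xab' : a <= x <= b by case/andP: xab => /ltW -> /ltW ->.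
    apply: cvgM; last exact: cdF.
    apply: continuous_comp; first exact: cF.
    have [ax xb] := andP xab.
    apply: cG; apply/andP; split; apply: ltW; apply: incF => //;
      by rewrite in_itv/= ?lexx ?ltW// (lt_trans ax xb).
  (* The derivative of [F] is known to be [dF] only inside, so both integrals are moved to the open
     interval. *)
  have eqoo : {in (`]a, b[%classic : set R),
      (fun x => (((G \o F) * F^`()%classic) x)%:E) =1 (fun x => (G (F x) * dF x)%:E)}.
    by move=> x /set_mem/=; rewrite in_itv/= => xab; rewrite -(dE _ xab).
  have mGF' := eq_measurable_fun _ (fun x xab => esym (eqoo x xab)) mGF.
  rewrite (integral_itv_bndoo _ _ mGF') (integral_itv_bndoo _ _ mGF).
  by congr fine; apply: eq_integral.
- exact: ltW.
- move=> x; rewrite in_itv/= => xab.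
  rewrite /prop_for /continuous_at dE//.
  have : dF y @[y --> x] --> dF x by apply: cdF; case/andP: xab => /ltW -> /ltW ->.
  apply: cvg_trans; apply: near_eq_cvg.
  by apply: filterS (nearab _ xab) => y /dE ->.
- by apply/cvg_ex; exists (dF a).
- by apply/cvg_ex; exists (dF b).
- split.
  - by move=> x; rewrite in_itv/= => /dFF[].
  - by apply: cvg_at_right_filter; apply: cF; rewrite lexx ltW.
  - by apply: cvg_at_left_filter; apply: cF; rewrite lexx ltW.
Unshelve. all: by end_near. Qed.

End Int.

(** * Pointwise continuity and differentiation rules, with tactics applying them *)

Section Calculus.
Context {R : realType}.
Implicit Types (f g : R -> R) (x k df dg : R).

Lemma contC x k : {for x, continuous (fun _ : R => k)}.
Proof. exact: cvg_cst. Qed.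
Lemma contI x : {for x, continuous (fun y : R => y)}.
Proof. exact: cvg_id. Qed.
Lemma contD x f g : {for x, continuous f} -> {for x, continuous g} ->
  {for x, continuous (fun y => f y + g y)}.
Proof. by move=> cf cg; apply: cvgD. Qed.
Lemma contN x f : {for x, continuous f} -> {for x, continuous (fun y => - f y)}.
Proof. by move=> cf; apply: cvgN. Qed.
Lemma contM x f g : {for x, continuous f} -> {for x, continuous g} ->
  {for x, continuous (fun y => f y * g y)}.
Proof. by move=> cf cg; apply: cvgM. Qed.
Lemma contX x f n : {for x, continuous f} -> {for x, continuous (fun y => f y ^+ n)}.
Proof.
move=> cf; elim: n => [|n ih]; first by apply: cvg_cst.
rewrite (_ : (fun y => _) = (fun y => f y * f y ^+ n)); first exact: contM.
by apply/funext => y; rewrite exprS.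
Qed.
Lemma contV x f : f x != 0 -> {for x, continuous f} ->
  {for x, continuous (fun y => (f y)^-1)}.
Proof. by move=> fx cf; apply: cvgV. Qed.
Lemma contcomp x f g : {for g x, continuous f} -> {for x, continuous g} ->
  {for x, continuous (fun y => f (g y))}.
Proof. by move=> cf cg; apply: continuous_comp. Qed.
Lemma contsqrt x f : {for x, continuous f} -> {for x, continuous (fun y => Num.sqrt (f y))}.
Proof. by move=> cf; apply: continuous_comp => //; exact: sqrt_continuous. Qed.
Lemma contnorm x f : {for x, continuous f} -> {for x, continuous (fun y => `|f y|)}.
Proof. by move=> cf; apply: continuous_comp => //; exact: norm_continuous. Qed.
Lemma contcos x f : {for x, continuous f} -> {for x, continuous (fun y => cos (f y))}.
Proof. by move=> cf; apply: continuous_comp => //; exact: continuous_cos. Qed.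
Lemma contsin x f : {for x, continuous f} -> {for x, continuous (fun y => sin (f y))}.
Proof. by move=> cf; apply: continuous_comp => //; exact: continuous_sin. Qed.
Lemma contln x f : 0 < f x -> {for x, continuous f} -> {for x, continuous (fun y => ln (f y))}.
Proof. by move=> fx cf; apply: continuous_comp => //; exact: continuous_ln. Qed.
Lemma conthorner x (p : {poly R}) f : {for x, continuous f} ->
  {for x, continuous (fun y => p.[f y])}.
Proof. by move=> cf; apply: (@continuous_comp _ _ _ f (horner p)) => //; exact: continuous_horner. Qed.

Lemma der_eq x f df dg : der x f df -> df = dg -> der x f dg.
Proof. by move=> Hf <-. Qed.
Lemma isdC x k : der x (fun _ : R => k) 0.
Proof. exact: is_derive_cst. Qed.
Lemma isdI x : der x (fun y : R => y) 1.
Proof. exact: is_derive_id. Qed.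
Lemma isdD x f g df dg : der x f df -> der x g dg ->
  der x (fun y => f y + g y) (df + dg).
Proof. by move=> Hf Hg; exact: is_deriveD. Qed.
Lemma isdN x f df : der x f df ->
  der x (fun y => - f y) (- df).
Proof. by move=> Hf; exact: is_deriveN. Qed.
Lemma isdM x f g df dg : der x f df -> der x g dg ->
  der x (fun y => f y * g y) (df * g x + f x * dg).
Proof.
move=> Hf Hg; apply: (is_derive_eq (is_deriveM Hf Hg)).
by rewrite addrC /GRing.scale/=; congr +%R; rewrite mulrC.
Qed.
Lemma isdX x f df n : der x f df ->
  der x (fun y => f y ^+ n) (n%:R * f x ^+ n.-1 * df).
Proof.
move=> Hf; rewrite (_ : (fun y => _) = f ^+ n); last by apply/funext => y; rewrite exprfctE.
exact: is_deriveX.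
Qed.
Lemma isdV x f df : f x != 0 -> der x f df ->
  der x (fun y => (f y)^-1) (- df / f x ^+ 2).
Proof.
move=> fx Hf; apply: (is_derive_eq (is_deriveV fx Hf)).
by rewrite /GRing.scale/= mulNr mulrC mulNr.
Qed.
Lemma isdcomp x f g df dg : der (g x) f df -> der x g dg ->
  der x (fun y => f (g y)) (df * dg).
Proof. by move=> Hf Hg; apply: (@is_derive1_comp R f g). Qed.
Lemma isdsqrt x f df : 0 < f x -> der x f df ->
  der x (fun y => Num.sqrt (f y)) (df / (2 * Num.sqrt (f x))).
Proof.
move=> fx Hf; rewrite mulrC; apply: (@isdcomp x Num.sqrt f _ df _ Hf); exact: is_derive1_sqrt.
Qed.
Lemma isdln x f df : 0 < f x -> der x f df ->
  der x (fun y => ln (f y)) (df / f x).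
Proof. by move=> fx Hf; rewrite mulrC; apply: (@isdcomp x (@ln R) f _ df _ Hf); exact: is_derive1_ln. Qed.
Lemma isdcos x f df : der x f df ->
  der x (fun y => cos (f y)) (- sin (f x) * df).
Proof. by move=> Hf; apply: (@isdcomp x cos f _ df _ Hf); exact: is_derive_cos. Qed.
Lemma isdsin x f df : der x f df ->
  der x (fun y => sin (f y)) (cos (f x) * df).
Proof. by move=> Hf; apply: (@isdcomp x sin f _ df _ Hf); exact: is_derive_sin. Qed.
Lemma isdacos x f df : -1 < f x < 1 -> der x f df ->
  der x (fun y => acos (f y)) (- df / Num.sqrt (1 - f x ^+ 2)).
Proof.
move=> fx Hf; apply: is_derive_eq; first by apply: (@isdcomp x acos f _ df _ Hf); exact: is_derive1_acos.
by rewrite !mulNr mulrC.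
Qed.

Lemma is_derive_cont x f df : der x f df -> {for x, continuous f}.
Proof. by move=> [Hf _]; apply/differentiable_continuous/derivable1_diffP. Qed.

Lemma is_derive_near_eq x u v f g df : u < x < v -> (forall y, u < y < v -> f y = g y) ->
  der x f df -> der x g df.
Proof.
move=> /andP[ux xv] fg; apply: near_eq_is_derive.
near=> y; apply: fg; apply/andP; split.
  by near: y; exact: lt_nbhsr.
by near: y; exact: lt_nbhsl.
Unshelve. all: by end_near. Qed.

Lemma is_derive_unique x f df dg : der x f df -> der x f dg -> df = dg.
Proof. by move=> [_ <-] [_ <-]. Qed.

Lemma derive0_const u v f : (forall x, u < x < v -> der x f 0) ->
  forall x y, u < x < v -> u < y < v -> f x = f y.
Proof.
move=> Hf; have H x y : u < x < v -> u < y < v -> x < y -> f x = f y.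
  move=> /andP[ux xv] /andP[uy yv] xy.
  have h1 z : z \in `]x, y[ -> is_derive z (1 : R) f ((fun=> 0) z).
    by rewrite in_itv/= => /andP[xz zy]; apply: Hf; rewrite (lt_trans ux)//= (lt_trans zy).
  have h2 : {within `[x, y], continuous f}.
    apply: continuous_in_subspaceT => z /set_mem/=; rewrite in_itv/= => /andP[xz zy].
    by apply: is_derive_cont; apply: Hf; rewrite (lt_le_trans ux)//= (le_lt_trans zy).
  have [c _] := MVT xy h1 h2.
  by rewrite mul0r => /eqP; rewrite subr_eq0 => /eqP.
move=> x y Hx Hy; have [xy|xy|->//] := ltgtP x y; first exact: H.
by apply/esym/H.
Qed.

End Calculus.

(** Both tactics follow the syntax of the function and leave as goals the nonvanishing of
    denominators and the positivity under logarithms (for [isd_step], also under roots). *)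
Ltac cont_step := lazymatch goal with
  | |- continuous_at _ (fun _ => ?k) => exact: contC
  | |- continuous_at _ (fun y => y) => exact: contI
  | |- continuous_at _ (fun y => @?f y + @?g y) => apply: (@contD _ _ f g)
  | |- continuous_at _ (fun y => @?f y * @?g y) => apply: (@contM _ _ f g)
  | |- continuous_at _ (fun y => - @?f y) => apply: (@contN _ _ f)
  | |- continuous_at _ (fun y => (@?f y)^-1) => apply: (@contV _ _ f)
  | |- continuous_at _ (fun y => (@?f y) ^+ _) => apply: (@contX _ _ f)
  | |- continuous_at _ (fun y => Num.sqrt (@?f y)) => apply: (@contsqrt _ _ f)
  | |- continuous_at _ (fun y => cos (@?f y)) => apply: (@contcos _ _ f)
  | |- continuous_at _ (fun y => sin (@?f y)) => apply: (@contsin _ _ f)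
  | |- continuous_at _ (fun y => ln (@?f y)) => apply: (@contln _ _ f)
  | |- continuous_at _ (fun y => `|@?f y|) => apply: (@contnorm _ _ f)
  | |- continuous_at _ (fun y => (?p).[@?f y]) => apply: (@conthorner _ _ p f)
  | |- prop_for _ _ => rewrite /prop_for; cbv beta
  | |- continuous_at _ _ => assumption
  end.
Ltac cont := repeat cont_step.

Ltac isd_step := lazymatch goal with
  | |- der _ (fun _ => ?k) _ => exact: isdC
  | |- der _ (fun y => y) _ => exact: isdI
  | |- der _ (fun y => @?f y + @?g y) _ => eapply (@isdD _ _ f g)
  | |- der _ (fun y => @?f y * @?g y) _ => eapply (@isdM _ _ f g)
  | |- der _ (fun y => - @?f y) _ => eapply (@isdN _ _ f)
  | |- der _ (fun y => (@?f y)^-1) _ => eapply (@isdV _ _ f)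
  | |- der _ (fun y => (@?f y) ^+ _) _ => eapply (@isdX _ _ f)
  | |- der _ (fun y => Num.sqrt (@?f y)) _ => eapply (@isdsqrt _ _ f)
  | |- der _ (fun y => ln (@?f y)) _ => eapply (@isdln _ _ f)
  | |- der _ (fun y => cos (@?f y)) _ => eapply (@isdcos _ _ f)
  | |- der _ (fun y => sin (@?f y)) _ => eapply (@isdsin _ _ f)
  | |- der _ _ _ => eassumption
  end.
Ltac isd := repeat isd_step.

Lemma sqrt_ex {R : realType} (r : R) : 0 < r -> exists2 s : R, 0 < s & r = s ^+ 2.
Proof. by move=> r0; exists (Num.sqrt r); rewrite ?sqrtr_gt0// sqr_sqrtr// ltW. Qed.

(** * Integrals over one band with inverse square-root weight *)

Section Arc.
Context {R : realType}.
Implicit Types (g dg : R -> R) (y t : R).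

Definition arcpt (a b t : R) : R := (a + b) / 2 - (b - a) / 2 * cos t.
(** This is the integral of g(y) / sqrt ((y - a) (b - y) rho(y)) over [a, b]: in the angle [t] the
    endpoint singularities cancel against dy. *)
Definition arc (a b : R) (rho g : R -> R) : R :=
  Int 0 pi (fun t => g (arcpt a b t) / Num.sqrt (rho (arcpt a b t))).

Variables (a b : R) (rho drho : R -> R).
Hypothesis ab : a < b.
Hypothesis rho_gt0 : forall y, a <= y <= b -> 0 < rho y.
Hypothesis rho_der : forall y, a <= y <= b -> der y rho (drho y).
Hypothesis drho_cts : cts a b drho.

Local Notation Y := (arcpt a b).
Local Notation I := (arc a b rho).

Lemma arcpt_itv t : a <= Y t <= b.
Proof.
have := cos_geN1 t; have := cos_le1 t; rewrite /arcpt.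
move: (cos t) => c c1 c2.
have ab' := ab; have h1 : 0 <= (b - a) * (1 - c) by apply: mulr_ge0; lra.
have h2 : 0 <= (b - a) * (1 + c) by apply: mulr_ge0; lra.
by apply/andP; split; lra.
Qed.

Lemma arcpt_cont t : {for t, continuous Y}.
Proof. by rewrite /arcpt; cont. Qed.

Lemma arcpt_der t : der t Y ((b - a) / 2 * sin t).
Proof. by apply: der_eq; [rewrite /arcpt; isd|rewrite /=; ring]. Qed.

Lemma rho_cts : cts a b rho.
Proof. by move=> y /rho_der; exact: is_derive_cont. Qed.

Lemma arc_integrand_cts g : cts a b g ->
  cts 0 pi (fun t => g (Y t) / Num.sqrt (rho (Y t))).
Proof.
move=> cg t _; apply: contM.
  by apply: (@contcomp _ t g Y); [exact/cg/arcpt_itv|exact: arcpt_cont].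
apply: contV; first by rewrite gt_eqF// sqrtr_gt0 rho_gt0// arcpt_itv.
apply: contsqrt; apply: (@contcomp _ t rho Y); last exact: arcpt_cont.
exact/rho_cts/arcpt_itv.
Qed.

Let int0 g : cts a b g -> intg 0 pi (fun t => g (Y t) / Num.sqrt (rho (Y t))).
Proof. by move=> cg; apply/cts_intg/arc_integrand_cts. Qed.

Lemma eq_arc f g : (forall y, a <= y <= b -> f y = g y) -> I f = I g.
Proof. by move=> fg; apply: eq_Int => t _; rewrite fg// arcpt_itv. Qed.

Lemma arcD f g : cts a b f -> cts a b g -> I (fun y => f y + g y) = I f + I g.
Proof.
move=> cf cg; rewrite /arc -IntD; [|exact: int0..].
by apply: eq_Int => t _; rewrite mulrDl.
Qed.

Lemma arcZ k g : cts a b g -> I (fun y => k * g y) = k * I g.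
Proof.
move=> cg; rewrite /arc -IntZ; last exact: int0.
by apply: eq_Int => t _; rewrite mulrA.
Qed.

Lemma arc_le f g : cts a b f -> cts a b g -> (forall y, a <= y <= b -> f y <= g y) -> I f <= I g.
Proof.
move=> cf cg fg; apply: Int_le; [exact: int0..|] => t _.
by rewrite ler_pM2r ?fg ?arcpt_itv// invr_gt0 sqrtr_gt0 rho_gt0// arcpt_itv.
Qed.

Lemma arc_gt0 g : cts a b g -> (forall y, a <= y <= b -> 0 < g y) -> 0 < I g.
Proof.
move=> cg g0; apply: Int_gt0; [exact: pi_gt0|exact: arc_integrand_cts|] => t _.
by rewrite divr_gt0 ?g0 ?sqrtr_gt0 ?rho_gt0// arcpt_itv.
Qed.

Lemma arc_derive (u v x0 K : R) (g dg : R -> R -> R) : u < x0 < v ->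
  (forall x, u < x < v -> cts a b (g x)) ->
  (forall x y, u < x < v -> a <= y <= b -> der x (g^~ y) (dg x y)) ->
  (forall x y, u < x < v -> a <= y <= b -> `|dg x y| <= K) ->
  der x0 (fun x => I (g x)) (I (dg x0)).
Proof.
move=> ux cg dgg dgK.
have [m m0 Hm] : exists2 m : R, 0 < m & forall t, m <= Num.sqrt (rho (Y t)).
  have [|c cab Hc] := @EVT_min R (fun y => Num.sqrt (rho y)) a b (ltW ab).
    by apply: cts_within => y yab; apply/contsqrt/rho_cts.
  exists (Num.sqrt (rho c)); first by rewrite sqrtr_gt0 rho_gt0// -in_itv.
  by move=> t; apply: Hc; rewrite in_itv/= arcpt_itv.
apply: (@Int_derive R 0 pi u v x0 (K / m)
  (fun x t => g x (Y t) / Num.sqrt (rho (Y t)))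
  (fun x t => dg x (Y t) / Num.sqrt (rho (Y t)))) => //.
- by move=> x xuv; exact: (arc_integrand_cts (cg _ xuv)).
- move=> x t xuv _; have := dgg x (Y t) xuv (arcpt_itv t) => H.
  apply: der_eq; first by apply: isdM; [exact: H|exact: isdC].
  rewrite /=.
  by rewrite mulr0 addr0.
move=> x t xuv _; rewrite normrM normfV (ger0_norm (sqrtr_ge0 _)).
apply: ler_pM; rewrite ?dgK ?arcpt_itv// ?invr_ge0 ?sqrtr_ge0//.
by rewrite lef_pV2 ?posrE ?Hm// sqrtr_gt0 rho_gt0// arcpt_itv.
Qed.

(* The integrand is the derivative of [sin t * sqrt (rho y) * g y], which vanishes at [0] and [pi]. *)
Lemma arc_exact g dg : (forall y, a <= y <= b -> der y g (dg y)) -> cts a b dg ->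
  I (fun y => ((a + b - 2 * y) * rho y + (y - a) * (b - y) * drho y) / 2 * g y
              + (y - a) * (b - y) * rho y * dg y) = 0.
Proof.
move=> gd cdg.
have cg : cts a b g by move=> y /gd; exact: is_derive_cont.
pose F t := (b - a) / 2 * sin t * Num.sqrt (rho (Y t)) * g (Y t).
set h := (fun y => _).
rewrite /arc (@Int_FTC R 0 pi _ F (pi_ge0 _)).
- by rewrite /F sinpi sin0 !mulr0 !mul0r subrr.
- apply: (@arc_integrand_cts h) => y yab; rewrite /h.
  have := rho_cts yab; have := drho_cts yab; have := cg _ yab; have := cdg _ yab.
  by move=> *; cont.
- move=> t _; rewrite /F; apply: contM; last first.
    by apply: (@contcomp _ t g Y); [exact/cg/arcpt_itv|exact: arcpt_cont].
  apply: contM; first by cont.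
  apply: contsqrt; apply: (@contcomp _ t rho Y); last exact: arcpt_cont.
  exact/rho_cts/arcpt_itv.
move=> t _; have tab := arcpt_itv t.
have r0 := rho_gt0 tab.
have s0 : 0 < Num.sqrt (rho (Y t)) by rewrite sqrtr_gt0.
have d1 : der t (fun t => rho (Y t)) (drho (Y t) * ((b - a) / 2 * sin t)).
  by apply: isdcomp (arcpt_der t); exact: rho_der.
have d2 : der t (fun t => g (Y t)) (dg (Y t) * ((b - a) / 2 * sin t)).
  by apply: isdcomp (arcpt_der t); exact: gd.
apply: der_eq.
  by apply: isdM d2; apply: isdM; [isd|exact: (isdsqrt r0 d1)].
have E1 : (Y t - a) * (b - Y t) = ((b - a) / 2 * sin t) ^+ 2.
  by rewrite exprMn sin2cos2 /arcpt; field.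
have E2 : a + b - 2 * Y t = (b - a) * cos t by rewrite /arcpt; field.
rewrite /h E1 E2 /=; have [s sp ->] := sqrt_ex r0.
rewrite sqrtr_sqr (gtr0_norm sp).
by field; rewrite gt_eqF.
Qed.


Lemma arcpt0 : Y 0 = a.
Proof. by rewrite /arcpt cos0; field. Qed.

Lemma arcptpi : Y pi = b.
Proof. by rewrite /arcpt cospi; field. Qed.

(** Since dy = sqrt ((y - a) (b - y)) dt and sqrt w = w / sqrt w, a square-root weight in the
    numerator becomes an [arc] integral of a smooth function. *)
Lemma arcE g : cts a b g ->
  Int a b (fun y => g y * Num.sqrt ((y - a) * (b - y) * rho y)) =
  I (fun y => g y * ((y - a) * (b - y) * rho y)).
Proof.
move=> cg; have := @Int_subst R 0 pi Y (fun t => (b - a) / 2 * sin t)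
  (fun y => g y * Num.sqrt ((y - a) * (b - y) * rho y)) (pi_gt0 R).
rewrite arcpt0 arcptpi => ->.
- apply: eq_Int => t /andP[t0 tpi].
  have r0 := rho_gt0 (arcpt_itv t).
  have [s sp ->] := sqrt_ex r0.
  have E1 : (Y t - a) * (b - Y t) = ((b - a) / 2 * sin t) ^+ 2.
    by rewrite exprMn sin2cos2 /arcpt; field.
  rewrite E1 -exprMn !sqrtr_sqr (gtr0_norm sp) ger0_norm; last first.
    rewrite mulr_ge0 ?(ltW sp)// mulr_ge0 ?divr_ge0 ?subr_ge0 ?(ltW ab)//.
    by apply: sin_ge0_pi; rewrite t0.
  by field; rewrite gt_eqF.
- by move=> t _; exact: arcpt_cont.
- by move=> t _; cont.
- by move=> t _; exact: arcpt_der.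
- move=> t /andP[t0 tpi]; rewrite mulr_gt0 ?divr_gt0 ?subr_gt0//.
  by apply: sin_gt0_pi; rewrite t0.
by move=> y yab; have := cg _ yab; have := rho_cts yab => *; cont.
Qed.

End Arc.

(** * Equality of the two band periods *)

Section Period.
Context {R : realType}.
Implicit Types (x t l : R).

Lemma cos_2atan x : cos (2 * atan x) = (1 - x ^+ 2) / (1 + x ^+ 2).
Proof.
have x0 : 0 < 1 + x ^+ 2 by rewrite ltr_pwDl// sqr_ge0.
rewrite mulr_natl cos_mulr2n cos_atan exprVn sqr_sqrtr ?ltW//.
by rewrite mulr2n; field; rewrite gt_eqF.
Qed.

Lemma sin_2atan x : sin (2 * atan x) = 2 * x / (1 + x ^+ 2).
Proof.
have x0 : 0 < 1 + x ^+ 2 by rewrite ltr_pwDl// sqr_ge0.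
have c0 : cos (atan x) != 0 by rewrite cos_atan invr_eq0 gt_eqF// sqrtr_gt0.
have -> : sin (2 * atan x) = 2 * x * cos (atan x) ^+ 2.
  have xE : sin (atan x) = x * cos (atan x) by rewrite -[X in X * _]atanK /tan divfK.
  by rewrite mulr_natl sin_mulr2n xE mulr2n; ring.
by rewrite cos_atan exprVn sqr_sqrtr ?ltW.
Qed.

(* [tan (half_tan l t / 2) = l * tan (t / 2)], in a form that is smooth on the whole of [0, pi]. *)
Definition half_tan l t : R :=
  t + 2 * atan ((l - 1) * sin t / (1 + l + (1 - l) * cos t)).

Lemma half_tan_den l t : 0 < l -> 0 < 1 + l + (1 - l) * cos t.
Proof.
move=> l0; have := cos_geN1 t; have := cos_le1 t; move: (cos t) => c c1 c2.
have [l1|l1] := lerP l 1.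
  have h : 0 <= (1 - l) * (1 + c) by apply: mulr_ge0; lra.
  by lra.
have h : 0 <= (l - 1) * (1 - c) by apply: mulr_ge0; lra.
by lra.
Qed.

(** With T = tan (t / 2), this is cos = (1 - l^2 T^2) / (1 + l^2 T^2) and T^2 = (1 - cos t) / (1 +
    cos t), cleared of denominators so that t = pi is allowed. *)
Lemma cos_half_tan l t : 0 < l ->
  cos (half_tan l t) = ((1 + cos t) - l ^+ 2 * (1 - cos t)) / ((1 + cos t) + l ^+ 2 * (1 - cos t)).
Proof.
move=> l0; rewrite /half_tan cosD cos_2atan sin_2atan.
have d0 := half_tan_den t l0.
have := sin2cos2 t; move: (sin t) (cos t) d0 => S C d0 SC.
have SC' : S ^+ 2 = (1 - C) * (1 + C) by rewrite SC; ring.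
have e0 : 1 + C + l ^+ 2 * (1 - C) != 0.
  have d2 : 0 < (1 + l + (1 - l) * C) ^+ 2 by rewrite exprn_gt0.
  have s2 := sqr_ge0 ((l - 1) * S).
  apply: lt0r_neq0; suff : 0 < 2 * (1 + C + l ^+ 2 * (1 - C)) by rewrite pmulr_rgt0.
  rewrite (_ : 2 * _ = ((1 + l + (1 - l) * C) ^+ 2 + ((l - 1) * S) ^+ 2)); first by lra.
  by rewrite exprMn SC; ring.
have E : (1 + l + (1 - l) * C) ^+ 2 + ((l - 1) * S) ^+ 2 = 2 * (1 + C + l ^+ 2 * (1 - C)).
  by rewrite exprMn SC; ring.
set N := (l - 1) * S; set d := 1 + l + (1 - l) * C.
have E1 : (1 - (N / d) ^+ 2) / (1 + (N / d) ^+ 2) = (d ^+ 2 - N ^+ 2) / (2 * (1 + C + l ^+ 2 * (1 - C))).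
  rewrite -E -/N -/d; field.
  rewrite -/N -/d in E; rewrite E mulf_neq0//= gt_eqF//.
have E2 : 2 * (N / d) / (1 + (N / d) ^+ 2) = 2 * N * d / (2 * (1 + C + l ^+ 2 * (1 - C))).
  rewrite -E -/N -/d; field.
  rewrite -/N -/d in E; rewrite E mulf_neq0//= gt_eqF//.
rewrite E1 E2 (_ : S * _ = S ^+ 2 * (2 * (l - 1) * d) / (2 * (1 + C + l ^+ 2 * (1 - C)))); last first.
  by rewrite /N; field.
by rewrite /N exprMn SC' /d; field.
Qed.

Lemma half_tan_der l t : 0 < l ->
  der t (half_tan l) (2 * l / ((1 + cos t) + l ^+ 2 * (1 - cos t))).
Proof.
move=> l0; have d0 := half_tan_den t l0.
apply: der_eq.
  apply: isdD; first exact: isdI.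
  apply: isdM; first exact: isdC.
  apply: (@isdcomp _ _ (@atan R) (fun t => (l - 1) * sin t / (1 + l + (1 - l) * cos t))).
    exact: is_derive1_atan.
  apply: isdM; first by isd.
  by apply: isdV; [rewrite gt_eqF|isd].
rewrite /=.
have := sin2cos2 t; move: (sin t) (cos t) d0 => S C d0 SC.
have E : (1 + l + (1 - l) * C) ^+ 2 + ((l - 1) * S) ^+ 2 = 2 * (1 + C + l ^+ 2 * (1 - C)).
  by rewrite exprMn SC; ring.
have e0 : 0 < 2 * (1 + C + l ^+ 2 * (1 - C)).
  have d2 : 0 < (1 + l + (1 - l) * C) ^+ 2 by rewrite exprn_gt0.
  have s2 := sqr_ge0 ((l - 1) * S).
  by rewrite -E; lra.
set d := 1 + l + (1 - l) * C in d0 E *.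
have -> : (1 + ((l - 1) * S / d) ^+ 2)^-1 = d ^+ 2 / (2 * (1 + C + l ^+ 2 * (1 - C))).
  by rewrite -E; field; rewrite E !gt_eqF.
have e1 : 1 + C + l ^+ 2 * (1 - C) != 0 by apply: lt0r_neq0; rewrite -(pmulr_rgt0 _ (ltr0Sn R 1)).
set w := (X in 0 * _ + 2 * (_ * X)).
have wE : d ^+ 2 * w = (l - 1) * (C * d + (1 - l) * S ^+ 2).
  by rewrite /w; field; rewrite gt_eqF.
rewrite (_ : 0 * _ + _ = d ^+ 2 * w / (1 + C + l ^+ 2 * (1 - C))); last by field.
by rewrite wE SC /d; field.
Qed.

Lemma half_tan0 l : 0 < l -> half_tan l 0 = 0.
Proof. by move=> l0; rewrite /half_tan sin0 mulr0 mul0r atan0; ring. Qed.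
Lemma half_tanpi l : 0 < l -> half_tan l pi = pi.
Proof. by move=> l0; rewrite /half_tan sinpi mulr0 mul0r atan0; ring. Qed.

(* The substitution [half_tan l] with [l ^+ 2 = B / C] is the Moebius involution exchanging two bands. *)
Lemma period_swap (A B C D : R) : 0 < A -> 0 < B -> 0 < C -> 0 < D ->
  Int 0 pi (fun t => (Num.sqrt ((A * (1 + cos t) + B * (1 - cos t)) * (C * (1 + cos t) + D * (1 - cos t))))^-1) =
  Int 0 pi (fun t => (Num.sqrt ((A * (1 + cos t) + C * (1 - cos t)) * (B * (1 + cos t) + D * (1 - cos t))))^-1).
Proof.
move=> A0 B0 C0 D0.
have [l l0 lE] := sqrt_ex (divr_gt0 B0 C0).
have BE : B = l ^+ 2 * C by rewrite -lE divfK// gt_eqF.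
have lin_gt0 (X Y t : R) : 0 < X -> 0 < Y -> 0 < X * (1 + cos t) + Y * (1 - cos t).
  move=> X0 Y0; have := cos_geN1 t; have := cos_le1 t; move: (cos t) => c c1 c2.
  have h1 : 0 <= X * (1 + c) by apply: mulr_ge0; lra.
  have h2 : 0 <= Y * (1 - c) by apply: mulr_ge0; lra.
  have [c0|c0] := lerP 0 c.
    have h3 : 0 < X * (1 + c) by apply: mulr_gt0; lra.
    by lra.
  have h3 : 0 < Y * (1 - c) by apply: mulr_gt0; lra.
  by lra.
pose G t := (Num.sqrt ((A * (1 + cos t) + C * (1 - cos t)) * (B * (1 + cos t) + D * (1 - cos t))))^-1.
have cG t : {for t, continuous G}.
  rewrite /G; apply: contV; last by cont.
  by rewrite gt_eqF// sqrtr_gt0 mulr_gt0 ?lin_gt0.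
have H t : 0 < 1 + cos t + l ^+ 2 * (1 - cos t).
  by have := @lin_gt0 1 (l ^+ 2) t ltr01 (exprn_gt0 2 l0); rewrite mul1r.
have := @Int_subst R 0 pi (half_tan l) (fun t => 2 * l / (1 + cos t + l ^+ 2 * (1 - cos t))) G (pi_gt0 R).
rewrite half_tan0// half_tanpi// => ->; first last.
- by move=> t _; exact: cG.
- by move=> t _; rewrite divr_gt0// mulr_gt0.
- by move=> t _; exact: half_tan_der.
- by move=> t _; cont; rewrite gt_eqF.
- by move=> t _; exact/is_derive_cont/half_tan_der.
apply: eq_Int => t _; rewrite /G cos_half_tan//.
set c := cos t; set dd := 1 + c + l ^+ 2 * (1 - c).
have dd0 : 0 < dd by exact: H.
(* The substitution turns the radicand into the other one times the square of the Jacobian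
   [2 * l / dd], so the Jacobian cancels under the root. *)
have -> : (A * (1 + (1 + c - l ^+ 2 * (1 - c)) / dd) + C * (1 - (1 + c - l ^+ 2 * (1 - c)) / dd)) *
   (B * (1 + (1 + c - l ^+ 2 * (1 - c)) / dd) + D * (1 - (1 + c - l ^+ 2 * (1 - c)) / dd)) =
   (2 * l / dd) ^+ 2 * ((A * (1 + c) + B * (1 - c)) * (C * (1 + c) + D * (1 - c))).
  by rewrite BE /dd; field; rewrite -/dd gt_eqF.
have k0 : 0 < 2 * l / dd by rewrite divr_gt0// mulr_gt0.
rewrite (sqrtrM _ (sqr_ge0 (2 * l / dd))) sqrtr_sqr gtr0_norm// invfM mulrAC mulVf ?mul1r// gt_eqF//.
Qed.


End Period.

(** * Resolvents of functionals annihilating exact forms *)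

Section Functional.
Context {R : realType}.
Implicit Types (S : R -> Prop) (f g : R -> R) (x y e : R).

Definition ctsOn S f := forall y, S y -> {for y, continuous f}.

Variables (s1 s2 s3 s4 : R).
Definition quart y := y ^+ 4 - s1 * y ^+ 3 + s2 * y ^+ 2 - s3 * y + s4.
Definition dquart y := 4 * y ^+ 3 - 3 * s1 * y ^+ 2 + 2 * s2 * y - s3.

Lemma quart_cont y : {for y, continuous quart}.
Proof. by rewrite /quart; cont. Qed.
Lemma dquart_cont y : {for y, continuous dquart}.
Proof. by rewrite /dquart; cont. Qed.

(** These are the properties of integration against dy / sqrt |Q| on which the resolvent equation
    rests; they hold for either band and for the signed difference alike. [fun_exact] is integration
    by parts: Q'/2 g + Q g' is sqrt Q times the derivative of sqrt Q g. *)
Record functional S (L : (R -> R) -> R) : Prop := Functional {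
  fun_ext : forall f g, (forall y, S y -> f y = g y) -> L f = L g ;
  fun_add : forall f g, ctsOn S f -> ctsOn S g -> L (fun y => f y + g y) = L f + L g ;
  fun_scale : forall k f, ctsOn S f -> L (fun y => k * f y) = k * L f ;
  fun_derive : forall (u v x0 K : R) (g dg : R -> R -> R), u < x0 < v ->
    (forall x, u < x < v -> ctsOn S (g x)) ->
    (forall x y, u < x < v -> S y -> der x (g^~ y) (dg x y)) ->
    (forall x y, u < x < v -> S y -> `|dg x y| <= K) ->
    der x0 (fun x => L (g x)) (L (dg x0)) ;
  fun_exact : forall g dg, (forall y, S y -> der y g (dg y)) -> ctsOn S dg ->
    L (fun y => dquart y / 2 * g y + quart y * dg y) = 0 }.

Variables (S : R -> Prop) (L : (R -> R) -> R).
Hypothesis HL : functional S L.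

Lemma fun_lin3 k1 k2 k3 f1 f2 f3 : ctsOn S f1 -> ctsOn S f2 -> ctsOn S f3 ->
  L (fun y => k1 * f1 y + k2 * f2 y + k3 * f3 y) = k1 * L f1 + k2 * L f2 + k3 * L f3.
Proof.
move=> c1 c2 c3; have [_ ad sc _ _] := HL.
have cs k f : ctsOn S f -> ctsOn S (fun y => k * f y).
  by move=> cf y /cf ?; cont.
rewrite (ad (fun y => k1 * f1 y + k2 * f2 y)) ?ad ?sc//; try exact: cs.
by move=> y Sy; apply: contD; apply: cs.
Qed.

(* [kre x e y + i kim x e y = 1 / (x + i e - y)], and [kre2 + i kim2] is its square. *)
Definition kden x e y : R := (x - y) ^+ 2 + e ^+ 2.
Definition kre x e y : R := (x - y) / kden x e y.
Definition kim x e y : R := - (e / kden x e y).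
Definition kre2 x e y : R := ((x - y) ^+ 2 - e ^+ 2) / kden x e y ^+ 2.
Definition kim2 x e y : R := - (2 * (x - y) * e / kden x e y ^+ 2).

(** [Qre + i Qim] is Q(x + i e) and [dQre + i dQim] is Q'(x + i e), by Taylor expansion in [e]. *)
Definition Qre x e : R := quart x - e ^+ 2 * (6 * x ^+ 2 - 3 * s1 * x + s2) + e ^+ 4.
Definition Qim x e : R := e * dquart x - e ^+ 3 * (4 * x - s1).
Definition dQre x e : R := dquart x - 3 * e ^+ 2 * (4 * x - s1).
Definition dQim x e : R := 2 * e * (6 * x ^+ 2 - 3 * s1 * x + s2) - 4 * e ^+ 3.

Definition off x e := forall y, S y -> kden x e y != 0.

Lemma kden_cont x e y : {for y, continuous (kden x e)}.
Proof. by rewrite /kden; cont. Qed.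

Lemma kre_cont x e : off x e -> ctsOn S (kre x e).
Proof.
move=> xe y Sy; have kc := @kden_cont x e y; have k0 := xe _ Sy.
by rewrite /kre; apply: contM; [cont|apply: contV].
Qed.
Lemma kim_cont x e : off x e -> ctsOn S (kim x e).
Proof.
move=> xe y Sy; have kc := @kden_cont x e y; have k0 := xe _ Sy.
by rewrite /kim; apply: contN; apply: contM; [cont|apply: contV].
Qed.
Lemma kre2_cont x e : off x e -> ctsOn S (kre2 x e).
Proof.
move=> xe y Sy; have kc := @kden_cont x e y; have k0 := xe _ Sy.
by rewrite /kre2; apply: contM; [cont|apply: contV; [by rewrite expf_eq0|cont]].
Qed.
Lemma kim2_cont x e : off x e -> ctsOn S (kim2 x e).
Proof.
move=> xe y Sy; have kc := @kden_cont x e y; have k0 := xe _ Sy.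
by rewrite /kim2; apply: contN; apply: contM; [cont|apply: contV; [by rewrite expf_eq0|cont]].
Qed.

Lemma kre_der_y x e y : kden x e y != 0 -> der y (kre x e) (kre2 x e y).
Proof.
move=> d0; apply: der_eq; first by rewrite /kre /kden; isd.
by rewrite /= /kre2 /kden; field.
Qed.
Lemma kim_der_y x e y : kden x e y != 0 -> der y (kim x e) (kim2 x e y).
Proof.
move=> d0; apply: der_eq; first by rewrite /kim /kden; isd.
by rewrite /= /kim2 /kden; field.
Qed.
Lemma kre_der_x x e y : kden x e y != 0 -> der x (fun x => kre x e y) (- kre2 x e y).
Proof.
move=> d0; apply: der_eq; first by rewrite /kre /kden; isd.
by rewrite /= /kre2 /kden; field.
Qed.
Lemma kim_der_x x e y : kden x e y != 0 -> der x (fun x => kim x e y) (- kim2 x e y).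
Proof.
move=> d0; apply: der_eq; first by rewrite /kim /kden; isd.
by rewrite /= /kim2 /kden; field.
Qed.
Lemma kre_der_e x e y : kden x e y != 0 -> der e (fun e => kre x e y) (kim2 x e y).
Proof.
move=> d0; apply: der_eq; first by rewrite /kre /kden; isd.
by rewrite /= /kim2 /kden; field.
Qed.
Lemma kim_der_e x e y : kden x e y != 0 -> der e (fun e => kim x e y) (- kre2 x e y).
Proof.
move=> d0; apply: der_eq; first by rewrite /kim /kden; isd.
by rewrite /= /kre2 /kden; field.
Qed.

Local Notation m0 := (L (fun=> 1)).
Local Notation m1 := (L (fun y => y)).
Local Notation m2 := (L (fun y => y ^+ 2)).

Let c0 : ctsOn S (fun=> 1). Proof. by move=> y _; cont. Qed.
Let c1 : ctsOn S (fun y => y). Proof. by move=> y _; cont. Qed.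
Let c2 : ctsOn S (fun y => y ^+ 2). Proof. by move=> y _; cont. Qed.

Lemma fun_lin7 (k1 k2 k3 k4 k5 k6 k7 : R) f1 f2 f3 f4 : ctsOn S f1 -> ctsOn S f2 -> ctsOn S f3 -> ctsOn S f4 ->
  L (fun y => k1 * f1 y + k2 * f2 y + k3 * f3 y + k4 * f4 y + (k5 * 1 + k6 * y + k7 * y ^+ 2)) =
  k1 * L f1 + k2 * L f2 + k3 * L f3 + k4 * L f4 + (k5 * m0 + k6 * m1 + k7 * m2).
Proof.
move=> h1 h2 h3 h4.
have cs k f : ctsOn S f -> ctsOn S (fun y => k * f y).
  by move=> cf y /cf ?; cont.
have cl3 l1 l2 l3 g1 g2 g3 : ctsOn S g1 -> ctsOn S g2 -> ctsOn S g3 ->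
    ctsOn S (fun y => l1 * g1 y + l2 * g2 y + l3 * g3 y).
  by move=> hg1 hg2 hg3 y Sy; have := hg1 _ Sy; have := hg2 _ Sy; have := hg3 _ Sy => *; cont.
rewrite (fun_add HL (f := fun y => k1 * f1 y + k2 * f2 y + k3 * f3 y + k4 * f4 y)
  (g := fun y => k5 * 1 + k6 * y + k7 * y ^+ 2)).
- rewrite (fun_add HL (f := fun y => k1 * f1 y + k2 * f2 y + k3 * f3 y)); [|exact: cl3|exact: cs].
  by rewrite (fun_lin3 _ _ _ h1 h2 h3) (fun_lin3 _ _ _ c0 c1 c2) (fun_scale HL).
- by move=> y Sy; apply: contD; [exact: cl3|exact: cs].
- exact: cl3.
Qed.

(** Take g = 1 / (z - y) in [fun_exact] with z = x + i e. Expanding Q and Q' at z, the integrand is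
    Q(z) / (z - y)^2 - Q'(z) / (2 (z - y)) plus a quadratic polynomial in y, whose moments form the
    right-hand side. This is the real part; [ode_im] is the imaginary part. *)
Lemma ode_re x e : off x e ->
  (dQre x e * L (kre x e) - dQim x e * L (kim x e)) / 2 - (Qre x e * L (kre2 x e) - Qim x e * L (kim2 x e))
  = (x ^+ 2 - e ^+ 2 - s1 / 2 * x) * m0 + s1 / 2 * m1 - m2.
Proof.
move=> xe.
have := fun_exact HL (fun y Sy => kre_der_y (xe y Sy)) (kre2_cont xe).
rewrite (fun_ext HL (g := fun y => (- dQre x e / 2) * kre x e y + (dQim x e / 2) * kim x e y
   + Qre x e * kre2 x e y + (- Qim x e) * kim2 x e y
   + ((x ^+ 2 - e ^+ 2 - s1 / 2 * x) * 1 + (s1 / 2) * y + (-1) * y ^+ 2))).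
  rewrite fun_lin7; [|exact: kre_cont|exact: kim_cont|exact: kre2_cont|exact: kim2_cont].
  by lra.
move=> y Sy; have := xe y Sy.
rewrite /kre /kim /kre2 /kim2 /kden /dQre /dQim /Qre /Qim /quart /dquart => d0.
by field.
Qed.

Lemma ode_im x e : off x e ->
  (dQre x e * L (kim x e) + dQim x e * L (kre x e)) / 2 - (Qre x e * L (kim2 x e) + Qim x e * L (kre2 x e))
  = (2 * x * e - s1 / 2 * e) * m0.
Proof.
move=> xe.
have := fun_exact HL (fun y Sy => kim_der_y (xe y Sy)) (kim2_cont xe).
rewrite (fun_ext HL (g := fun y => (- dQim x e / 2) * kre x e y + (- dQre x e / 2) * kim x e y
   + Qim x e * kre2 x e y + (Qre x e) * kim2 x e y
   + ((2 * x * e - s1 / 2 * e) * 1 + 0 * y + 0 * y ^+ 2))).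
  rewrite fun_lin7; [|exact: kre_cont|exact: kim_cont|exact: kre2_cont|exact: kim2_cont].
  by lra.
move=> y Sy; have := xe y Sy.
rewrite /kre /kim /kre2 /kim2 /kden /dQre /dQim /Qre /Qim /quart /dquart => d0.
by field.
Qed.

Lemma fun_opp f : ctsOn S f -> L (fun y => - f y) = - L f.
Proof.
move=> cf; rewrite -mulN1r -(fun_scale HL)//; apply: (fun_ext HL) => y _.
by rewrite mulN1r.
Qed.

Lemma kim2_bound x e y d : 0 < d -> d <= kden x e y -> `|kim2 x e y| <= d^-1.
Proof.
move=> d0 dk; have k0 : 0 < kden x e y by exact: lt_le_trans dk.
rewrite /kim2 normrN normrM normfV normrX (gtr0_norm k0) ler_pdivrMr ?exprn_gt0//.
apply: (@le_trans _ _ (kden x e y)).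
  rewrite /kden ler_norml; apply/andP; split.
    by rewrite -subr_ge0 (_ : _ - _ = (x - y + e) ^+ 2) ?sqr_ge0//; ring.
  by rewrite -subr_ge0 (_ : _ - _ = (x - y - e) ^+ 2) ?sqr_ge0//; ring.
by rewrite expr2 mulrA ler_peMl ?(ltW k0)// ler_pdivlMl ?mulr1.
Qed.

Lemma kre2_bound x e y d : 0 < d -> d <= kden x e y -> `|kre2 x e y| <= d^-1.
Proof.
move=> d0 dk; have k0 : 0 < kden x e y by exact: lt_le_trans dk.
rewrite /kre2 normrM normfV normrX (gtr0_norm k0) ler_pdivrMr ?exprn_gt0//.
apply: (@le_trans _ _ (kden x e y)).
  rewrite /kden ler_norml; apply/andP; split.
    by have := sqr_ge0 (x - y); lra.
  by have := sqr_ge0 e; lra.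
by rewrite expr2 mulrA ler_peMl ?(ltW k0)// ler_pdivlMl ?mulr1.
Qed.

Lemma off_ge d x e : 0 < d -> (forall y, S y -> d <= kden x e y) -> off x e.
Proof. by move=> d0 H y /H dk; rewrite gt_eqF// (lt_le_trans d0). Qed.

Section der_e.
Variables (x u v e0 d : R).
Hypotheses (d0 : 0 < d) (ue : u < e0 < v) (Hd : forall e y, u < e < v -> S y -> d <= kden x e y).

Let offe e : u < e < v -> off x e.
Proof. by move=> euv; apply: off_ge d0 _ => y; exact: Hd. Qed.

Lemma L_kre_der_e : der e0 (fun e => L (kre x e)) (L (kim2 x e0)).
Proof.
apply: (fun_derive HL (K := d^-1) ue).
- by move=> e euv; exact/kre_cont/offe.
- by move=> e y euv Sy; exact/kre_der_e/(offe euv Sy).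
- by move=> e y euv Sy; apply: kim2_bound => //; exact: Hd.
Qed.

Lemma L_kim_der_e : der e0 (fun e => L (kim x e)) (- L (kre2 x e0)).
Proof.
rewrite -fun_opp; last exact/kre2_cont/offe.
apply: (fun_derive HL (dg := fun e y => - kre2 x e y) (K := d^-1) ue).
- by move=> e euv; exact/kim_cont/offe.
- by move=> e y euv Sy; exact/kim_der_e/(offe euv Sy).
- by move=> e y euv Sy; rewrite normrN; apply: kre2_bound => //; exact: Hd.
Qed.
End der_e.

Section der_x.
Variables (e u v x0 d : R).
Hypotheses (d0 : 0 < d) (ux : u < x0 < v) (Hd : forall x y, u < x < v -> S y -> d <= kden x e y).

Let offx x : u < x < v -> off x e.
Proof. by move=> xuv; apply: off_ge d0 _ => y; exact: Hd. Qed.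

Lemma L_kre_der_x : der x0 (fun x => L (kre x e)) (- L (kre2 x0 e)).
Proof.
rewrite -fun_opp; last exact/kre2_cont/offx.
apply: (fun_derive HL (g := fun x y => kre x e y) (dg := fun x y => - kre2 x e y) (K := d^-1) ux).
- by move=> x xuv; exact/kre_cont/offx.
- by move=> x y xuv Sy; exact/kre_der_x/(offx xuv Sy).
- by move=> x y xuv Sy; rewrite normrN; apply: kre2_bound => //; exact: Hd.
Qed.

Lemma L_kim_der_x : der x0 (fun x => L (kim x e)) (- L (kim2 x0 e)).
Proof.
rewrite -fun_opp; last exact/kim2_cont/offx.
apply: (fun_derive HL (g := fun x y => kim x e y) (dg := fun x y => - kim2 x e y) (K := d^-1) ux).
- by move=> x xuv; exact/kim_cont/offx.
- by move=> x y xuv Sy; exact/kim_der_x/(offx xuv Sy).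
- by move=> x y xuv Sy; rewrite normrN; apply: kim2_bound => //; exact: Hd.
Qed.
End der_x.

Hypothesis m0E : m0 = 0.
Hypothesis m2E : m2 = s1 / 2 * m1.

(** Real and imaginary parts of Q(z) r(z)^2, where r(z) = L(1 / (z - y)) and z = x + i e. *)
Definition Phire x e := Qre x e * (L (kre x e) ^+ 2 - L (kim x e) ^+ 2) - 2 * Qim x e * L (kre x e) * L (kim x e).
Definition Phiim x e := Qim x e * (L (kre x e) ^+ 2 - L (kim x e) ^+ 2) + 2 * Qre x e * L (kre x e) * L (kim x e).

(** Under the two moment hypotheses the equation is Q r' + Q' r / 2 = 0, which says (Q r^2)' = 0;
    along a vertical line d/de is i d/dz. *)
Lemma Phi_der_e x u v e0 d : 0 < d -> u < e0 < v ->
  (forall e y, u < e < v -> S y -> d <= kden x e y) ->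
  der e0 (Phire x) 0 /\ der e0 (Phiim x) 0.
Proof.
move=> d0 ue Hd.
have xe : off x e0 by apply: off_ge d0 _ => y; exact: Hd.
have h1 := L_kre_der_e d0 ue Hd; have h2 := L_kim_der_e d0 ue Hd.
have e1 := ode_re xe; have e2 := ode_im xe.
have q1 : der e0 (Qre x) (- dQim x e0).
  by apply: der_eq; [rewrite /Qre; isd|rewrite /dQim /=; ring].
have q2 : der e0 (Qim x) (dQre x e0).
  by apply: der_eq; [rewrite /Qim; isd|rewrite /dQre /=; ring].
move: e1 e2; rewrite m0E m2E => e1 e2; split.
  apply: der_eq; first by rewrite /Phire; isd.
  rewrite /=; move: (L (kre x e0)) (L (kim x e0)) (L (kre2 x e0)) (L (kim2 x e0)) e1 e2 {h1 h2 q1 q2} => A B E F.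
  move: (Qre x e0) (Qim x e0) (dQre x e0) (dQim x e0) => r1 r2 d1 d2 e1 e2.
  have e1' : r1 * E - r2 * F = (d1 * A - d2 * B) / 2 by lra.
  have e2' : r1 * F + r2 * E = (d1 * B + d2 * A) / 2 by lra.
  transitivity (- d2 * (A ^+ 2 - B ^+ 2) - 2 * d1 * A * B + 2 * A * (r1 * F + r2 * E) + 2 * B * (r1 * E - r2 * F)); first by ring.
  by rewrite e1' e2'; field.
apply: der_eq; first by rewrite /Phiim; isd.
rewrite /=; move: (L (kre x e0)) (L (kim x e0)) (L (kre2 x e0)) (L (kim2 x e0)) e1 e2 {h1 h2 q1 q2} => A B E F.
move: (Qre x e0) (Qim x e0) (dQre x e0) (dQim x e0) => r1 r2 d1 d2 e1 e2.
have e1' : r1 * E - r2 * F = (d1 * A - d2 * B) / 2 by lra.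
have e2' : r1 * F + r2 * E = (d1 * B + d2 * A) / 2 by lra.
transitivity (d1 * (A ^+ 2 - B ^+ 2) - 2 * d2 * A * B - 2 * A * (r1 * E - r2 * F) + 2 * B * (r1 * F + r2 * E)); first by ring.
by rewrite e1' e2'; field.
Qed.

Lemma Phi_der_x e u v x0 d : 0 < d -> u < x0 < v ->
  (forall x y, u < x < v -> S y -> d <= kden x e y) ->
  der x0 (Phire^~ e) 0 /\ der x0 (Phiim^~ e) 0.
Proof.
move=> d0 ux Hd.
have xe : off x0 e by apply: off_ge d0 _ => y; exact: Hd.
have h1 := L_kre_der_x d0 ux Hd; have h2 := L_kim_der_x d0 ux Hd.
have e1 := ode_re xe; have e2 := ode_im xe.
have q1 : der x0 (Qre^~ e) (dQre x0 e).
  by apply: der_eq; [rewrite /Qre /quart; isd|rewrite /dQre /dquart /=; ring].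
have q2 : der x0 (Qim^~ e) (dQim x0 e).
  by apply: der_eq; [rewrite /Qim /dquart; isd|rewrite /dQim /=; ring].
move: e1 e2; rewrite m0E m2E => e1 e2; split.
  apply: der_eq; first by rewrite /Phire; isd.
  rewrite /=; move: (L (kre x0 e)) (L (kim x0 e)) (L (kre2 x0 e)) (L (kim2 x0 e)) e1 e2 {h1 h2 q1 q2} => A B E F.
  move: (Qre x0 e) (Qim x0 e) (dQre x0 e) (dQim x0 e) => r1 r2 d1 d2 e1 e2.
  have e1' : r1 * E - r2 * F = (d1 * A - d2 * B) / 2 by lra.
  have e2' : r1 * F + r2 * E = (d1 * B + d2 * A) / 2 by lra.
  transitivity (d1 * (A ^+ 2 - B ^+ 2) - 2 * d2 * A * B - 2 * A * (r1 * E - r2 * F) + 2 * B * (r1 * F + r2 * E)); first by ring.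
  by rewrite e1' e2'; field.
apply: der_eq; first by rewrite /Phiim; isd.
rewrite /=; move: (L (kre x0 e)) (L (kim x0 e)) (L (kre2 x0 e)) (L (kim2 x0 e)) e1 e2 {h1 h2 q1 q2} => A B E F.
move: (Qre x0 e) (Qim x0 e) (dQre x0 e) (dQim x0 e) => r1 r2 d1 d2 e1 e2.
have e1' : r1 * E - r2 * F = (d1 * A - d2 * B) / 2 by lra.
have e2' : r1 * F + r2 * E = (d1 * B + d2 * A) / 2 by lra.
transitivity (d2 * (A ^+ 2 - B ^+ 2) + 2 * d1 * A * B - 2 * A * (r1 * F + r2 * E) - 2 * B * (r1 * E - r2 * F)); first by ring.
by rewrite e1' e2'; field.
Qed.

(** Constancy is propagated along a broken line: up from the real point [x0] off [S] to height 1,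
    across to [x], then vertically to height [e]. Other real points off [S] are reached by going
    back down. *)
Lemma Phi_const x0 d : 0 < d -> (forall y, S y -> d <= (x0 - y) ^+ 2) ->
  let C := quart x0 * L (kre x0 0) ^+ 2 in
  (forall x e, 0 < e -> Phire x e = C /\ Phiim x e = 0) /\
  (forall x d, 0 < d -> (forall y, S y -> d <= (x - y) ^+ 2) -> quart x * L (kre x 0) ^+ 2 = C).
Proof.
move=> d0 Hd C.
have line x d' : 0 < d' -> (forall y, S y -> d' <= (x - y) ^+ 2) ->
    Phire x 1 = quart x * L (kre x 0) ^+ 2 /\ Phiim x 1 = 0.
  move=> d0' Hd'.
  have H e y : -2 < e < 2 -> S y -> d' <= kden x e y.
    by move=> _ /Hd' h; rewrite /kden; have := sqr_ge0 e; lra.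
  have D e : -2 < e < 2 -> der e (Phire x) 0 /\ der e (Phiim x) 0.
    by move=> euv; exact: (Phi_der_e d0' euv H).
  have i1 : -2 < (1 : R) < 2 by apply/andP; split; lra.
  have i0 : -2 < (0 : R) < 2 by apply/andP; split; lra.
  have B0 : L (kim x 0) = 0.
    rewrite (fun_ext HL (g := fun=> 0 * 1)) ?(fun_scale HL) ?mul0r//.
    by move=> y _; rewrite /kim !mul0r oppr0.
  split.
    rewrite (derive0_const (fun e h => (D e h).1) i1 i0) /Phire B0.
    by rewrite /Qre /Qim; ring.
  rewrite (derive0_const (fun e h => (D e h).2) i1 i0) /Phiim B0.
  by rewrite /Qre /Qim; ring.
have e1 x : Phire x 1 = C /\ Phiim x 1 = 0.
  have [L1 L2] := line _ _ d0 Hd; rewrite /C -L1 -L2.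
  pose m := `|x| + `|x0| + 1.
  have H z y : - m < z < m -> S y -> (1 : R) <= kden z 1 y.
    by move=> _ _; rewrite /kden expr1n; have := sqr_ge0 (z - y); lra.
  have D z : - m < z < m -> der z (Phire^~ 1) 0 /\ der z (Phiim^~ 1) 0.
    by move=> zuv; exact: (Phi_der_x ltr01 zuv H).
  have ix : - m < x < m.
    by rewrite -ltr_norml /m -addrA ltrDl ltr_wpDl.
  have ix0 : - m < x0 < m.
    by rewrite -ltr_norml /m addrAC ltrDr ltr_wpDl.
  split; first exact: (derive0_const (fun e h => (D e h).1) ix ix0).
  exact: (derive0_const (fun e h => (D e h).2) ix ix0).
split; last first.
  by move=> x d' d0' Hd'; have [L1 _] := line _ _ d0' Hd'; rewrite -L1; exact: (e1 x).1.
move=> x e ep; have [<- <-] := e1 x.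
(* The open interval of heights from [m] to [e + 1] contains both [e] and 1 and stays away from the
   real line. *)
pose m := Num.min e 1 / 2.
have m0' : 0 < m by rewrite divr_gt0// lt_min ep ltr01.
have me : m < e.
  have : Num.min e 1 <= e by rewrite ge_min lexx.
  by rewrite /m; lra.
have m1' : m < 1.
  have : Num.min e 1 <= 1 by rewrite ge_min lexx orbT.
  by rewrite /m; lra.
have H z y : m < z < e + 1 -> S y -> m ^+ 2 <= kden x z y.
  move=> /andP[mz _] _; rewrite /kden; have := sqr_ge0 (x - y).
  have : m ^+ 2 <= z ^+ 2 by apply: lerXn2r; rewrite ?nnegrE ltW// (lt_trans m0').
  by lra.
have D z : m < z < e + 1 -> der z (Phire x) 0 /\ der z (Phiim x) 0.
  by move=> zuv; exact: (Phi_der_e (exprn_gt0 2 m0') zuv H).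
have i1 : m < e < e + 1 by rewrite me/= ltrDl.
have i2 : m < 1 < e + 1 by rewrite m1'/= ltrDr.
split; first exact: (derive0_const (fun e h => (D e h).1) i1 i2).
exact: (derive0_const (fun e h => (D e h).2) i1 i2).
Qed.

End Functional.

(** * The signed functional of two bands and its first moments *)

Section TwoCut.
Context {R : realType}.
Variables (a1 b1 a2 b2 : R).
Hypotheses (h1 : a1 < b1) (h2 : b1 < a2) (h3 : a2 < b2).
Implicit Types (x y e : R) (f g : R -> R).

Definition sym1 := a1 + b1 + a2 + b2.
Definition sym2 := a1 * b1 + a1 * a2 + a1 * b2 + b1 * a2 + b1 * b2 + a2 * b2.
Definition sym3 := a1 * b1 * a2 + a1 * b1 * b2 + a1 * a2 * b2 + b1 * a2 * b2.
Definition sym4 := a1 * b1 * a2 * b2.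
Local Notation Q := (quart sym1 sym2 sym3 sym4).
Local Notation dQ := (dquart sym1 sym2 sym3).
Local Notation functional := (functional sym1 sym2 sym3 sym4).

Lemma quartE y : Q y = (y - a1) * (y - b1) * (y - a2) * (y - b2).
Proof. by rewrite /quart /sym1 /sym2 /sym3 /sym4; ring. Qed.

Definition band1 y := a1 <= y <= b1.
Definition band2 y := a2 <= y <= b2.
Definition bands y := band1 y || band2 y.

Lemma bandsE y : bands y = (a1 <= y <= b1) || (a2 <= y <= b2).
Proof. by []. Qed.

Definition arc1 := arc a1 b1 (fun y => (a2 - y) * (b2 - y)).
Definition arc2 := arc a2 b2 (fun y => (y - a1) * (y - b1)).
(** The relative sign is that of the boundary values of the branch of sqrt Q on the two bands; with
    it the resolvent is a constant multiple of Q^(-1/2). *)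
Definition arcs g := arc2 g - arc1 g.

Let rho1_gt0 y : a1 <= y <= b1 -> 0 < (a2 - y) * (b2 - y).
Proof. by move=> /andP[? ?]; have H2 := h2; have H3 := h3; apply: mulr_gt0; lra. Qed.
Let rho2_gt0 y : a2 <= y <= b2 -> 0 < (y - a1) * (y - b1).
Proof. by move=> /andP[? ?]; have H2 := h2; have H1 := h1; apply: mulr_gt0; lra. Qed.
Let rho1_der y : a1 <= y <= b1 -> der y (fun y => (a2 - y) * (b2 - y)) (2 * y - a2 - b2).
Proof. by move=> _; apply: der_eq; [isd|rewrite /=; ring]. Qed.
Let rho2_der y : a2 <= y <= b2 -> der y (fun y => (y - a1) * (y - b1)) (2 * y - a1 - b1).
Proof. by move=> _; apply: der_eq; [isd|rewrite /=; ring]. Qed.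
Let drho1_cts : cts a1 b1 (fun y => 2 * y - a2 - b2).
Proof. by move=> y _; cont. Qed.
Let drho2_cts : cts a2 b2 (fun y => 2 * y - a1 - b1).
Proof. by move=> y _; cont. Qed.

Lemma arc1_functional : functional band1 arc1.
Proof.
split.
- by move=> f g; apply: eq_arc.
- by move=> f g cf cg; exact: (arcD h1 rho1_gt0 rho1_der cf cg).
- by move=> k f cf; exact: (arcZ h1 rho1_gt0 rho1_der k cf).
- by move=> u v x0 K g dg ux cg gd gK; exact: (arc_derive h1 rho1_gt0 rho1_der ux cg gd gK).
move=> g dg gd cdg; have E := arc_exact h1 rho1_gt0 rho1_der drho1_cts gd cdg.
have cg : ctsOn band1 g by move=> y /gd; exact: is_derive_cont.
(* Q is negative on the band: it is minus the product (y - a) (b - y) rho of [arc_exact], so the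
   negated identity is proved. *)
apply/eqP; rewrite -oppr_eq0; apply/eqP; rewrite -[RHS]E -mulN1r.
rewrite -(arcZ h1 rho1_gt0 rho1_der); last first.
  move=> y yS; have := @quart_cont _ sym1 sym2 sym3 sym4 y => c1.
  have := @dquart_cont _ sym1 sym2 sym3 y => c2; have c3 := cg _ yS; have c4 := cdg _ yS.
  by cont.
apply: eq_arc => // y _.
by rewrite quartE /dquart /sym1 /sym2 /sym3; field.
Qed.

Lemma arc2_functional : functional band2 arc2.
Proof.
split.
- by move=> f g; apply: eq_arc.
- by move=> f g cf cg; exact: (arcD h3 rho2_gt0 rho2_der cf cg).
- by move=> k f cf; exact: (arcZ h3 rho2_gt0 rho2_der k cf).
- by move=> u v x0 K g dg ux cg gd gK; exact: (arc_derive h3 rho2_gt0 rho2_der ux cg gd gK).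
move=> g dg gd cdg; have E := arc_exact h3 rho2_gt0 rho2_der drho2_cts gd cdg.
have cg : ctsOn band2 g by move=> y /gd; exact: is_derive_cont.
apply/eqP; rewrite -oppr_eq0; apply/eqP; rewrite -[RHS]E -mulN1r.
rewrite -(arcZ h3 rho2_gt0 rho2_der); last first.
  move=> y yS; have := @quart_cont _ sym1 sym2 sym3 sym4 y => c1.
  have := @dquart_cont _ sym1 sym2 sym3 y => c2; have c3 := cg _ yS; have c4 := cdg _ yS.
  by cont.
apply: eq_arc => // y _.
by rewrite quartE /dquart /sym1 /sym2 /sym3; field.
Qed.

Let in1 y : band1 y -> bands y. Proof. by rewrite /bands => ->. Qed.
Let in2 y : band2 y -> bands y. Proof. by rewrite /bands => ->; rewrite orbT. Qed.

Lemma arcs_functional : functional bands arcs.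
Proof.
have F1 := arc1_functional; have F2 := arc2_functional.
split.
- move=> f g fg; rewrite /arcs (fun_ext F1 (g := g)) ?(fun_ext F2 (g := g))// => y yS; apply: fg.
    exact: in2.
  exact: in1.
- move=> f g cf cg; rewrite /arcs (fun_add F1) ?(fun_add F2); first by ring.
  + by move=> y yS; apply/cf/in2.
  + by move=> y yS; apply/cg/in2.
  + by move=> y yS; apply/cf/in1.
  + by move=> y yS; apply/cg/in1.
- move=> k f cf; rewrite /arcs (fun_scale F1) ?(fun_scale F2); first by ring.
  + by move=> y yS; apply/cf/in2.
  + by move=> y yS; apply/cf/in1.
- move=> u v x0 K g dg ux cg gd gK; rewrite /arcs.
  apply: isdD.
    apply: (fun_derive F2 (K := K) ux).
    + by move=> x xuv y yS; apply: cg => //; exact: in2.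
    + by move=> x y xuv yS; apply: gd => //; exact: in2.
    + by move=> x y xuv yS; apply: gK => //; exact: in2.
  apply: isdN; apply: (fun_derive F1 (K := K) ux).
    + by move=> x xuv y yS; apply: cg => //; exact: in1.
    + by move=> x y xuv yS; apply: gd => //; exact: in1.
    + by move=> x y xuv yS; apply: gK => //; exact: in1.
move=> g dg gd cdg; rewrite /arcs (fun_exact F1) ?(fun_exact F2) ?subrr//.
- by move=> y yS; apply/gd/in2.
- by move=> y yS; apply/cdg/in2.
- by move=> y yS; apply/gd/in1.
- by move=> y yS; apply/cdg/in1.
Qed.

Lemma arc1_gt0 g : ctsOn band1 g -> (forall y, band1 y -> 0 < g y) -> 0 < arc1 g.
Proof. by move=> cg g0; exact: (arc_gt0 h1 rho1_gt0 rho1_der cg g0). Qed.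
Lemma arc2_gt0 g : ctsOn band2 g -> (forall y, band2 y -> 0 < g y) -> 0 < arc2 g.
Proof. by move=> cg g0; exact: (arc_gt0 h3 rho2_gt0 rho2_der cg g0). Qed.

(** On each band [rho] is a product of two factors affine in cos t, whose coefficients are half the
    distances between endpoints of different bands. Passing to the other band exchanges the two
    middle coefficients, which is [period_swap]. *)
Lemma arcs_moment0 : arcs (fun=> 1) = 0.
Proof.
have H1 := h1; have H2 := h2; have H3 := h3.
apply/eqP; rewrite subr_eq0; apply/eqP.
have := @period_swap R ((a2 - a1) / 2) ((a2 - b1) / 2) ((b2 - a1) / 2) ((b2 - b1) / 2).
move=> /(_ _ _ _ _) E; apply: etrans (etrans (esym (E _ _ _ _)) _); try by lra.
  by apply: eq_Int => t _; rewrite mul1r /arcpt; congr (Num.sqrt _)^-1; field.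
by apply: eq_Int => t _; rewrite mul1r /arcpt; congr (Num.sqrt _)^-1; field.
Qed.

(* On the first band, the resolvent of the second one solves an inhomogeneous first-order
   equation; integrating it proves a bilinear relation between the moments of the two bands. *)
Lemma arcs_moment2 : arcs (fun y => y ^+ 2) = sym1 / 2 * arcs (fun y => y).
Proof.
have F1 := arc1_functional; have F2 := arc2_functional.
have H2 := h2.
have offS x : a1 - 1 < x < (b1 + a2) / 2 -> off band2 x 0.
  by move=> /andP[_ xm] y /andP[ay yb]; rewrite /kden expr0n addr0 expf_eq0/= subr_eq0; lra.
have dist x y : a1 - 1 < x < (b1 + a2) / 2 -> band2 y -> ((a2 - b1) / 2) ^+ 2 <= kden x 0 y.
  move=> /andP[_ xm] /andP[ay yb]; rewrite /kden expr0n addr0.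
  rewrite -[leRHS]sqrrN; apply: lerXn2r; rewrite ?nnegrE; lra.
have d0 : 0 < ((a2 - b1) / 2) ^+ 2 by rewrite exprn_gt0//; lra.
have nb x : band1 x -> a1 - 1 < x < (b1 + a2) / 2 by move=> /andP[? ?]; apply/andP; split; lra.
have D x : band1 x -> der x (fun x => arc2 (kre x 0)) (- arc2 (kre2 x 0)).
  by move=> /nb xb; exact: (L_kre_der_x F2 d0 xb dist).
have c0 (P : R -> Prop) : ctsOn P (fun=> 1 : R) by move=> y _; cont.
have c1 (P : R -> Prop) : ctsOn P (fun y : R => y) by move=> y _; cont.
have c2 (P : R -> Prop) : ctsOn P (fun y : R => y ^+ 2) by move=> y _; cont.
have cD : ctsOn band1 (fun x => - arc2 (kre2 x 0)).
  move=> x xS; apply: contN; have xb := nb _ xS.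
  have ne (z y : R) : a1 - 1 < z < (b1 + a2) / 2 -> band2 y -> (a2 - b1) / 2 <= y - z.
    by move=> /andP[_ zm] /andP[ay yb]; lra.
  apply: (is_derive_cont (df := arc2 (fun y => 2 / (y - x) ^+ 3))).
  apply: (fun_derive F2 (g := fun x y => kre2 x 0 y) (dg := fun x y => 2 / (y - x) ^+ 3)
    (K := 2 / ((a2 - b1) / 2) ^+ 3) xb).
  - by move=> z zb; exact/kre2_cont/offS.
  - move=> z y zb yS; have zy := ne _ _ zb yS.
    have yz : z - y != 0 by apply: ltr0_neq0; lra.
    have yz' : y - z != 0 by apply: lt0r_neq0; lra.
    have k0 : (z - y) ^+ 2 + 0 ^+ 2 != 0 by rewrite expr0n addr0 expf_eq0.
    apply: der_eq; first (by rewrite /kre2 /kden; isd; exact: expf_neq0).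
    by rewrite /= !expr0n /= !addr0 !subr0; field; rewrite yz yz'.
  move=> z y zb yS; have zy := ne _ _ zb yS.
  have p0 : 0 < y - z by lra.
  have q0 : 0 < (a2 - b1) / 2 by lra.
  rewrite ger0_norm; last by rewrite divr_ge0// exprn_ge0// ltW.
  rewrite ler_pM2l ?ltr0n//.
  by rewrite lef_pV2 ?posrE ?exprn_gt0//; apply: lerXn2r => //; rewrite nnegrE ltW.
have := fun_exact F1 D cD.
have m0E : arc2 (fun=> 1) = arc1 (fun=> 1).
  by have /eqP := arcs_moment0; rewrite subr_eq0 => /eqP.
have m0_gt0 : 0 < arc1 (fun=> 1) by apply: arc1_gt0.
rewrite (fun_ext F1 (g := fun x => arc2 (fun=> 1) * x ^+ 2 + (- (sym1 / 2 * arc2 (fun=> 1))) * x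
   + (sym1 / 2 * arc2 (fun y => y) - arc2 (fun y => y ^+ 2)) * 1)); last first.
  move=> x /nb /offS xo; have := ode_re F2 xo.
  have -> : dQre sym1 sym2 sym3 x 0 = dQ x by rewrite /dQre; ring.
  have -> : dQim sym1 sym2 x 0 = 0 by rewrite /dQim; ring.
  have -> : Qre sym1 sym2 sym3 sym4 x 0 = Q x by rewrite /Qre; ring.
  have -> : Qim sym1 sym2 sym3 x 0 = 0 by rewrite /Qim; ring.
  move=> E; transitivity (arc2 (kre x 0) * dQ x / 2 - Q x * arc2 (kre2 x 0)); first by field.
  by rewrite mulrC; lra.
rewrite (fun_lin3 F1)// /arcs m0E.
move: m0_gt0; set M := arc1 (fun=> 1); move: (arc1 _) (arc1 (fun y => y)) => p2 p1 M0.
move: (arc2 _) (arc2 (fun y => y)) => q2 q1 E.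
apply: (mulfI (lt0r_neq0 M0)); lra.
Qed.


End TwoCut.

(** * Boundary values of the resolvent on the real line *)

Lemma cvg_invS {R : realType} (f : R -> R) : {for 0, continuous f} ->
  f (n.+1%:R^-1) @[n --> \oo] --> f 0.
Proof.
move=> cf; have h : (n.+1%:R^-1 : R) @[n --> \oo] --> (0 : R) by exact: cvg_harmonic.
exact: (continuous_cvg _ cf h).
Qed.

Section Jump.
Context {R : realType}.
Variables (a1 b1 a2 b2 : R).
Hypotheses (h1 : a1 < b1) (h2 : b1 < a2) (h3 : a2 < b2).
Implicit Types (x y e : R) (f g : R -> R).

Local Notation Q := (quart (sym1 a1 b1 a2 b2) (sym2 a1 b1 a2 b2) (sym3 a1 b1 a2 b2) (sym4 a1 b1 a2 b2)).
Local Notation qre := (Qre (sym1 a1 b1 a2 b2) (sym2 a1 b1 a2 b2) (sym3 a1 b1 a2 b2) (sym4 a1 b1 a2 b2)).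
Local Notation qim := (Qim (sym1 a1 b1 a2 b2) (sym2 a1 b1 a2 b2) (sym3 a1 b1 a2 b2)).
Local Notation bands := (bands a1 b1 a2 b2).
Local Notation L := (arcs a1 b1 a2 b2).

Let F := arcs_functional h1 h2 h3.
Let F1 := arc1_functional h1 h2 h3.
Let F2 := arc2_functional h1 h2 h3.

(** As L(1) = 0, subtracting the constant [k] from [f] does not change L(f), and then both bands
    contribute positively. *)
Lemma arcs_gt0 k f : ctsOn bands f -> (forall y, a2 <= y <= b2 -> k < f y) ->
  (forall y, a1 <= y <= b1 -> f y < k) -> 0 < L f.
Proof.
move=> cf f2 f1.
have c2 : ctsOn (band2 a2 b2) f by move=> y yS; apply: cf; rewrite bandsE -/(band2 a2 b2 y) yS orbT.
have c1 : ctsOn (band1 a1 b1) f by move=> y yS; apply: cf; rewrite bandsE -/(band1 a1 b1 y) yS.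
have cc (P : R -> Prop) (l : R) : ctsOn P (fun=> l) by move=> y _; exact: contC.
have e2 : 0 < arc2 a1 b1 a2 b2 (fun y => f y + (- k)).
  apply: (arc2_gt0 h1 h2 h3); last by move=> y /f2; rewrite subr_gt0.
  by move=> y yS; apply: contD; [exact: c2|exact: contC].
have e1 : 0 < arc1 a1 b1 a2 b2 (fun y => k + -1 * f y).
  apply: (arc1_gt0 h1 h2 h3); last by move=> y /f1; rewrite mulN1r subr_gt0.
  by move=> y yS; apply: contD; [exact: contC|apply: contM; [exact: contC|exact: c1]].
have m0 := arcs_moment0 h1 h2 h3.
move: e1 e2 m0; rewrite /arcs (fun_add F2)// (fun_add F1)//; last first.
  by move=> y yS; apply: contM; [exact: contC|exact: c1].
rewrite (fun_scale F1)//.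
have E (M : (R -> R) -> R) S : functional (sym1 a1 b1 a2 b2) (sym2 a1 b1 a2 b2) (sym3 a1 b1 a2 b2) (sym4 a1 b1 a2 b2) S M ->
    forall l, M (fun=> l) = l * M (fun=> 1).
  by move=> FM l; rewrite -(fun_scale FM)//; apply: (fun_ext FM) => y _; rewrite mulr1.
rewrite (E _ _ F1 k) (E _ _ F2 (- k)).
move: (arc1 _ _ _ _ _) (arc1 _ _ _ _ f) (arc2 _ _ _ _ _) (arc2 _ _ _ _ f) => u1 v1 u2 v2 e1 e2.
move=> /eqP; rewrite subr_eq0 => /eqP e; rewrite e in e2; lra.
Qed.

Lemma bands_sep x : ~~ bands x -> exists2 d : R, 0 < d & forall y, bands y -> d <= (x - y) ^+ 2.
Proof.
have H1 := h1; have H2 := h2; have H3 := h3.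
rewrite bandsE negb_or !negb_and -!ltNge => /andP[s1 s2].
have key d : 0 < d -> (forall y, a1 <= y <= b1 \/ a2 <= y <= b2 -> d <= x - y \/ d <= y - x) ->
    exists2 d : R, 0 < d & forall y, (a1 <= y <= b1) || (a2 <= y <= b2) -> d <= (x - y) ^+ 2.
  move=> d0 H; exists (d ^+ 2); first by rewrite exprn_gt0.
  move=> y /orP/H[dy|dy]; last rewrite -[leRHS]sqrrN opprB.
    by apply: lerXn2r => //; rewrite nnegrE ltW// (lt_le_trans d0).
  by apply: lerXn2r => //; rewrite nnegrE ltW// (lt_le_trans d0).
case/orP: s1 => s1.
  apply: (key (a1 - x)); first by rewrite subr_gt0.
  by move=> y [|] /andP[? ?]; right; lra.
case/orP: s2 => s2; last first.
  apply: (key (x - b2)); first by rewrite subr_gt0.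
  by move=> y [|] /andP[? ?]; left; lra.
apply: (key (Num.min (x - b1) (a2 - x))); first by rewrite lt_min !subr_gt0 s1.
move=> y [|] /andP[? ?]; [left|right].
  by apply: (@le_trans _ _ (x - b1)); [rewrite ge_min lexx|lra].
by apply: (@le_trans _ _ (a2 - x)); [rewrite ge_min lexx orbT|lra].
Qed.

Lemma quart_le0 x : bands x -> Q x <= 0.
Proof.
have H1 := h1; have H2 := h2; have H3 := h3.
move=> /orP[|] /andP[ax xb]; rewrite quartE.
  rewrite -mulrA mulr_le0_ge0//; first by rewrite mulr_ge0_le0//; lra.
  by rewrite -mulrNN; apply: mulr_ge0; lra.
rewrite mulr_ge0_le0//; last by lra.
by rewrite !mulr_ge0//; lra.
Qed.

Lemma quart_lt0 x : (a1 < x < b1) || (a2 < x < b2) -> Q x < 0.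
Proof.
have H1 := h1; have H2 := h2; have H3 := h3.
move=> /orP[|] /andP[ax xb]; rewrite quartE.
  rewrite -mulrA nmulr_rlt0; last by rewrite pmulr_rlt0; lra.
  by rewrite -mulrNN; apply: mulr_gt0; lra.
rewrite pmulr_rlt0; first by lra.
by rewrite !mulr_gt0//; lra.
Qed.

Lemma quart_gt0 x : ~~ bands x -> 0 < Q x.
Proof.
have H1 := h1; have H2 := h2; have H3 := h3.
rewrite bandsE negb_or !negb_and -!ltNge => /andP[s1 s2].
rewrite quartE -mulrA; case/orP: s1 => s1.
  by rewrite mulr_gt0// -mulrNN mulr_gt0//; lra.
case/orP: s2 => s2; last by rewrite !mulr_gt0//; lra.
by rewrite mulr_gt0//; [rewrite mulr_gt0//; lra|rewrite -mulrNN mulr_gt0//; lra].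
Qed.

Lemma off0 x : ~~ bands x -> off bands x 0.
Proof.
move=> /bands_sep[d d0 Hd] y /Hd dy; rewrite /kden expr0n addr0 gt_eqF//.
exact: lt_le_trans dy.
Qed.

Lemma kre0 x y : kre x 0 y = (x - y)^-1.
Proof.
rewrite /kre /kden expr0n addr0; have [->|xy] := eqVneq (x - y) 0; first by rewrite mul0r invr0.
by field.
Qed.

(** Outside the hull of the bands 1 / (x - y) increases in y, so its value at the midpoint of the
    gap separates its values on the two bands. *)
Lemma arcs_kre_outer x : x < a1 \/ b2 < x -> 0 < L (kre x 0).
Proof.
have H1 := h1; have H2 := h2; have H3 := h3.
move=> xo; have nb : ~~ bands x.
  rewrite bandsE negb_or !negb_and -!ltNge.
  by case: xo => xo; [have -> : x < a2 by lra|have -> : b1 < x by lra]; rewrite xo ?orbT.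
apply: (@arcs_gt0 ((x - (b1 + a2) / 2)^-1)); first exact/kre_cont/off0.
- move=> y /andP[? ?]; rewrite kre0; case: xo => xo.
    by rewrite ltf_nV2 ?negrE; lra.
  by rewrite ltf_pV2 ?posrE; lra.
- move=> y /andP[? ?]; rewrite kre0; case: xo => xo.
    by rewrite ltf_nV2 ?negrE; lra.
  by rewrite ltf_pV2 ?posrE; lra.
Qed.

Lemma arcs_kre_gap x : b1 < x < a2 -> L (kre x 0) < 0.
Proof.
have H1 := h1; have H2 := h2; have H3 := h3.
move=> /andP[bx xa]; have nb : ~~ bands x.
  by rewrite bandsE negb_or !negb_and -!ltNge bx xa orbT.
have ck := kre_cont (off0 nb).
rewrite -oppr_gt0 -(fun_opp F)//; apply: (@arcs_gt0 0).
- by move=> y yS; apply/contN/ck.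
- by move=> y /andP[? ?]; rewrite kre0 oppr_gt0 invr_lt0; lra.
- by move=> y /andP[? ?]; rewrite kre0 oppr_lt0 invr_gt0; lra.
Qed.

(** The constant value of Q r^2, read off at an arbitrary real point off the bands. *)
Definition jumpC := Q (b2 + 1) * L (kre (b2 + 1) 0) ^+ 2.

Let nb0 : ~~ bands (b2 + 1).
Proof.
have H1 := h1; have H2 := h2; have H3 := h3.
rewrite bandsE negb_or !negb_and -!ltNge.
by apply/andP; split; apply/orP; right; lra.
Qed.

Lemma jumpC_gt0 : 0 < jumpC.
Proof.
rewrite mulr_gt0 ?quart_gt0// exprn_gt0// arcs_kre_outer//; right; lra.
Qed.

Let PhiC : (forall x e, 0 < e -> Phire (sym1 a1 b1 a2 b2) (sym2 a1 b1 a2 b2) (sym3 a1 b1 a2 b2) (sym4 a1 b1 a2 b2) L x e = jumpC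
   /\ Phiim (sym1 a1 b1 a2 b2) (sym2 a1 b1 a2 b2) (sym3 a1 b1 a2 b2) (sym4 a1 b1 a2 b2) L x e = 0) /\
  (forall x d, 0 < d -> (forall y, bands y -> d <= (x - y) ^+ 2) -> Q x * L (kre x 0) ^+ 2 = jumpC).
Proof.
have [d d0 Hd] := bands_sep nb0.
exact: (Phi_const F (arcs_moment0 h1 h2 h3) (arcs_moment2 h1 h2 h3) d0 Hd).
Qed.

Lemma jump_off x : ~~ bands x -> Q x * L (kre x 0) ^+ 2 = jumpC.
Proof. by move=> /bands_sep[d d0 Hd]; exact: PhiC.2 Hd. Qed.

(* [jump] is the boundary value on the real line of [Q] times the resolvent; since [Num.sqrt]
   vanishes on negative numbers, it is zero on the bands. *)
Definition jump x : R := (if b1 < x < a2 then -1 else 1 : R) * (Num.sqrt jumpC * Num.sqrt (Q x)).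

(** Off the bands Q r^2 = [jumpC] determines Q r up to sign; the sign of r is negative in the gap
    and positive outside. *)
Lemma jumpE x : ~~ bands x -> Q x * L (kre x 0) = jump x.
Proof.
move=> nb; have q0 := quart_gt0 nb; have E := jump_off nb.
rewrite /jump; have -> : Num.sqrt jumpC = `|L (kre x 0)| * Num.sqrt (Q x).
  by rewrite -E mulrC sqrtrM ?sqr_ge0// sqrtr_sqr.
rewrite -mulrA -expr2 sqr_sqrtr ?(ltW q0)//.
case: ifPn => [xg|xg]; first by rewrite ltr0_norm ?arcs_kre_gap//; ring.
rewrite gtr0_norm; first by ring.
apply: arcs_kre_outer; move: nb xg.
rewrite bandsE negb_or !negb_and -!ltNge -!leNgt => /andP[/orP[?|bx]]; first by left.
by move=> /orP[xa|?]; [rewrite !leNgt bx xa|by right].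
Qed.

Lemma jump_bands x : bands x -> jump x = 0.
Proof. by move=> /quart_le0 q0; rewrite /jump (ler0_sqrtr q0) !mulr0. Qed.

Lemma jump_outer x : x < a1 \/ b2 < x -> 0 < jump x.
Proof.
have H1 := h1; have H2 := h2; have H3 := h3.
move=> xo; have nb : ~~ bands x.
  rewrite bandsE negb_or !negb_and -!ltNge.
  by case: xo => xo; [have -> : x < a2 by lra|have -> : b1 < x by lra]; rewrite xo ?orbT.
by rewrite -jumpE// mulr_gt0 ?quart_gt0 ?arcs_kre_outer.
Qed.

(** |Q(x + i e)|^2 factors over the four real roots, so it is smallest at e = 0. *)
Lemma qnormE x e : qre x e ^+ 2 + qim x e ^+ 2 =
  ((x - a1) ^+ 2 + e ^+ 2) * ((x - b1) ^+ 2 + e ^+ 2) * ((x - a2) ^+ 2 + e ^+ 2) * ((x - b2) ^+ 2 + e ^+ 2).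
Proof. by rewrite /Qre /Qim /quart /dquart /sym1 /sym2 /sym3 /sym4; ring. Qed.

Lemma qnorm_ge x e : Q x ^+ 2 <= qre x e ^+ 2 + qim x e ^+ 2.
Proof.
rewrite qnormE quartE !exprMn.
have h a : (x - a) ^+ 2 <= (x - a) ^+ 2 + e ^+ 2 by rewrite lerDl sqr_ge0.
apply: ler_pM; [by repeat (exact: sqr_ge0 || apply: mulr_ge0)|exact: sqr_ge0| |exact: h].
apply: ler_pM; [by repeat (exact: sqr_ge0 || apply: mulr_ge0)|exact: sqr_ge0| |exact: h].
by apply: ler_pM; [exact: sqr_ge0|exact: sqr_ge0|exact: h|exact: h].
Qed.

Lemma qnorm_gt0 x e : 0 < e -> 0 < qre x e ^+ 2 + qim x e ^+ 2.
Proof.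
move=> e0; have e2 : 0 < e ^+ 2 by rewrite exprn_gt0.
by rewrite qnormE !mulr_gt0// ltr_wpDl// sqr_ge0.
Qed.

(** Solve Q r^2 = C for the real part of r: twice its square is |r|^2 + Re (r^2), where |r|^2 = C /
    |Q| and Re (r^2) = C Re Q / |Q|^2. *)
Lemma arcs_kre_sqr x e : 0 < e -> let r := Num.sqrt (qre x e ^+ 2 + qim x e ^+ 2) in
  2 * r ^+ 2 * L (kre x e) ^+ 2 = jumpC * (qre x e + r).
Proof.
move=> e0 r; have [] := PhiC.1 x e e0; rewrite /Phire /Phiim.
have q0 := qnorm_gt0 x e0; have r0 : 0 < r by rewrite sqrtr_gt0.
have rE : r ^+ 2 = qre x e ^+ 2 + qim x e ^+ 2 by rewrite sqr_sqrtr ?ltW.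
move: jumpC_gt0 (L (kre x e)) (L (kim x e)) (qre x e) (qim x e) r r0 rE => C0 A B p q r r0 rE.
move: jumpC C0 => C C0 E1 E2.
have P1 : r ^+ 2 * (A ^+ 2 - B ^+ 2) = C * p.
  transitivity (p * (p * (A ^+ 2 - B ^+ 2) - 2 * q * A * B) + q * (q * (A ^+ 2 - B ^+ 2) + 2 * p * A * B)).
    by rewrite rE; ring.
  by rewrite E1 E2; ring.
have P2 : r * (A ^+ 2 + B ^+ 2) = C.
  apply: (@pexpIrn _ 2) => //.
  - by rewrite nnegrE mulr_ge0 ?(ltW r0)// addr_ge0// sqr_ge0.
  - by rewrite nnegrE ltW.
  transitivity ((p * (A ^+ 2 - B ^+ 2) - 2 * q * A * B) ^+ 2 + (q * (A ^+ 2 - B ^+ 2) + 2 * p * A * B) ^+ 2).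
    by rewrite exprMn rE; ring.
  by rewrite E1 E2; ring.
transitivity (r ^+ 2 * (A ^+ 2 - B ^+ 2) + r * (r * (A ^+ 2 + B ^+ 2))); first by ring.
by rewrite P1 P2; ring.
Qed.

Lemma Qkre_le x e : 0 < e ->
  (Q x * L (kre x e)) ^+ 2 <= jumpC * ((qre x e + Num.sqrt (qre x e ^+ 2 + qim x e ^+ 2)) / 2).
Proof.
move=> e0; have q0 := qnorm_gt0 x e0; have qq := qnorm_ge x e.
have := arcs_kre_sqr x e0; rewrite /= sqr_sqrtr ?(ltW q0)// exprMn => E.
apply: (@le_trans _ _ ((qre x e ^+ 2 + qim x e ^+ 2) * L (kre x e) ^+ 2)).
  by rewrite ler_wpM2r// sqr_ge0.
by move: E; lra.
Qed.

(** A bound uniform in [e], used as majorant in the passage to the real line. *)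
Lemma Qkre_bound x e : 0 < e -> `|Q x * L (kre x e)| <= Num.sqrt (jumpC * `|Q x|).
Proof.
move=> e0; have E := arcs_kre_sqr x e0; have q0 := qnorm_gt0 x e0; have qq := qnorm_ge x e.
rewrite -sqrtr_sqr ler_wsqrtr// exprMn; move: E.
set r := Num.sqrt _ => E.
have r0 : 0 < r by rewrite sqrtr_gt0.
have rE : r ^+ 2 = qre x e ^+ 2 + qim x e ^+ 2 by rewrite sqr_sqrtr ?ltW.
have Qr : `|Q x| <= r by rewrite -(@ler_pXn2r _ 2) ?nnegrE ?(ltW r0)// rE -normrX ger0_norm ?sqr_ge0.
have qr : qre x e <= r.
  apply: le_trans (ler_norm _) _.
  by rewrite -(@ler_pXn2r _ 2) ?nnegrE ?(ltW r0)// rE -normrX ger0_norm ?sqr_ge0// lerDl sqr_ge0.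
have A2 : r * L (kre x e) ^+ 2 <= jumpC.
  rewrite -(ler_pM2l r0) mulrA -expr2 [leRHS]mulrC.
  have : jumpC * (qre x e + r) <= jumpC * (r + r) by rewrite ler_pM2l ?jumpC_gt0// lerD2r.
  by rewrite -E; lra.
apply: (@le_trans _ _ (`|Q x| * (r * L (kre x e) ^+ 2))).
  rewrite [leRHS]mulrA; apply: ler_wpM2r; first exact: sqr_ge0.
  by rewrite -[leLHS]ger0_norm ?sqr_ge0// normrX expr2 ler_wpM2l.
by rewrite mulrC ler_wpM2r.
Qed.

(** On a band Q <= 0, so (Re Q(z) + |Q(z)|) / 2 tends to 0 and [Qkre_le] forces the limit 0,
    endpoints included; off the bands the resolvent is continuous down to e = 0. *)
Lemma Qkre_cvg x : (Q x * L (kre x (n.+1%:R^-1))) @[n --> \oo] --> jump x.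
Proof.
have [xb|nb] := boolP (bands x).
  rewrite jump_bands//.
  pose H e := jumpC * ((qre x e + Num.sqrt (qre x e ^+ 2 + qim x e ^+ 2)) / 2).
  have cH : {for 0, continuous H}.
    by rewrite /H /Qre /Qim; cont.
  have H0 : H 0 = 0.
    rewrite /H (_ : qre x 0 = Q x); last by rewrite /Qre; ring.
    rewrite (_ : qim x 0 = 0); last by rewrite /Qim; ring.
    by rewrite expr0n addr0 sqrtr_sqr ler0_norm ?quart_le0// subrr mul0r mulr0.
  have cv : H (n.+1%:R^-1) @[n --> \oo] --> (0 : R).
    by rewrite -H0; exact: cvg_invS.
  have cv2 : Num.sqrt (H (n.+1%:R^-1)) @[n --> \oo] --> (0 : R).
    rewrite -[X in _ --> X](@sqrtr0 R); apply: (continuous_cvg _ _ cv).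
    exact: sqrt_continuous.
  apply: norm_cvg0.
  apply: (squeeze_cvgr _ (cvg_cst 0) cv2); apply: nearW => n.
  rewrite normr_ge0/= -sqrtr_sqr ler_wsqrtr//.
  by apply: Qkre_le; rewrite invr_gt0 ltr0n.
rewrite -jumpE//; apply: cvgMr.
have [d d0 Hd] := bands_sep nb.
have i0 : -1 < (0 : R) < 1 by rewrite ltrN10 ltr01.
have : {for 0, continuous (fun e => L (kre x e))}.
  apply: is_derive_cont; apply: (L_kre_der_e F d0 i0) => e y _ /Hd.
  by rewrite /kden; have := sqr_ge0 e; lra.
by move=> ck; exact: (cvg_invS ck).
Qed.

End Jump.

(** * The regularised logarithm *)

Section Log.
Context {R : realType}.
Implicit Types (x y e a b c : R).
Notation leb := (@lebesgue_measure R).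

(** ln |x + i e - y|, whose derivative in [x] is the real resolvent kernel [kre]. *)
Definition lk x e y : R := ln ((x - y) ^+ 2 + e ^+ 2) / 2.

Lemma lk_cont x e y : 0 < (x - y) ^+ 2 + e ^+ 2 -> {for y, continuous (lk x e)}.
Proof. by move=> k0; rewrite /lk; cont. Qed.

Lemma kden_gt0 x e y : e != 0 -> 0 < kden x e y.
Proof. by move=> e0; rewrite /kden ltr_wpDl ?sqr_ge0// exprn_even_gt0. Qed.

Lemma lk0 x y : lk x 0 y = ln `|x - y|.
Proof.
rewrite /lk expr0n addr0 -[_ ^+ 2]ger0_norm ?sqr_ge0// normrX.
(* At y = x both sides are 0, because [ln 0] is 0 by convention. *)
have [->|xy] := eqVneq (x - y) 0; first by rewrite normr0 expr0n/= ln0// mul0r.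
by rewrite lnXn ?normr_gt0// mulr2n; field.
Qed.

Lemma lk_cvg x y : x != y -> lk x (n.+1%:R^-1) y @[n --> \oo] --> ln `|x - y|.
Proof.
move=> xy; rewrite -lk0; apply: (@cvg_invS R (fun e => lk x e y)).
have k0 : 0 < (x - y) ^+ 2 + 0 ^+ 2.
  by rewrite expr0n addr0 lt_neqAle sqr_ge0 eq_sym expf_eq0/= subr_eq0 xy.
by rewrite /lk; cont.
Qed.

Lemma ln_le_lk x e y : x != y -> ln `|x - y| <= lk x e y.
Proof.
move=> xy; rewrite -lk0 /lk ler_pM2r ?invr_gt0//.
have k0 : 0 < (x - y) ^+ 2 by rewrite lt_neqAle sqr_ge0 eq_sym expf_eq0/= subr_eq0 xy.
by rewrite ler_ln ?posrE ?ltr_wpDr ?sqr_ge0// expr0n addr0 // lerDl sqr_ge0.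
Qed.

Lemma lk_le x e y : 0 < e <= 1 -> lk x e y <= (x - y) ^+ 2.
Proof.
move=> /andP[e0 e1]; have e2 : e ^+ 2 <= 1 by rewrite expr_le1// ltW.
have s0 := sqr_ge0 (x - y).
apply: (@le_trans _ _ (ln (1 + (x - y) ^+ 2) / 2)).
  rewrite ler_pM2r ?invr_gt0// ler_ln ?posrE; first by lra.
    by rewrite ltr_wpDl// exprn_gt0.
  by lra.
have : ln (1 + (x - y) ^+ 2) <= (x - y) ^+ 2 by apply: le_ln1Dx; lra.
by lra.
Qed.

Lemma lk_abs_le x e y : 0 < e <= 1 -> x != y -> `|lk x e y| <= `|ln `|x - y| | + (x - y) ^+ 2.
Proof.
move=> e01 xy; have l1 := ln_le_lk e xy; have l2 := lk_le x y e01.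
have s0 := sqr_ge0 (x - y); have n0 := normr_ge0 (ln `|x - y|).
have n1 := ler_norm (- ln `|x - y|); rewrite normrN in n1.
by rewrite ler_norml; apply/andP; split; lra.
Qed.

Lemma measurable_lnnorm x (D : set R) : measurable_fun D (fun y : R => ln `|x - y|).
Proof.
apply: measurable_funTS; apply: (measurableT_comp (@measurable_ln R)).
by apply: measurableT_comp => //; exact: measurable_funB.
Qed.

Let inv01 n : 0 < (n.+1%:R^-1 : R) <= 1.
Proof. by rewrite invr_gt0 ltr0n/= invf_le1 ?ltr0n// ler1n. Qed.

(** The lower bound does not depend on [e]: the integrand dominates the exact derivative of (y - x)
    [lk] - y, and the boundary terms are bounded below by those for e = 0. *)
Lemma Int_lk_ge x c e : 1 <= c -> 0 < e <= 1 ->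
  2 * (c * ln c - c) <= Int (x - c) (x + c) (lk x e).
Proof.
move=> c1 /andP[e0 e1].
have c0 : 0 < c by lra.
have k0 y : 0 < (x - y) ^+ 2 + e ^+ 2 by apply: kden_gt0; rewrite gt_eqF.
have i1 : intg (x - c) (x + c) (lk x e) by apply: cts_intg => y _; exact: lk_cont.
pose dF y := lk x e y + (y - x) ^+ 2 / ((x - y) ^+ 2 + e ^+ 2) - 1.
pose F y := (y - x) * lk x e y - y.
have cdF : cts (x - c) (x + c) dF.
  move=> y _; have := lk_cont (k0 y) => cl; rewrite /dF; cont.
  by rewrite gt_eqF.
have dFF y : der y F (dF y).
  apply: der_eq; first by (rewrite /F /lk; isd).
  have := k0 y; rewrite /= /dF /lk => k0y.
  by field; rewrite gt_eqF//= gt_eqF.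
have E : Int (x - c) (x + c) dF = F (x + c) - F (x - c).
  apply: Int_FTC => //; first by lra.
  by move=> y _; exact: is_derive_cont (dFF y).
apply: (@le_trans _ _ (Int (x - c) (x + c) dF)); last first.
  apply: Int_le => //; first exact: cts_intg.
  move=> y _; rewrite /dF -addrA gerDl subr_le0 ler_pdivrMr// mul1r.
  by rewrite -sqrrN opprB lerDl sqr_ge0.
have c2 : ln c <= ln (c ^+ 2 + e ^+ 2) / 2.
  rewrite ler_pdivlMr// mulr_natr -lnXn// ler_ln ?posrE ?exprn_gt0 ?ltr_wpDr ?sqr_ge0 ?exprn_gt0//.
  by rewrite lerDl sqr_ge0.
have c3 : c * ln c <= c * (ln (c ^+ 2 + e ^+ 2) / 2) by rewrite ler_pM2l.
rewrite E /F /lk.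
rewrite (_ : x - (x + c) = - c); last by ring.
rewrite (_ : x - (x - c) = c); last by ring.
by rewrite sqrrN; lra.
Qed.

Lemma intg_ln a b x : intg a b (fun y => ln `|x - y|).
Proof.
(* The segment is enlarged to one centred at [x], of half-length at least 1 as [Int_lk_ge]
   requires. *)
pose c := `|x - a| + `|x - b| + 1.
have ca : a - c <= x <= a + c.
  rewrite -ler_distl /c; have := normr_ge0 (x - b); lra.
have cb : b - c <= x <= b + c.
  by rewrite -ler_distl /c; have := normr_ge0 (x - a); lra.
have c1 : 1 <= c by rewrite /c; have := normr_ge0 (x - a); have := normr_ge0 (x - b); lra.
suff : intg (x - c) (x + c) (fun y => ln `|x - y|).
  apply: intg_sub; lra.
(* [K] bounds [lk] above for all heights up to 1, so [K - lk] is nonnegative and increases as the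
   height decreases: monotone convergence applies. *)
pose K := ln (c ^+ 2 + 1) / 2.
have M0 : 0 <= K by rewrite divr_ge0// ln_ge0// lerDr sqr_ge0.
pose D : set R := `[x - c, x + c]%classic.
have mD : measurable (D : set (measurableTypeR R)) by exact: measurable_itv.
pose en n : R := n.+1%:R^-1.
have k0 n y : 0 < (x - y) ^+ 2 + en n ^+ 2 by apply: kden_gt0; rewrite gt_eqF// (andP (inv01 n)).1.
have il n : intg (x - c) (x + c) (lk x (en n)) by apply: cts_intg => y _; exact: lk_cont.
have ig n : intg (x - c) (x + c) (fun y => K - lk x (en n) y) by apply: intgB => //; exact: intg_cst.
pose g n y := (K - lk x (en n) y)%:E.
have mg n : measurable_fun D (g n) by have /integrableP[] := ig n.
have g0 n y : D y -> (0 <= g n y)%E.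
  rewrite /D/= in_itv/= => /andP[y1 y2]; rewrite lee_fin subr_ge0 /lk /K.
  have p2 : 0 < c ^+ 2 + 1 by rewrite ltr_wpDl// sqr_ge0.
  rewrite ler_pM2r ?invr_gt0// ler_ln ?posrE//.
  have /andP[e0 e1] := inv01 n.
  have : en n ^+ 2 <= 1 by rewrite expr_le1// ltW.
  have : (x - y) ^+ 2 <= c ^+ 2.
    rewrite -subr_ge0 (_ : _ - _ = (c - (x - y)) * (c + (x - y))); last by ring.
    by apply: mulr_ge0; lra.
  by lra.
have nd : forall z, D z -> nondecreasing_seq (g ^~ z).
  move=> z _ p q pq; rewrite lee_fin lerB// /lk ler_pM2r ?invr_gt0// ler_ln ?posrE//.
  rewrite lerD2l; have /andP[e0 e1] := inv01 q; have /andP[e2 e3] := inv01 p.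
  apply: lerXn2r; [by rewrite nnegrE ltW|by rewrite nnegrE ltW|].
  by rewrite /en lef_pV2 ?posrE ?ltr0n// ler_nat.
have MC := monotone_convergence leb mD mg g0 nd.
have iB n : (\int[leb]_(y in D) g n y <= (2 * c * K - 2 * (c * ln c - c))%:E)%E.
  rewrite (intgE (ig n)) lee_fin IntB//; last exact: intg_cst.
  have := Int_lk_ge x c1 (inv01 n); rewrite Int_cst; last by lra.
  by rewrite -/(en n); lra.
have mf : measurable_fun D (fun y => limn (g ^~ y)).
  by apply: emeasurable_fun_cvg mg _ => y Dy; exact/ereal_nondecreasing_is_cvgn/nd.
have fi : leb.-integrable D (fun y => limn (g ^~ y)).
  apply/integrableP; split=> //.
  under eq_integral => y /set_mem Dy.
    rewrite gee0_abs; last first.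
      by apply: lime_ge; [exact/ereal_nondecreasing_is_cvgn/nd|apply: nearW => n; exact: g0].
    over.
  rewrite MC (le_lt_trans _ (ltry (2 * c * K - 2 * (c * ln c - c))))//.
  apply: lime_le; last exact: nearW.
  apply: ereal_nondecreasing_is_cvgn => n m nm; apply: ge0_le_integral => //.
  - by move=> y Dy; exact: g0.
  - exact: mg.
  - exact: mg.
  by move=> y Dy; exact: (nd y Dy n m nm).
have : leb.-integrable D (fun y => (K - ln `|x - y|)%:E).
  apply: le_integrable fi => //.
    by apply/measurable_EFinP; apply: measurable_funB => //; exact: measurable_lnnorm.
  (* At y = x the convention [ln 0] = 0 makes the function equal to [K], while the limit of the
     sequence is at least [K]; domination is enough. *)
  move=> y Dy; have [xy|xy] := eqVneq x y.
    rewrite {1}xy subrr normr0 ln0// subr0 gee0_abs ?lee_fin//.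
    apply: (le_trans _ (lee_abs _)); apply: lime_ge; first by apply/ereal_nondecreasing_is_cvgn/nd.
    apply: nearW => n; rewrite lee_fin lerBrDl gerDr /lk {1}xy subrr expr0n add0r.
    have /andP[e0 e1] := inv01 n.
    by rewrite pmulr_lle0 ?invr_gt0// ln_le0// expr_le1// ltW.
  rewrite (_ : limn (g ^~ y) = (K - ln `|x - y|)%:E)//.
  apply/cvg_lim => //; apply: cvg_EFin; first exact: nearW.
  by apply: cvgB; [exact: cvg_cst|exact: lk_cvg].
move=> iK; have := intgB (intg_cst (x - c) (x + c) K) iK.
by apply: eq_intg => y _; ring.
Qed.

End Log.

(** * Signed logarithmic potentials as limits of regularised ones *)

Lemma arc_cvg {R : realType} (a b : R) (rho drho : R -> R) (f_ : nat -> R -> R) (f : R -> R) (c K : R) :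
  a < b -> (forall y, a <= y <= b -> 0 < rho y) ->
  (forall y, a <= y <= b -> der y rho (drho y)) ->
  (forall n, cts a b (f_ n)) -> cts a b f ->
  (forall y, a <= y <= b -> y != c -> f_ n y @[n --> \oo] --> f y) ->
  (forall n y, a <= y <= b -> `|f_ n y| <= K) ->
  arc a b rho (f_ n) @[n --> \oo] --> arc a b rho f.
Proof.
move=> ab rho0 rhod cf_ cf fcv fK.
pose s t := (Num.sqrt (rho (arcpt a b t)))^-1.
have cs : cts 0 pi (fun t => K * s t).
  have := @arc_integrand_cts _ a b rho drho ab rho0 rhod (fun=> K).
  by apply=> y _; exact: contC.
(* The only angle at which [arcpt] can take the exceptional value [c]. *)
pose d := acos (((a + b) / 2 - c) / ((b - a) / 2)).
have [] // := @Int_dominated R 0 pi d (fun n t => f_ n (arcpt a b t) * s t)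
  (fun t => f (arcpt a b t) * s t) (fun t => K * s t).
- by move=> n; apply: cts_intg; exact: (arc_integrand_cts ab rho0 rhod (cf_ n)).
- exact: (intg_measurable (cts_intg (arc_integrand_cts ab rho0 rhod cf))).
- exact: cts_intg.
- move=> t /andP[t0 tpi] td; apply: cvgMl; apply: fcv; first exact: arcpt_itv.
  apply: contra td => /eqP E; apply/eqP; rewrite /d -E /arcpt.
  rewrite (_ : (_ - _) / _ = cos t); last by field; rewrite subr_eq0 gt_eqF.
  by rewrite cosK// in_itv/= t0.
- move=> n t _ _; have s0 : 0 <= s t by rewrite invr_ge0 sqrtr_ge0.
  by rewrite normrM (ger0_norm s0) ler_wpM2r// fK// arcpt_itv.
Qed.

Section Potential.
Context {R : realType}.
Variables (a1 b1 a2 b2 : R).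
Hypotheses (h1 : a1 < b1) (h2 : b1 < a2) (h3 : a2 < b2).
Implicit Types (x y e : R) (f g : R -> R).

Local Notation Q := (quart (sym1 a1 b1 a2 b2) (sym2 a1 b1 a2 b2) (sym3 a1 b1 a2 b2) (sym4 a1 b1 a2 b2)).
Local Notation bands := (bands a1 b1 a2 b2).
Local Notation L := (arcs a1 b1 a2 b2).
Local Notation jump := (jump a1 b1 a2 b2).

Let F := arcs_functional h1 h2 h3.
Let F1 := arc1_functional h1 h2 h3.
Let F2 := arc2_functional h1 h2 h3.

Let rho1_gt0 y : a1 <= y <= b1 -> 0 < (a2 - y) * (b2 - y).
Proof. by move=> /andP[? ?]; have H2 := h2; have H3 := h3; apply: mulr_gt0; lra. Qed.
Let rho2_gt0 y : a2 <= y <= b2 -> 0 < (y - a1) * (y - b1).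
Proof. by move=> /andP[? ?]; have H2 := h2; have H1 := h1; apply: mulr_gt0; lra. Qed.
Let rho1_der y : a1 <= y <= b1 -> der y (fun y => (a2 - y) * (b2 - y)) (2 * y - a2 - b2).
Proof. by move=> _; apply: der_eq; [isd|rewrite /=; ring]. Qed.
Let rho2_der y : a2 <= y <= b2 -> der y (fun y => (y - a1) * (y - b1)) (2 * y - a1 - b1).
Proof. by move=> _; apply: der_eq; [isd|rewrite /=; ring]. Qed.

Definition weight y : R := Num.sqrt `|Q y|.
Definition sint f : R := Int a2 b2 f - Int a1 b1 f.

Lemma weight_cont y : {for y, continuous weight}.
Proof. by rewrite /weight; have := @quart_cont R (sym1 a1 b1 a2 b2) (sym2 a1 b1 a2 b2) (sym3 a1 b1 a2 b2) (sym4 a1 b1 a2 b2) y => cq; cont. Qed.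

Let in1 y : a1 <= y <= b1 -> bands y. Proof. by rewrite bandsE => ->. Qed.
Let in2 y : a2 <= y <= b2 -> bands y. Proof. by rewrite bandsE => ->; rewrite orbT. Qed.

(** On the bands -Q = |Q|, hence sqrt |Q| = -Q / sqrt |Q|. *)
Lemma sint_arcs g : ctsOn bands g -> sint (fun y => g y * weight y) = L (fun y => g y * - Q y).
Proof.
move=> cg.
have cg1 : cts a1 b1 g by move=> y /in1; exact: cg.
have cg2 : cts a2 b2 g by move=> y /in2; exact: cg.
rewrite /sint /arcs; congr (_ - _).
  rewrite -[RHS](_ : arc a2 b2 (fun y => (y - a1) * (y - b1)) (fun y => g y * ((y - a2) * (b2 - y) * ((y - a1) * (y - b1)))) = _).
    rewrite -(arcE h3 rho2_gt0 rho2_der cg2); apply: eq_Int => y yS.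
    rewrite /weight ler0_norm ?quart_le0 ?in2// quartE; congr (_ * Num.sqrt _); ring.
  by apply: eq_arc => // y _; rewrite quartE; ring.
rewrite -[RHS](_ : arc a1 b1 (fun y => (a2 - y) * (b2 - y)) (fun y => g y * ((y - a1) * (b1 - y) * ((a2 - y) * (b2 - y)))) = _).
  rewrite -(arcE h1 rho1_gt0 rho1_der cg1); apply: eq_Int => y yS.
  rewrite /weight ler0_norm ?quart_le0 ?in1// quartE; congr (_ * Num.sqrt _); ring.
by apply: eq_arc => // y _; rewrite quartE; ring.
Qed.

Lemma bands_bounded f : ctsOn bands f -> exists2 K : R, 0 < K & forall y, bands y -> `|f y| <= K.
Proof.
move=> cf.
have key a b : a < b -> cts a b f -> exists K : R, forall y, a <= y <= b -> `|f y| <= K.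
  move=> ab c; have [|z _ Hz] := @EVT_max R (fun y => `|f y|) a b (ltW ab).
    by apply: cts_within => y /c cy; cont.
  by exists `|f z| => y yab; apply: Hz; rewrite in_itv.
have [K1 HK1] : exists K : R, forall y, a1 <= y <= b1 -> `|f y| <= K.
  by apply: key => // y /in1; exact: cf.
have [K2 HK2] : exists K : R, forall y, a2 <= y <= b2 -> `|f y| <= K.
  by apply: key => // y /in2; exact: cf.
exists (Num.max 1 (Num.max K1 K2)); first by rewrite lt_max ltr01.
by move=> y /orP[/HK1|/HK2] h; rewrite !le_max h !orbT.
Qed.

Lemma arcs_bound f K : ctsOn bands f -> (forall y, bands y -> `|f y| <= K) ->
  `|L f| <= K * (arc1 a1 b1 a2 b2 (fun=> 1) + arc2 a1 b1 a2 b2 (fun=> 1)).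
Proof.
move=> cf fK.
have c1 : cts a1 b1 f by move=> y /in1; exact: cf.
have c2 : cts a2 b2 f by move=> y /in2; exact: cf.
have cc (a b k : R) : cts a b (fun=> k) by move=> y _; exact: contC.
have E1 k : arc1 a1 b1 a2 b2 (fun=> k) = k * arc1 a1 b1 a2 b2 (fun=> 1).
  rewrite -(fun_scale F1); last by move=> y _; exact: contC.
  by apply: (fun_ext F1) => y _; rewrite mulr1.
have E2 k : arc2 a1 b1 a2 b2 (fun=> k) = k * arc2 a1 b1 a2 b2 (fun=> 1).
  rewrite -(fun_scale F2); last by move=> y _; exact: contC.
  by apply: (fun_ext F2) => y _; rewrite mulr1.
have u1 : arc1 a1 b1 a2 b2 f <= arc1 a1 b1 a2 b2 (fun=> K).
  by apply: (arc_le h1 rho1_gt0 rho1_der) => // y /in1/fK; rewrite ler_norml => /andP[].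
have l1 : arc1 a1 b1 a2 b2 (fun=> - K) <= arc1 a1 b1 a2 b2 f.
  by apply: (arc_le h1 rho1_gt0 rho1_der) => // y /in1/fK; rewrite ler_norml => /andP[].
have u2 : arc2 a1 b1 a2 b2 f <= arc2 a1 b1 a2 b2 (fun=> K).
  by apply: (arc_le h3 rho2_gt0 rho2_der) => // y /in2/fK; rewrite ler_norml => /andP[].
have l2 : arc2 a1 b1 a2 b2 (fun=> - K) <= arc2 a1 b1 a2 b2 f.
  by apply: (arc_le h3 rho2_gt0 rho2_der) => // y /in2/fK; rewrite ler_norml => /andP[].
move: u1 l1 u2 l2; rewrite (E1 K) (E1 (- K)) (E2 K) (E2 (- K)) /arcs => u1 l1 u2 l2.
rewrite ler_norml; apply/andP; split; lra.
Qed.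

Lemma arcs_cvg (f_ : nat -> R -> R) f c K : (forall n, ctsOn bands (f_ n)) -> ctsOn bands f ->
  (forall y, bands y -> y != c -> f_ n y @[n --> \oo] --> f y) ->
  (forall n y, bands y -> `|f_ n y| <= K) ->
  L (f_ n) @[n --> \oo] --> L f.
Proof.
move=> cf_ cf fcv fK; apply: cvgB.
  apply: (arc_cvg (c := c) (K := K) h3 rho2_gt0 rho2_der).
  - by move=> n y /in2; exact: cf_.
  - by move=> y /in2; exact: cf.
  - by move=> y /in2; exact: fcv.
  - by move=> n y /in2; exact: fK.
apply: (arc_cvg (c := c) (K := K) h1 rho1_gt0 rho1_der).
- by move=> n y /in1; exact: cf_.
- by move=> y /in1; exact: cf.
- by move=> y /in1; exact: fcv.
- by move=> n y /in1; exact: fK.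
Qed.

(** The logarithmic potential of the signed density that is f sqrt |Q| on the second band and its
    opposite on the first; [upotE] is its regularisation at height [e], written through [arcs] by
    [sint_arcs]. *)
Definition upot f x : R := sint (fun y => f y * ln `|x - y| * weight y).
Definition upotE f x e : R := L (fun y => f y * lk x e y * - Q y).

Lemma intg_bounded_ln a b f x : cts a b f -> intg a b (fun y => f y * ln `|x - y|).
Proof.
move=> cf; have il := intg_ln a b x.
have [ba|ab] := ltP b a.
  rewrite /intg set_itv_ge ?bnd_simp -?ltNge//; exact: integrable_set0.
have [|z _ Hz] := @EVT_max R (fun y => `|f y|) a b ab.
  by apply: cts_within => y /cf cy; cont.
have ik := intgZ `|f z| il.
apply: le_integrable ik => //.
  apply/measurable_EFinP; apply: measurable_funM; last exact: measurable_lnnorm.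
  exact: (intg_measurable (cts_intg cf)).
move=> y; rewrite /= in_itv/= => yab; rewrite lee_fin !normrM normr_id.
by rewrite ler_wpM2r// Hz// in_itv.
Qed.

Lemma upotE_cvg f x : ctsOn bands f -> upotE f x (n.+1%:R^-1) @[n --> \oo] --> upot f x.
Proof.
move=> cf.
have inv01 n : 0 < (n.+1%:R^-1 : R) <= 1 by rewrite invr_gt0 ltr0n/= invf_le1 ?ltr0n// ler1n.
have cl n y : {for y, continuous (lk x n.+1%:R^-1)}.
  by apply: lk_cont; apply: kden_gt0; rewrite gt_eqF ?invr_gt0 ?ltr0n.
have E n : upotE f x n.+1%:R^-1 = sint (fun y => f y * lk x n.+1%:R^-1 y * weight y).
  rewrite (@sint_arcs (fun y => f y * lk x n.+1%:R^-1 y))//.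
  by move=> y /cf cy; have := @cl n y => c2; cont.
have -> : (fun n => upotE f x n.+1%:R^-1) = (fun n => sint (fun y => f y * lk x n.+1%:R^-1 y * weight y)).
  by apply/funext.
have key a b : cts a b f -> Int a b (fun y => f y * lk x n.+1%:R^-1 y * weight y) @[n --> \oo] -->
    Int a b (fun y => f y * ln `|x - y| * weight y).
  move=> cfab.
  pose fw y := f y * weight y.
  have cfw : cts a b fw by move=> y /cfab cy; have := @weight_cont y => cw; rewrite /fw; cont.
  have ig : intg a b (fun y => `|fw y| * `|ln `|x - y| | + `|fw y| * (x - y) ^+ 2).
    apply: intgD.
      have := integrable_abse (intg_bounded_ln x cfw); apply: eq_integrable => // y _.
      by rewrite /= normrM.
    by apply: cts_intg => y /cfw cy; cont.
  have [] // := @Int_dominated R a b x (fun n y => f y * lk x n.+1%:R^-1 y * weight y)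
    (fun y => f y * ln `|x - y| * weight y) _ _ _ ig.
  - move=> n; apply: cts_intg => y /cfab cy; have := @cl n y => c2.
    by have := @weight_cont y => cw; cont.
  - have := intg_measurable (intg_bounded_ln x cfw); apply: eq_measurable_fun => y _.
    by rewrite /fw; ring.
  - move=> y _ yx; apply: cvgMl; apply: cvgMr; apply: lk_cvg; by rewrite eq_sym.
  move=> n y _ yx; rewrite mulrAC normrM -/(fw y) -mulrDr ler_wpM2l//.
  by apply: lk_abs_le => //; rewrite eq_sym.
apply: cvgB; apply: key.
  by move=> y /in2; exact: cf.
by move=> y /in1; exact: cf.
Qed.

End Potential.

(** * The derivative of a signed potential *)

Section Formula.
Context {R : realType}.
Variables (a1 b1 a2 b2 : R).
Hypotheses (h1 : a1 < b1) (h2 : b1 < a2) (h3 : a2 < b2).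
Implicit Types (x y e : R).

Local Notation Q := (quart (sym1 a1 b1 a2 b2) (sym2 a1 b1 a2 b2) (sym3 a1 b1 a2 b2) (sym4 a1 b1 a2 b2)).
Local Notation bands := (bands a1 b1 a2 b2).
Local Notation L := (arcs a1 b1 a2 b2).
Local Notation jump := (jump a1 b1 a2 b2).

Let F := arcs_functional h1 h2 h3.

(** [dd] is the divided difference of Q p; below it is a polynomial in both variables. *)
Variables (p : R -> R) (dd : R -> R -> R).
Hypothesis p_cont : forall y, {for y, continuous p}.
Hypothesis ddE : forall x y, Q x * p x - Q y * p y = (x - y) * dd x y.
Hypothesis dd_cont : forall x y, {for y, continuous (dd x)}.
Hypothesis dd_bound : forall B : R, exists K : R, forall x y, `|x| <= B -> bands y -> `|dd x y| <= K.

Let q_cont y : {for y, continuous Q}. Proof. exact: quart_cont. Qed.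

Let offe x e : 0 < e -> off bands x e.
Proof. by move=> e0 y _; rewrite gt_eqF// kden_gt0// gt_eqF. Qed.

Let kden_ge x e y : e ^+ 2 <= kden x e y.
Proof. by rewrite /kden lerDr sqr_ge0. Qed.

Let kre_bound x e y : 0 < e -> `|kre x e y| <= e^-1.
Proof.
move=> e0; have k0 : 0 < kden x e y by rewrite kden_gt0// gt_eqF.
rewrite /kre normrM normfV (gtr0_norm k0) ler_pdivrMr// -(ler_pM2l e0) mulrA divff ?gt_eqF// mul1r.
have : `|x - y| ^+ 2 = (x - y) ^+ 2 by rewrite -normrX ger0_norm ?sqr_ge0.
rewrite /kden => <-; have := sqr_ge0 (`|x - y| - e); have := sqr_ge0 (`|x - y|); have := sqr_ge0 e; lra.
Qed.

Lemma upotE_der x e : 0 < e ->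
  der x (fun x => upotE a1 b1 a2 b2 p x e) (L (fun y => p y * kre x e y * - Q y)).
Proof.
move=> e0.
have [K K0 HK] : exists2 K : R, 0 < K & forall y, bands y -> `|p y * Q y| <= K.
  by apply: bands_bounded => // y _; have := @p_cont y; have := @q_cont y => c1 c2; cont.
have ix : x - 1 < x < x + 1 by rewrite ltrBlDr ltrDl ltr01.
apply: (fun_derive F (g := fun x y => p y * lk x e y * - Q y)
  (dg := fun x y => p y * kre x e y * - Q y) (K := K / e) ix).
- move=> z _ y _; have := @p_cont y; have := @q_cont y => c1 c2.
  have k0 : 0 < (z - y) ^+ 2 + e ^+ 2 by apply: kden_gt0; rewrite gt_eqF.
  by have c3 := lk_cont k0; cont.
- move=> z y _ _; have k0 : 0 < (z - y) ^+ 2 + e ^+ 2 by apply: kden_gt0; rewrite gt_eqF.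
  apply: der_eq; first by (rewrite /lk; isd).
  by rewrite /= /kre /kden; field; rewrite gt_eqF.
move=> z y _ yS; rewrite mulrN normrN mulrAC normrM.
by apply: ler_pM => //; [exact: HK|exact: kre_bound].
Qed.

Lemma resolvent_cont x e : 0 < e -> {for x, continuous (fun x => L (fun y => p y * kre x e y * - Q y))}.
Proof.
move=> e0.
have [K K0 HK] : exists2 K : R, 0 < K & forall y, bands y -> `|p y * Q y| <= K.
  by apply: bands_bounded => // y _; have := @p_cont y; have := @q_cont y => c1 c2; cont.
have ix : x - 1 < x < x + 1 by rewrite ltrBlDr ltrDl ltr01.
apply: is_derive_cont.
apply: (fun_derive F (g := fun x y => p y * kre x e y * - Q y)
  (dg := fun x y => p y * kre2 x e y * Q y) (K := K / e ^+ 2) ix).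
- move=> z _ y yS; have := @p_cont y; have := @q_cont y => c1 c2.
  by have c3 := kre_cont (@offe z e e0) yS; cont.
- move=> z y _ _; have k0 : kden z e y != 0 by rewrite gt_eqF// kden_gt0// gt_eqF.
  have d := kre_der_x k0.
  apply: der_eq; first by isd.
  by rewrite /=; ring.
move=> z y _ yS; rewrite mulrAC normrM.
apply: ler_pM => //; first exact: HK.
by apply: kre2_bound; [rewrite exprn_gt0|exact: kden_ge].
Qed.

(** Writing -Q(y) p(y) = (x - y) [dd x y] - Q(x) p(x) splits the resolvent of the density into a
    part that tends to L([dd x]) and a multiple of the known resolvent. *)
Lemma resolventE x e : 0 < e -> L (fun y => p y * kre x e y * - Q y) =
  L (fun y => dd x y * ((x - y) * kre x e y)) - p x * (Q x * L (kre x e)).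
Proof.
move=> e0.
have ck := kre_cont (@offe x e e0).
have cd : ctsOn bands (fun y => dd x y * ((x - y) * kre x e y)).
  by move=> y yS; have := ck _ yS; have := @dd_cont x y => c1 c2; cont.
rewrite (_ : _ - _ = L (fun y => dd x y * ((x - y) * kre x e y)) + (- (p x * Q x)) * L (kre x e)); last by ring.
rewrite -(fun_scale F)// -(fun_add F)//; last by move=> y /ck c1; cont.
apply: (fun_ext F) => y _; rewrite mulrA (mulrC (dd x y)) -ddE; ring.
Qed.

Let k2_01 x e y : 0 < e -> 0 <= (x - y) * kre x e y <= 1.
Proof.
move=> e0; have k0 : 0 < kden x e y by rewrite kden_gt0// gt_eqF.
rewrite /kre mulrA -expr2 divr_ge0 ?sqr_ge0 ?(ltW k0)//= ler_pdivrMr// mul1r.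
by rewrite lerDl sqr_ge0.
Qed.

Lemma resolvent_cvg x :
  L (fun y => p y * kre x n.+1%:R^-1 y * - Q y) @[n --> \oo] --> L (dd x) - p x * jump x.
Proof.
have en n : 0 < (n.+1%:R^-1 : R) by rewrite invr_gt0 ltr0n.
rewrite (_ : (fun n => _) = (fun n => L (fun y => dd x y * ((x - y) * kre x n.+1%:R^-1 y)) -
   p x * (Q x * L (kre x n.+1%:R^-1)))); last by apply/funext => n; rewrite resolventE.
apply: cvgB; last by apply: cvgMr; exact: Qkre_cvg.
have [K HK] := dd_bound `|x|.
apply: (arcs_cvg h1 h2 h3 (c := x) (K := K)).
- move=> n y yS; have := kre_cont (@offe x _ (en n)) yS; have := @dd_cont x y => c1 c2.
  by cont.
- by move=> y _; exact: dd_cont.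
- move=> y yS yx; rewrite -[X in _ --> X]mulr1; apply: cvgMr.
  have := @cvg_invS R (fun e => (x - y) * kre x e y).
  have xy : x - y != 0 by rewrite subr_eq0 eq_sym.
  rewrite kre0 mulfV//; apply.
  rewrite /kre /kden; cont.
  by rewrite expr0n addr0 expf_eq0.
move=> n y yS; rewrite normrM -[leRHS]mulr1; apply: ler_pM => //; first exact: HK.
by have /andP[k0 k1] := k2_01 x y (en n); rewrite ger0_norm.
Qed.

(** At positive height this is the fundamental theorem of calculus for [upotE]; dominated
    convergence carries both sides to height 0, although the potential need not be differentiable at
    the endpoints. *)
Lemma upot_formula x1 x2 : x1 <= x2 ->
  intg x1 x2 (fun x => L (dd x) - p x * jump x) /\
  upot a1 b1 a2 b2 p x2 - upot a1 b1 a2 b2 p x1 = Int x1 x2 (fun x => L (dd x) - p x * jump x).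
Proof.
move=> x12; have en n : 0 < (n.+1%:R^-1 : R) by rewrite invr_gt0 ltr0n.
pose G n x := L (fun y => p y * kre x n.+1%:R^-1 y * - Q y).
have cG n : cts x1 x2 (G n) by move=> x _; exact: resolvent_cont.
have [K HK] := dd_bound (`|x1| + `|x2|).
pose m := arc1 a1 b1 a2 b2 (fun=> 1) + arc2 a1 b1 a2 b2 (fun=> 1).
(* The two terms dominate the two terms of [resolventE]: [arcs_bound] for the divided difference,
   [Qkre_bound] for the rest. *)
pose g x := K * m + `|p x| * Num.sqrt (jumpC a1 b1 a2 b2 * `|Q x|).
have ig : intg x1 x2 g.
  apply: cts_intg => x _; have := @p_cont x; have := @q_cont x => c1 c2.
  by rewrite /g; cont.
have mf : measurable_fun `[x1, x2] (fun x => L (dd x) - p x * jump x).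
  apply: (measurable_fun_cvg (h := G)).
    by move=> n; exact: (intg_measurable (cts_intg (cG n))).
  by move=> x _; exact: resolvent_cvg.
have xb x : x1 <= x <= x2 -> `|x| <= `|x1| + `|x2|.
  move=> /andP[l r]; have := ler_norm x2; have := ler_norm (- x1); rewrite normrN => n1 n2.
  by have := normr_ge0 x1; have := normr_ge0 x2 => n3 n4; rewrite ler_norml; apply/andP; split; lra.
(* Convergence holds everywhere, so the exceptional point is placed outside the segment. *)
have [] // := @Int_dominated R x1 x2 (x1 - 1) G _ g (fun n => cts_intg (cG n)) mf ig.
- by move=> x _ _; exact: resolvent_cvg.
- move=> n x xi _; rewrite /G resolventE//.
  apply: le_trans (ler_normB _ _) _; apply: lerD.
    apply: (arcs_bound h1 h2 h3).
      move=> y yS; have := kre_cont (@offe x _ (en n)) yS; have := @dd_cont x y => c1 c2.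
      by cont.
    move=> y yS; rewrite normrM -[leRHS]mulr1; apply: ler_pM => //; first exact/HK/yS/xb.
    by have /andP[k0 k1] := k2_01 x y (en n); rewrite ger0_norm.
  rewrite normrM ler_wpM2l//.
  exact: Qkre_bound.
move=> il lim; split=> //.
have lim2 : Int x1 x2 (G n) @[n --> \oo] --> upot a1 b1 a2 b2 p x2 - upot a1 b1 a2 b2 p x1.
  rewrite (_ : (fun n => _) = (fun n => upotE a1 b1 a2 b2 p x2 n.+1%:R^-1 - upotE a1 b1 a2 b2 p x1 n.+1%:R^-1)).
    by apply: cvgB; apply: upotE_cvg => // y _; exact: p_cont.
  apply/funext => n; apply: (@Int_FTC R x1 x2 (G n) (fun x => upotE a1 b1 a2 b2 p x n.+1%:R^-1) x12) => //.
    by move=> x _; apply: is_derive_cont; exact: upotE_der.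
  by move=> x _; exact: upotE_der.
by have := cvg_unique _ lim2 lim; apply.
Qed.

End Formula.

(** * Moments, and the polynomial part of the formula for p(y) = y - c *)

Section Moments.
Context {R : realType}.
Variables (a1 b1 a2 b2 : R).
Hypotheses (h1 : a1 < b1) (h2 : b1 < a2) (h3 : a2 < b2).
Implicit Types (x y e c : R).

Local Notation s1 := (sym1 a1 b1 a2 b2).
Local Notation s2 := (sym2 a1 b1 a2 b2).
Local Notation s3 := (sym3 a1 b1 a2 b2).
Local Notation s4 := (sym4 a1 b1 a2 b2).
Local Notation Q := (quart s1 s2 s3 s4).
Local Notation bands := (bands a1 b1 a2 b2).
Local Notation L := (arcs a1 b1 a2 b2).
Local Notation jump := (jump a1 b1 a2 b2).

Let F := arcs_functional h1 h2 h3.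

Definition moment k := L (fun y => y ^+ k).

Lemma arcs_sum n (u : nat -> R) : L (fun y => \sum_(k < n) u k * y ^+ k) = \sum_(k < n) u k * moment k.
Proof.
elim: n => [|n ih].
  rewrite big_ord0 (fun_ext F (g := fun y => 0 * 1)); last by move=> y _; rewrite big_ord0 mul0r.
  by rewrite (fun_scale F) ?mul0r// => y _; exact: contC.
rewrite big_ord_recr -ih/= (fun_ext F (g := fun y => \sum_(k < n) u k * y ^+ k + u n * y ^+ n)).
  rewrite (fun_add F) ?(fun_scale F)// => y _; try by cont.
  elim: n {ih} => [|n ih].
    rewrite (_ : (fun y => _) = (fun=> 0)); first exact: contC.
    by apply/funext => z; rewrite big_ord0.
  rewrite (_ : (fun y => _) = (fun y => \sum_(k < n) u k * y ^+ k + u n * y ^+ n)); first by cont.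
  by apply/funext => z; rewrite big_ord_recr.
by move=> y _; rewrite big_ord_recr.
Qed.

Lemma moment0 : moment 0 = 0.
Proof. by rewrite -(arcs_moment0 h1 h2 h3); apply: (fun_ext F). Qed.

Lemma moment2 : moment 2 = s1 / 2 * moment 1.
Proof. by rewrite /moment (arcs_moment2 h1 h2 h3). Qed.

Lemma moment1_gt0 : 0 < moment 1.
Proof.
have H2 := h2; apply: (arcs_gt0 h1 h2 h3 (k := (b1 + a2) / 2)).
- by move=> y _; cont.
- by move=> y /andP[? ?]; lra.
- by move=> y /andP[? ?]; lra.
Qed.

(** [fun_exact] with g = 1 gives L(Q') = 0; g = y and g = y^2 give the next two moments, so all
    those used are multiples of the first. *)
Lemma moment3 : moment 3 = (3 / 8 * s1 ^+ 2 - s2 / 2) * moment 1.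
Proof.
have := fun_exact F (g := fun=> 1) (dg := fun=> 0) (fun y _ => @isdC R y 1) (fun y _ => @contC R y 0).
rewrite (fun_ext F (g := fun y => \sum_(k < 4) [:: - s3 / 2; s2; - (3 / 2) * s1; 2]`_k * y ^+ k)); last first.
  by move=> y _; rewrite !big_ord_recr big_ord0 /= /dquart; field.
rewrite arcs_sum !big_ord_recr big_ord0 /= moment0 moment2; lra.
Qed.

Lemma moment4 : moment 4 = (5 / 6 * s1 * (3 / 8 * s1 ^+ 2 - s2 / 2) - 2 / 3 * s2 * (s1 / 2) + s3 / 2) * moment 1.
Proof.
have := fun_exact F (g := fun y => y) (dg := fun=> 1) (fun y _ => @isdI R y) (fun y _ => @contC R y 1).
rewrite (fun_ext F (g := fun y => \sum_(k < 5) [:: s4; - (3 / 2) * s3; 2 * s2; - (5 / 2) * s1; 3]`_k * y ^+ k)); last first.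
  by move=> y _; rewrite !big_ord_recr big_ord0 /= /dquart /quart; field.
rewrite arcs_sum !big_ord_recr big_ord0 /= moment0 moment2 moment3; lra.
Qed.

(** [mu4] and [mu5] are the fourth and fifth moments divided by the first. *)
Definition mu4 := 5 / 6 * s1 * (3 / 8 * s1 ^+ 2 - s2 / 2) - 2 / 3 * s2 * (s1 / 2) + s3 / 2.
Definition mu5 := (7 / 2 * s1 * mu4 - 3 * s2 * (3 / 8 * s1 ^+ 2 - s2 / 2) + 5 / 2 * s3 * (s1 / 2) - 2 * s4) / 4.

Lemma moment5 : moment 5 = mu5 * moment 1.
Proof.
have dX y : der y (fun y => y ^+ 2) (2 * y) by apply: der_eq; [isd|rewrite /=; ring].
have cX : ctsOn bands (fun y => 2 * y) by move=> y _; cont.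
have := fun_exact F (fun y _ => dX y) cX.
rewrite (fun_ext F (g := fun y => \sum_(k < 6) [:: 0; 2 * s4; - (5 / 2) * s3; 3 * s2; - (7 / 2) * s1; 4]`_k * y ^+ k)); last first.
  by move=> y _; rewrite !big_ord_recr big_ord0 /= /dquart /quart; field.
rewrite arcs_sum !big_ord_recr big_ord0 /= moment0 moment2 moment3 moment4 /mu5 /mu4; lra.
Qed.

Section fixc.
Variable c : R.

(** [qf4] to [qf1] are the coefficients of Q(y) (y - c) at y^4 to y, and [qdd] is its divided
    difference. *)
Definition qf4 := - (s1 + c).
Definition qf3 := s2 + c * s1.
Definition qf2 := - (s3 + c * s2).
Definition qf1 := s4 + c * s3.

Definition qdd x y := x ^+ 4 + x ^+ 3 * y + x ^+ 2 * y ^+ 2 + x * y ^+ 3 + y ^+ 4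
  + qf4 * (x ^+ 3 + x ^+ 2 * y + x * y ^+ 2 + y ^+ 3) + qf3 * (x ^+ 2 + x * y + y ^+ 2)
  + qf2 * (x + y) + qf1.

Lemma qddE x y : Q x * (x - c) - Q y * (y - c) = (x - y) * qdd x y.
Proof. by rewrite /quart /qdd /qf4 /qf3 /qf2 /qf1; ring. Qed.

(** After division by the first moment, [qlin] and [qcst] are the lower coefficients of L([qdd x])
    as a cubic in x, and [qmass] is the total integral of (y - c) sqrt |Q| with the signs of the
    bands. *)
Definition qlin := qf3 + qf4 * (s1 / 2) + (3 / 8 * s1 ^+ 2 - s2 / 2).
Definition qcst := qf2 + qf3 * (s1 / 2) + qf4 * (3 / 8 * s1 ^+ 2 - s2 / 2) + mu4.
Definition qmass := - (mu5 + qf4 * mu4 + qf3 * (3 / 8 * s1 ^+ 2 - s2 / 2) + qf2 * (s1 / 2) + qf1).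

Lemma arcs_qdd x : L (qdd x) = moment 1 * (x ^+ 3 - (c + s1 / 2) * x ^+ 2 + qlin * x + qcst).
Proof.
rewrite (fun_ext F (g := fun y => \sum_(k < 5) [:: x ^+ 4 + qf4 * x ^+ 3 + qf3 * x ^+ 2 + qf2 * x + qf1;
  x ^+ 3 + qf4 * x ^+ 2 + qf3 * x + qf2; x ^+ 2 + qf4 * x + qf3; x + qf4; 1]`_k * y ^+ k)); last first.
  by move=> y _; rewrite !big_ord_recr big_ord0 /= /qdd; ring.
by rewrite arcs_sum !big_ord_recr big_ord0 /= moment0 moment2 moment3 moment4 /qlin /qcst /mu4 /qf4; field.
Qed.

Lemma arcs_mass : L (fun y => (y - c) * - Q y) = moment 1 * qmass.
Proof.
rewrite (fun_ext F (g := fun y => \sum_(k < 6) [:: c * s4; - qf1; - qf2; - qf3; - qf4; -1]`_k * y ^+ k)); last first.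
  by move=> y _; rewrite !big_ord_recr big_ord0 /= /quart /qf4 /qf3 /qf2 /qf1; ring.
rewrite arcs_sum !big_ord_recr big_ord0 /= moment0 moment2 moment3 moment4 moment5 /qmass /mu4; ring.
Qed.

Lemma qdd_bound (B : R) : exists K : R, forall x y, `|x| <= B -> bands y -> `|qdd x y| <= K.
Proof.
have [Y Y0 HY] : exists2 Y : R, 0 < Y & forall y, bands y -> `|y| <= Y.
  by apply: bands_bounded => // y _; cont.
exists (B ^+ 4 + B ^+ 3 * Y + B ^+ 2 * Y ^+ 2 + B * Y ^+ 3 + Y ^+ 4
  + `|qf4| * (B ^+ 3 + B ^+ 2 * Y + B * Y ^+ 2 + Y ^+ 3) + `|qf3| * (B ^+ 2 + B * Y + Y ^+ 2)
  + `|qf2| * (B + Y) + `|qf1|).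
move=> x y xB /HY yY.
have B0 : 0 <= B by exact: le_trans xB.
have px k : `|x ^+ k| <= B ^+ k by rewrite normrX; apply: lerXn2r; rewrite ?nnegrE.
have py k : `|y ^+ k| <= Y ^+ k by rewrite normrX; apply: lerXn2r; rewrite ?nnegrE// ltW.
rewrite /qdd; repeat (exact: xB || exact: yY || exact: lexx || exact: px || exact: py
  || (rewrite normrM; apply: ler_pM => //)
  || (apply: le_trans (ler_normD _ _) _; apply: lerD)).
Qed.

Lemma quartic_formula x1 x2 : x1 <= x2 ->
  intg x1 x2 (fun x => moment 1 * (x ^+ 3 - (c + s1 / 2) * x ^+ 2 + qlin * x + qcst) - (x - c) * jump x) /\
  upot a1 b1 a2 b2 (fun y => y - c) x2 - upot a1 b1 a2 b2 (fun y => y - c) x1 =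
  Int x1 x2 (fun x => moment 1 * (x ^+ 3 - (c + s1 / 2) * x ^+ 2 + qlin * x + qcst) - (x - c) * jump x).
Proof.
move=> x12.
have [|||| i E] := @upot_formula R a1 b1 a2 b2 h1 h2 h3 (fun y => y - c) qdd _ _ _ _ x1 x2 x12.
- by move=> y; cont.
- by move=> x y; exact: qddE.
- by move=> x y; rewrite /qdd; cont.
- exact: qdd_bound.
split; first by apply: eq_intg i => x _; rewrite arcs_qdd.
by rewrite E; apply: eq_Int => x _; rewrite arcs_qdd.
Qed.

End fixc.
End Moments.

(** * Two-cut regularity in terms of densities *)

Section TwoCutDef.
Context {R : realType}.
Implicit Types (x y : R) (h V : {poly R}).

Definition bint (a1 b1 a2 b2 : R) (f : R -> R) : R := Int a1 b1 f + Int a2 b2 f.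
Definition dens (a1 b1 a2 b2 : R) h y : R := weight a1 b1 a2 b2 y * `|h.[y]|.
Definition lpot (a1 b1 a2 b2 : R) h x : R :=
  bint a1 b1 a2 b2 (fun y => dens a1 b1 a2 b2 h y * ln `|x - y|).

(** The analytic content of regularity for ordered bands, with the constant 1/c absorbed in [h] and
    minimality of the energy replaced by unit mass and the Euler-Lagrange conditions. *)
Record two_cut (a1 b1 a2 b2 : R) h V : Prop := TwoCut {
  tc_lt1 : a1 < b1 ;
  tc_lt2 : b1 < a2 ;
  tc_lt3 : a2 < b2 ;
  tc_neq0 : forall y, bands a1 b1 a2 b2 y -> h.[y] != 0 ;
  tc_mass : bint a1 b1 a2 b2 (dens a1 b1 a2 b2 h) = 1 ;
  tc_el : exists l : R,
    (forall x, bands a1 b1 a2 b2 x -> 2 * lpot a1 b1 a2 b2 h x - V.[x] = l) /\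
    (forall x, ~~ bands a1 b1 a2 b2 x -> 2 * lpot a1 b1 a2 b2 h x - V.[x] < l) }.

End TwoCutDef.

(** * The quartic potential with prescribed bands *)

Section Quartic.
Context {R : realType}.
Variables (a1 b1 a2 b2 : R).
Hypotheses (h1 : a1 < b1) (h2 : b1 < a2) (h3 : a2 < b2).
Implicit Types (x y e : R).

Local Notation s1 := (sym1 a1 b1 a2 b2).
Local Notation s2 := (sym2 a1 b1 a2 b2).
Local Notation s3 := (sym3 a1 b1 a2 b2).
Local Notation s4 := (sym4 a1 b1 a2 b2).
Local Notation Q := (quart s1 s2 s3 s4).
Local Notation bands := (bands a1 b1 a2 b2).
Local Notation jump := (jump a1 b1 a2 b2).
Local Notation weight := (weight a1 b1 a2 b2).

Let q_cont y : {for y, continuous Q}. Proof. exact: quart_cont. Qed.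
Let sq_cont y : {for y, continuous (fun x => Num.sqrt (Q x))}.
Proof. by have := @q_cont y => c1; cont. Qed.

(** The mean of x over the gap with weight sqrt Q; this is the position of the zero for which the
    effective potential takes equal values on both sides of the gap. *)
Definition gapc : R := Int b1 a2 (fun x => x * Num.sqrt (Q x)) / Int b1 a2 (fun x => Num.sqrt (Q x)).
Local Notation c := gapc.

Let gap_gt0 x : b1 < x < a2 -> 0 < Num.sqrt (Q x).
Proof.
move=> /andP[bx xa]; rewrite sqrtr_gt0 (quart_gt0 h1 h2 h3)//.
by rewrite bandsE negb_or !negb_and -!ltNge bx xa !orbT.
Qed.

Lemma gap_int_gt0 : 0 < Int b1 a2 (fun x => Num.sqrt (Q x)).
Proof. by apply: Int_gt0 => //; move=> x _; exact: sq_cont. Qed.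

Lemma gapc_int : Int b1 a2 (fun x => (x - c) * Num.sqrt (Q x)) = 0.
Proof.
have g0 := gap_int_gt0.
have i1 : intg b1 a2 (fun x => x * Num.sqrt (Q x)).
  by apply: cts_intg => x _; have := @q_cont x => c1; cont.
have i2 : intg b1 a2 (fun x => Num.sqrt (Q x)).
  by apply: cts_intg => x _; exact: sq_cont.
rewrite (@eq_Int _ _ _ _ (fun x => x * Num.sqrt (Q x) - c * Num.sqrt (Q x))); last by move=> x _; ring.
rewrite IntB//; last exact: intgZ.
by rewrite IntZ// /gapc divfK ?subrr// gt_eqF.
Qed.

Lemma gapc_itv : b1 < c < a2.
Proof.
have E := gapc_int; have g0 := gap_int_gt0.
have i1 k : cts b1 a2 (fun x => (x - k) * Num.sqrt (Q x)).
  by move=> x _; have := @q_cont x => c1; cont.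
have i2 : intg b1 a2 (fun x => Num.sqrt (Q x)).
  by apply: cts_intg => x _; exact: sq_cont.
have sh k : Int b1 a2 (fun x => (x - k) * Num.sqrt (Q x)) = (c - k) * Int b1 a2 (fun x => Num.sqrt (Q x)).
  rewrite (@eq_Int _ _ _ _ (fun x => (x - c) * Num.sqrt (Q x) + (c - k) * Num.sqrt (Q x))); last by move=> x _; ring.
  rewrite IntD; [|exact: cts_intg (i1 c)|exact: intgZ].
  by rewrite IntZ// E add0r.
apply/andP; split.
  have : 0 < Int b1 a2 (fun x => (x - b1) * Num.sqrt (Q x)).
    apply: Int_gt0 => // x xi; rewrite mulr_gt0 ?gap_gt0//.
    by case/andP: xi => ? _; rewrite subr_gt0.
  by rewrite sh pmulr_lgt0// subr_gt0.
have : 0 < Int b1 a2 (fun x => (-1) * ((x - a2) * Num.sqrt (Q x))).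
  apply: Int_gt0 => //.
    by move=> x _; have := @q_cont x => c1; cont.
  move=> x xi; rewrite mulN1r -mulNr mulr_gt0 ?gap_gt0//.
  by case/andP: xi => _ ?; rewrite opprB subr_gt0.
rewrite IntZ; last exact: cts_intg (i1 a2).
by rewrite sh mulN1r -mulNr pmulr_lgt0// opprB subr_gt0.
Qed.

Local Notation qlin := (qlin a1 b1 a2 b2 c).
Local Notation qcst := (qcst a1 b1 a2 b2 c).
Local Notation qmass := (qmass a1 b1 a2 b2 c).
Local Notation m1 := (moment a1 b1 a2 b2 1).

Definition qprim x := x ^+ 4 / 4 - (c + s1 / 2) * x ^+ 3 / 3 + qlin * x ^+ 2 / 2 + qcst * x.
(** The effective potential up to a positive factor; subtracting the primitive of the cubic leaves
    the derivative -(x - c) [jump x]. *)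
Definition wpot x := upot a1 b1 a2 b2 (fun y => y - c) x - m1 * qprim x.

Lemma wpotB x1 x2 : x1 <= x2 ->
  intg x1 x2 (fun x => (x - c) * jump x) /\
  wpot x2 - wpot x1 = - Int x1 x2 (fun x => (x - c) * jump x).
Proof.
move=> x12; have [i E] := quartic_formula h1 h2 h3 c x12.
pose k x := m1 * (x ^+ 3 - (c + s1 / 2) * x ^+ 2 + qlin * x + qcst).
have ck : cts x1 x2 k by move=> x _; rewrite /k; cont.
have dk x : der x (fun x => m1 * qprim x) (k x).
  by apply: der_eq; [rewrite /qprim; isd|rewrite /= /k; field].
have Ek : Int x1 x2 k = m1 * qprim x2 - m1 * qprim x1.
  apply: (@Int_FTC R x1 x2 k (fun x => m1 * qprim x)) => //.
  by move=> x _; exact: is_derive_cont (dk x).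
have ij : intg x1 x2 (fun x => (x - c) * jump x).
  by have := intgB (cts_intg ck) i; apply: eq_intg => x _; rewrite /k; ring.
split=> //.
have : Int x1 x2 (fun x => k x - (x - c) * jump x) = Int x1 x2 k - Int x1 x2 (fun x => (x - c) * jump x).
  by apply: IntB => //; exact: cts_intg.
by rewrite -E Ek /wpot; lra.
Qed.

Lemma wpot_decr x1 x2 (g : R -> R) : x1 < x2 -> (forall x, x1 <= x <= x2 -> (x - c) * jump x = g x) ->
  cts x1 x2 g -> (forall x, x1 < x < x2 -> 0 < g x) -> wpot x2 < wpot x1.
Proof.
move=> x12 Eg cg g0; have [_ E] := wpotB (ltW x12).
rewrite -subr_lt0 E oppr_lt0 (@eq_Int _ _ _ _ g)//.
exact: Int_gt0.
Qed.

Lemma wpot_incr x1 x2 (g : R -> R) : x1 < x2 -> (forall x, x1 <= x <= x2 -> (x - c) * jump x = - g x) ->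
  cts x1 x2 g -> (forall x, x1 < x < x2 -> 0 < g x) -> wpot x1 < wpot x2.
Proof.
move=> x12 Eg cg g0; have [_ E] := wpotB (ltW x12).
rewrite -subr_gt0 E (@eq_Int _ _ _ _ (fun x => -1 * g x)); last by move=> x /Eg ->; rewrite mulN1r.
rewrite IntZ ?mulN1r ?opprK; last exact: cts_intg.
exact: Int_gt0.
Qed.

Lemma wpot_eq x1 x2 : x1 <= x2 -> (forall x, x1 <= x <= x2 -> (x - c) * jump x = 0) -> wpot x2 = wpot x1.
Proof.
move=> x12 H; have [_ E] := wpotB x12; apply/eqP; rewrite -subr_eq0 E (@eq_Int _ _ _ _ (fun=> 0))//.
by rewrite Int_cst// mul0r oppr0.
Qed.

Let C := jumpC a1 b1 a2 b2.
Let C0 : 0 < Num.sqrt C. Proof. by rewrite sqrtr_gt0; exact: jumpC_gt0. Qed.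

Let jump_gap x : b1 <= x <= a2 -> (x - c) * jump x = - (Num.sqrt C * ((x - c) * Num.sqrt (Q x))).
Proof.
move=> /andP[]; rewrite le_eqVlt => /predU1P[<- _|bx].
  rewrite /jump (_ : Q b1 = 0); last by rewrite quartE; ring.
  by rewrite sqrtr0 !mulr0 oppr0.
rewrite le_eqVlt => /predU1P[->|xa].
  rewrite /jump (_ : Q a2 = 0); last by rewrite quartE; ring.
  by rewrite sqrtr0 !mulr0 oppr0.
by rewrite /jump bx xa /=; ring.
Qed.

Let jump_out x : x <= a1 \/ b2 <= x -> (x - c) * jump x = Num.sqrt C * ((x - c) * Num.sqrt (Q x)).
Proof.
have H1 := h1; have H2 := h2; have H3 := h3.
move=> xo; rewrite /jump ifF; first by ring.
by apply/negbTE/negP => /andP[? ?]; case: xo => ?; lra.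
Qed.

(** This is where the choice of [gapc] enters: the change across the gap is a multiple of the
    vanishing integral. *)
Let wpot_gap : wpot a2 = wpot b1.
Proof.
have [_ E] := wpotB (ltW h2); apply/eqP; rewrite -subr_eq0 E.
rewrite (@eq_Int _ _ _ _ (fun x => (- Num.sqrt C) * ((x - c) * Num.sqrt (Q x)))); last first.
  by move=> x /jump_gap ->; rewrite mulNr.
rewrite IntZ; first by rewrite gapc_int mulr0 oppr0.
by apply: cts_intg => x _; have := @q_cont x => c1; cont.
Qed.

Let wpot_band1 x : a1 <= x <= b1 -> wpot x = wpot b1.
Proof.
move=> /andP[ax xb]; apply/esym/wpot_eq => // y /andP[xy yb].
rewrite jump_bands ?mulr0//; apply/orP; left; apply/andP; split=> //.
exact: le_trans xy.
Qed.

Let wpot_band2 x : a2 <= x <= b2 -> wpot x = wpot b1.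
Proof.
move=> /andP[ax xb]; rewrite -wpot_gap; apply: wpot_eq => // y /andP[ay yx].
rewrite jump_bands ?mulr0//; apply/orP; right; apply/andP; split=> //.
exact: le_trans xb.
Qed.

Lemma wpot_bands x : bands x -> wpot x = wpot b1.
Proof. by move=> /orP[/wpot_band1|/wpot_band2]. Qed.

(** Signs of -(x - c) [jump]: [wpot] increases up to the first band and decreases after the second;
    in the gap it decreases up to [gapc] and then increases. A gap point is compared with the
    endpoint on its own side of [gapc]. *)
Lemma wpot_off x : ~~ bands x -> wpot x < wpot b1.
Proof.
have H1 := h1; have H2 := h2; have H3 := h3; have /andP[c1 c2] := gapc_itv.
have cg (s : R) y : {for y, continuous (fun x => Num.sqrt C * (s * (x - c) * Num.sqrt (Q x)))}.
  by have := @q_cont y => cs; cont.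
rewrite bandsE negb_or !negb_and -!ltNge => /andP[s1' s2'].
have [xa|ax] := ltP x a1.
  rewrite -(@wpot_band1 a1) ?lexx ?ltW//.
  apply: (@wpot_incr _ _ (fun x => Num.sqrt C * (-1 * (x - c) * Num.sqrt (Q x)))) => //.
  - move=> y /andP[_ ya]; rewrite jump_out; first by ring.
    by left.
  move=> y /andP[_ ya]; rewrite mulr_gt0// mulr_gt0 ?sqrtr_gt0//; first by lra.
  apply: (quart_gt0 h1 h2 h3); rewrite bandsE negb_or !negb_and -!ltNge ya/=.
  by rewrite (lt_trans ya)// (lt_trans h1).
have [bx|xb] := ltP b2 x.
  rewrite -(@wpot_band2 b2) ?lexx ?ltW//.
  apply: (@wpot_decr _ _ (fun x => Num.sqrt C * (1 * (x - c) * Num.sqrt (Q x)))) => //.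
  - move=> y /andP[ya _]; rewrite jump_out; first by ring.
    by right.
  move=> y /andP[ya _]; rewrite mulr_gt0// mulr_gt0 ?sqrtr_gt0//; first by lra.
  apply: (quart_gt0 h1 h2 h3); rewrite bandsE negb_or !negb_and -!ltNge ya/= orbT andbT.
  by apply/orP; right; lra.
have bx : b1 < x by case/orP: s1' => //; rewrite ltNge ax.
have xa : x < a2 by case/orP: s2' => //; rewrite ltNge xb.
have [xc|cx] := lerP x c.
  apply: (@wpot_decr _ _ (fun x => Num.sqrt C * (-1 * (x - c) * Num.sqrt (Q x)))) => //.
  - move=> y /andP[by_ yx]; rewrite jump_gap; first by ring.
    by rewrite by_/= (le_trans yx)// ltW.
  move=> y /andP[by_ yx]; rewrite mulr_gt0// mulr_gt0 ?gap_gt0//; first by lra.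
  by rewrite by_ (lt_trans yx).
rewrite -wpot_gap.
apply: (@wpot_incr _ _ (fun x => Num.sqrt C * (1 * (x - c) * Num.sqrt (Q x)))) => //.
- move=> y /andP[xy ya]; rewrite jump_gap; first by ring.
  by rewrite ya andbT (le_trans _ xy)// ltW.
move=> y /andP[xy ya]; rewrite mulr_gt0// mulr_gt0 ?gap_gt0//; first by lra.
by rewrite ya andbT (lt_trans bx).
Qed.

Local Notation M := (m1 * qmass).

Let w_cont y : {for y, continuous weight}. Proof. exact: weight_cont. Qed.

Lemma massE : sint a1 b1 a2 b2 (fun y => (y - c) * weight y) = M.
Proof.
rewrite -(arcs_mass h1 h2 h3) (sint_arcs h1 h2 h3 (g := fun y => y - c))//.
by move=> y _; cont.
Qed.

Lemma abs_band1 y : a1 <= y <= b1 -> `|y - c| = - (y - c).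
Proof. by have /andP[c1 c2] := gapc_itv => /andP[ay yb]; rewrite ltr0_norm//; lra. Qed.
Lemma abs_band2 y : a2 <= y <= b2 -> `|y - c| = y - c.
Proof. by have /andP[c1 c2] := gapc_itv => /andP[ay yb]; rewrite gtr0_norm//; lra. Qed.

(** y - c is negative on the first band and positive on the second, so the signs built into [sint]
    turn it into |y - c|: the signed calculus computes a positive measure. *)
Lemma sint_abs f : intg a1 b1 (fun y => `|y - c| * f y) ->
  sint a1 b1 a2 b2 (fun y => (y - c) * f y) = bint a1 b1 a2 b2 (fun y => `|y - c| * f y).
Proof.
move=> i1; rewrite /sint /bint addrC; congr (_ + _).
  rewrite -mulN1r (@eq_Int _ a1 b1 (fun y => (y - c) * f y) (fun y => -1 * (`|y - c| * f y))).
    by rewrite IntZ// mulrA mulrNN !mul1r.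
  by move=> y /abs_band1 ->; ring.
by apply: eq_Int => y /abs_band2 ->.
Qed.

Lemma mass_gt0 : 0 < M.
Proof.
have wgt0 a b : a < b -> (forall y, a < y < b -> (a1 < y < b1) || (a2 < y < b2)) ->
    (forall y, a < y < b -> y != c) -> 0 < Int a b (fun y => `|y - c| * weight y).
  move=> ab H yc; apply: Int_gt0 => //.
    by move=> y _; have := @w_cont y => cw; cont.
  move=> y yab; rewrite mulr_gt0 ?normr_gt0 ?subr_eq0 ?yc// sqrtr_gt0 normr_gt0 ltr0_neq0//.
  by apply: (quart_lt0 h1 h2 h3); exact: H.
have /andP[c1 c2] := gapc_itv.
rewrite -massE sint_abs; last by apply: cts_intg => y _; have := @w_cont y => cw; cont.
rewrite addr_gt0// wgt0//.
- by move=> y ->.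
- by move=> y /andP[_ yb]; rewrite lt_eqF// (lt_trans yb).
- by move=> y ->; rewrite orbT.
- by move=> y /andP[ay _]; rewrite gt_eqF// (lt_trans c2).
Qed.

Lemma qmass_gt0 : 0 < qmass.
Proof. by have := mass_gt0; rewrite pmulr_rgt0//; exact: moment1_gt0. Qed.

(** Dividing the density by the total mass [M] makes it a probability; the matching potential is
    twice [qprim] over [qmass], because the first moment cancels. *)
Definition qpotential : {poly R} := (2 * qmass)^-1 *: 'X^4 - (2 / 3 * (c + s1 / 2) / qmass) *: 'X^3
  + (qlin / qmass) *: 'X^2 + (2 * qcst / qmass) *: 'X.

Definition qh : {poly R} := M^-1 *: ('X - c%:P).

Lemma qpotentialE x : qpotential.[x] = 2 / qmass * qprim x.
Proof.
have := qmass_gt0; rewrite /qpotential !hornerD hornerN !hornerZ !hornerXn hornerX /qprim.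
by move: qmass qlin qcst => q u v q0; field; rewrite gt_eqF.
Qed.

Lemma quartic_two_cut : two_cut a1 b1 a2 b2 qh qpotential.
Proof.
have M0 := mass_gt0; have q0 := qmass_gt0; have m0 := moment1_gt0 h1 h2 h3.
have dE y : dens a1 b1 a2 b2 qh y = M^-1 * (`|y - c| * weight y).
  by rewrite /dens /qh hornerZ hornerXsubC normrM gtr0_norm ?invr_gt0//; ring.
have cw : ctsOn (fun=> True) (fun y => `|y - c| * weight y).
  by move=> y _; have := @w_cont y => cw; cont.
have lE x : lpot a1 b1 a2 b2 qh x = M^-1 * upot a1 b1 a2 b2 (fun y => y - c) x.
  rewrite /lpot /upot.
  have i a b : intg a b (fun y => (`|y - c| * weight y) * ln `|x - y|).
    by apply: intg_bounded_ln => y _; exact: cw.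
  have -> : sint a1 b1 a2 b2 (fun y => (y - c) * ln `|x - y| * weight y) =
      bint a1 b1 a2 b2 (fun y => `|y - c| * weight y * ln `|x - y|).
    transitivity (sint a1 b1 a2 b2 (fun y => (y - c) * (weight y * ln `|x - y|))).
      by rewrite /sint; congr (_ - _); apply: eq_Int => y _; ring.
    rewrite sint_abs; last by apply: eq_intg (i a1 b1) => y _; ring.
    by rewrite /bint; congr (_ + _); apply: eq_Int => y _; ring.
  rewrite /bint mulrDr -!IntZ//; congr (_ + _); apply: eq_Int => y _; rewrite dE; ring.
have ELE x : 2 * lpot a1 b1 a2 b2 qh x - qpotential.[x] = 2 / M * wpot x.
  rewrite lE qpotentialE /wpot; move: m0 q0.
  move: (upot _ _ _ _ _ x) m1 qmass (qprim x) => U mm qq pp mm0 qq0.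
  by field; rewrite !gt_eqF.
have M2 : 0 < 2 / M by rewrite divr_gt0.
split=> //.
- move=> y yS; rewrite /qh hornerZ hornerXsubC; apply: mulf_neq0; first by rewrite invr_eq0 gt_eqF.
  have /andP[c1 c2] := gapc_itv; rewrite subr_eq0; case/orP: yS => /andP[l r].
    by rewrite lt_eqF// (le_lt_trans r).
  by rewrite gt_eqF// (lt_le_trans c2).
- have i a b : intg a b (fun y => `|y - c| * weight y) by apply: cts_intg => y _; exact: cw.
  have : bint a1 b1 a2 b2 (fun y => `|y - c| * weight y) = M.
    by rewrite -massE sint_abs.
  move=> E; rewrite -(mulVf (lt0r_neq0 M0)) -[X in _ = _ * X]E /bint mulrDr -!IntZ//.
  by congr (_ + _); apply: eq_Int => y _; rewrite dE.
exists (2 / M * wpot b1); split=> x xS; rewrite ELE.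
  by rewrite wpot_bands.
by rewrite ltr_pM2l// wpot_off.
Qed.

End Quartic.

(** * Signs on a band, and divided differences of general polynomials *)

Section ConstSign.
Context {R : realType}.

Lemma poly_const_sign (a b : R) (h : {poly R}) : (forall y, a <= y <= b -> h.[y] != 0) ->
  (forall y, a <= y <= b -> 0 < h.[y]) \/ (forall y, a <= y <= b -> h.[y] < 0).
Proof.
move=> h0; have [ba|ab] := ltP b a.
  by left=> y /andP[ay yb]; have := le_lt_trans (le_trans ay yb) ba; rewrite ltxx.
have [ha|ha|ha] := ltgtP h.[a] 0; last by have := h0 a; rewrite lexx ab ha eqxx => /(_ isT).
  right=> y /andP[ay yb]; rewrite ltNge; apply/negP => hy.
  have [|z /andP[az zy] /rootP rz] := @poly_ivt R h a y ay; first by rewrite (ltW ha).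
  by have := h0 z; rewrite rz eqxx az (le_trans zy yb) => /(_ isT).
left=> y /andP[ay yb]; rewrite ltNge; apply/negP => hy.
have [|z /andP[az zy] /rootP rz] := @poly_ivt R (- h) a y ay.
  by rewrite !hornerN oppr_le0 oppr_ge0 (ltW ha).
by have := h0 z; rewrite -[h.[z]]opprK -hornerN rz oppr0 eqxx az (le_trans zy yb) => /(_ isT).
Qed.

End ConstSign.

Section DividedDifference.
Context {R : realType}.
Variables (a1 b1 a2 b2 : R).
Hypotheses (h1 : a1 < b1) (h2 : b1 < a2) (h3 : a2 < b2).
Local Notation bands := (bands a1 b1 a2 b2).
Variable f : {poly R}.
Local Notation N := (size f).

(** [ddco i x] is the coefficient of y^i in (f(x) - f(y)) / (x - y); applying L in y to that
    quotient gives the polynomial [resid] in x. *)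
Definition ddco (i : nat) (x : R) : R := \sum_(k < N | (i < k)%N) f`_k * x ^+ (k.-1 - i).
Definition ddpoly (x y : R) : R := \sum_(i < N) ddco i x * y ^+ i.
Definition resid : {poly R} := \sum_(i < N) \sum_(k < N | (i < k)%N) (f`_k * moment a1 b1 a2 b2 i) *: 'X^(k.-1 - i).

Lemma ddpolyE x y : f.[x] - f.[y] = (x - y) * ddpoly x y.
Proof.
rewrite !horner_coef -sumrB /ddpoly mulr_sumr.
transitivity (\sum_(k < N) \sum_(i < N | (i < k)%N) (x - y) * (f`_k * x ^+ (k.-1 - i) * y ^+ i)).
  apply: eq_bigr => k _; rewrite -mulrBr subrXX mulrCA mulr_sumr mulr_sumr.
  rewrite (big_ord_widen_cond _ (fun=> true) (fun i => (x - y) * (f`_k * (x ^+ (k.-1 - i) * y ^+ i))) (ltnW (ltn_ord k))).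
  by apply: eq_bigr => i _; rewrite -!mulrA.
rewrite (exchange_big_dep predT)//=; apply: eq_bigr => i _.
by rewrite /ddco mulr_suml mulr_sumr.
Qed.

Lemma sum_cont n (u : nat -> R -> R) x : (forall i, {for x, continuous (u i)}) ->
  {for x, continuous (fun y => \sum_(i < n) u i y)}.
Proof.
move=> cu; elim: n => [|n ih].
  rewrite (_ : (fun y => _) = (fun=> 0)); first exact: contC.
  by apply/funext => z; rewrite big_ord0.
rewrite (_ : (fun y => _) = (fun y => \sum_(i < n) u i y + u n y)); last first.
  by apply/funext => z; rewrite big_ord_recr.
by have := cu n => c; cont.
Qed.

Lemma ddpoly_cont x y : {for y, continuous (ddpoly x)}.
Proof. by apply: (@sum_cont N (fun i y => ddco i x * y ^+ i)) => i; cont. Qed.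

Lemma arcs_ddpoly x : arcs a1 b1 a2 b2 (ddpoly x) = resid.[x].
Proof.
rewrite /ddpoly (arcs_sum h1 h2 h3 _ (fun i => ddco i x)) /resid horner_sum; apply: eq_bigr => i _.
rewrite horner_sum /ddco mulr_suml; apply: eq_bigr => k _.
by rewrite hornerZ hornerXn; ring.
Qed.

Lemma ddpoly_bound (B : R) : exists K : R, forall x y, `|x| <= B -> bands y -> `|ddpoly x y| <= K.
Proof.
have [Y Y0 HY] : exists2 Y : R, 0 < Y & forall y, bands y -> `|y| <= Y.
  by apply: bands_bounded => // y _; cont.
exists (\sum_(i < N) (\sum_(k < N | (i < k)%N) `|f`_k| * B ^+ (k.-1 - i)) * Y ^+ i).
move=> x y xB /HY yY; apply: le_trans (ler_norm_sum _ _ _) _; apply: ler_sum => i _.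
rewrite normrM; apply: ler_pM => //; last first.
  by rewrite normrX; apply: lerXn2r; rewrite ?nnegrE// ltW.
apply: le_trans (ler_norm_sum _ _ _) _; apply: ler_sum => k _.
rewrite normrM ler_wpM2l// normrX; apply: lerXn2r; rewrite ?nnegrE//.
exact: le_trans xB.
Qed.

End DividedDifference.

(** * A Stieltjes transform is not a polynomial off its band *)

Section Opposite.
Context {R : realType}.
Variables (a1 b1 a2 b2 : R).
Hypotheses (h1 : a1 < b1) (h2 : b1 < a2) (h3 : a2 < b2).
Implicit Types (x y : R).
Local Notation bands := (bands a1 b1 a2 b2).
Local Notation weight := (weight a1 b1 a2 b2).
Variables (p : R -> R).
Hypothesis p_cont : forall y, {for y, continuous p}.
Hypothesis p_gt0 : forall y, a2 <= y <= b2 -> 0 < p y.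

(** [G n] is the n-th derivative, divided by n!, of the Stieltjes transform of the density on the
    second band, evaluated on the first. *)
Let G n x : R := Int a2 b2 (fun y => weight y * p y * (y - x)^-1 ^+ n.+1).

Let w_cont y : {for y, continuous weight}. Proof. exact: weight_cont. Qed.

Let wp_bound : exists K : R, forall y, a2 <= y <= b2 -> `|weight y * p y| <= K.
Proof.
have [|z _ Hz] := @EVT_max R (fun y => `|weight y * p y|) a2 b2 (ltW h3).
  by apply: cts_within => y _; have := @w_cont y; have := @p_cont y => c1 c2; cont.
by exists `|weight z * p z| => y yab; apply: Hz; rewrite in_itv.
Qed.

Let yx_gt0 x y : a1 < x < b1 -> a2 <= y <= b2 -> a2 - b1 <= y - x.
Proof. by move=> /andP[_ xb] /andP[ay _]; lra. Qed.

Let inv_cont n x y : a1 < x < b1 -> a2 <= y <= b2 -> {for y, continuous (fun y => weight y * p y * (y - x)^-1 ^+ n)}.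
Proof.
move=> xi yi; have H2 := h2; have yx := yx_gt0 xi yi.
have n0 : y - x != 0 by apply: lt0r_neq0; lra.
by have := @w_cont y; have := @p_cont y => c1 c2; cont.
Qed.

Let G_der n x : a1 < x < b1 -> der x (G n) (n.+1%:R * G n.+1 x).
Proof.
move=> xi; have [K HK] := wp_bound; have H2 := h2.
have d0 : 0 < a2 - b1 by lra.
apply: der_eq.
  apply: (@Int_derive R a2 b2 a1 b1 x (K * (n.+1%:R * (a2 - b1)^-1 ^+ n.+2)) (fun x y => weight y * p y * (y - x)^-1 ^+ n.+1)
    (fun x y => weight y * p y * (n.+1%:R * (y - x)^-1 ^+ n.+2))) => //.
  - by move=> z zi y yi; exact: inv_cont.
  - move=> z y zi yi; have yz := yx_gt0 zi yi; have n0 : y - z != 0 by apply: lt0r_neq0; lra.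
    apply: der_eq; first by isd.
    rewrite /= !exprS; field; rewrite ?n0//.
  move=> z y zi yi; rewrite normrM; apply: ler_pM => //; first exact: HK.
  have yz := yx_gt0 zi yi; have yz0 : 0 < y - z by lra.
  rewrite ger0_norm; last by rewrite mulr_ge0// exprn_ge0// invr_ge0 ltW.
  rewrite ler_wpM2l//; apply: lerXn2r; rewrite ?nnegrE ?invr_ge0; [exact: ltW|exact: ltW|].
  by rewrite lef_pV2 ?posrE.
rewrite /G -IntZ; last by apply: cts_intg => y yi; exact: inv_cont.
by apply: eq_Int => y _; ring.
Qed.

Let G_gt0 n x : a1 < x < b1 -> 0 < G n x.
Proof.
move=> xi; have H2 := h2; apply: Int_gt0 => //; first by move=> y yi; exact: inv_cont.
move=> y /andP[ay yb]; have yi : a2 <= y <= b2 by rewrite !ltW.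
have yx := yx_gt0 xi yi.
rewrite !mulr_gt0 ?exprn_gt0 ?invr_gt0 ?p_gt0//; last by lra.
rewrite sqrtr_gt0 normr_gt0 ltr0_neq0// (quart_lt0 h1 h2 h3)//.
by rewrite ay yb orbT.
Qed.

(* All derivatives of the Stieltjes transform of a positive measure are positive,
   so it cannot coincide with a polynomial on an interval. *)
Lemma stieltjes_not_poly (P : {poly R}) : ~ (forall x, a1 < x < b1 -> G 0 x = P.[x]).
Proof.
move=> H.
have key n : forall x, a1 < x < b1 -> (n`!)%:R * G n x = P^`(n).[x].
  elim: n => [|n ih] x xi; first by rewrite mul1r derivn0 H.
  have d1 : der x (fun x => (n`!)%:R * G n x) ((n.+1`!)%:R * G n.+1 x).
    apply: der_eq; first by apply: isdM; [exact: isdC|exact: G_der].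
    by rewrite /= mul0r add0r mulrA -natrM factS mulnC.
  have d2 : der x (fun x => (n`!)%:R * G n x) P^`(n.+1).[x].
    apply: (is_derive_near_eq xi (f := horner P^`(n))); first by move=> y /ih ->.
    by rewrite derivnS; exact: is_derive_poly.
  exact: is_derive_unique d1 d2.
have m1 : a1 < (a1 + b1) / 2 < b1 by rewrite !midf_lt.
have /eqP := key (size P) _ m1; rewrite derivn_poly0// horner0 mulf_eq0.
by rewrite pnatr_eq0 gtn_eqF ?fact_gt0//= gt_eqF// G_gt0.
Qed.


End Opposite.

(** * Opposite signs on the bands, and convex combinations *)

Section Combination.
Context {R : realType}.
Variables (a1 b1 a2 b2 : R).
Implicit Types (x y : R) (h V : {poly R}).
Local Notation s1 := (sym1 a1 b1 a2 b2).
Local Notation s2 := (sym2 a1 b1 a2 b2).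
Local Notation s3 := (sym3 a1 b1 a2 b2).
Local Notation s4 := (sym4 a1 b1 a2 b2).
Local Notation Q := (quart s1 s2 s3 s4).
Local Notation bands := (bands a1 b1 a2 b2).
Local Notation weight := (weight a1 b1 a2 b2).
Local Notation two_cut := (two_cut a1 b1 a2 b2).
Local Notation rho := (dens a1 b1 a2 b2).
Local Notation pot := (lpot a1 b1 a2 b2).

Let w_cont y : {for y, continuous weight}. Proof. exact: weight_cont. Qed.

(** With one common sign, the potential of the measure is the sum of the band contributions while
    [upot] is their difference. On the first band the former is (V + l) / 2 and the latter has
    polynomial derivative, so the second band alone would have a polynomial potential there. *)
Lemma same_sign_absurd h V (s : R) : two_cut h V -> (forall y, bands y -> 0 < s * h.[y]) -> `|s| = 1 -> False.
Proof.
move=> H sh s_1; have h1 := tc_lt1 H; have h2 := tc_lt2 H; have h3 := tc_lt3 H.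
have [l [EL _]] := tc_el H.
pose p y := s * h.[y].
have p_cont y : {for y, continuous p} by rewrite /p; cont.
have absp y : bands y -> `|h.[y]| = p y.
  by move=> /sh hy; rewrite -[LHS]mul1r -s_1 -normrM gtr0_norm.
pose Qp : {poly R} := 'X^4 - s1 *: 'X^3 + s2 *: 'X^2 - s3 *: 'X + s4%:P.
have QpE y : Qp.[y] = Q y.
  by rewrite /Qp !hornerD !hornerN !hornerZ !hornerXn hornerX hornerC.
pose f := Qp * (s *: h).
have fE y : f.[y] = Q y * p y by rewrite /f hornerM QpE hornerZ.
have b1in x : a1 <= x <= b1 -> bands x by rewrite bandsE => ->.
have b2in x : a2 <= x <= b2 -> bands x by rewrite bandsE => ->; rewrite orbT.
(* On the first band [jump] vanishes, leaving only the polynomial [resid] as derivative. *)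
have UF x : a1 <= x <= b1 -> upot a1 b1 a2 b2 p x = upot a1 b1 a2 b2 p a1 + Int a1 x (fun t => (resid a1 b1 a2 b2 f).[t]).
  move=> /andP[ax xb].
  have [||||_ E] := @upot_formula R a1 b1 a2 b2 h1 h2 h3 p (ddpoly f) _ _ _ _ a1 x ax.
  - exact: p_cont.
  - by move=> z y; rewrite -!fE ddpolyE.
  - by move=> z y; exact: ddpoly_cont.
  - exact: ddpoly_bound.
  rewrite -(subrKC (upot a1 b1 a2 b2 p a1) (upot a1 b1 a2 b2 p x)) E; congr (_ + _).
  apply: eq_Int => t /andP[at_ tx]; rewrite arcs_ddpoly// jump_bands ?mulr0 ?subr0//.
  by apply: b1in; rewrite at_ (le_trans tx).
pose g x := Int a2 b2 (fun y => weight y * p y * ln (y - x)).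
(* Adding the two potentials cancels the contribution of the first band and doubles that of the
   second. *)
have gE x : a1 < x < b1 -> 2 * g x = (V.[x] + l) / 2 + (upot a1 b1 a2 b2 p a1 + Int a1 x (fun t => (resid a1 b1 a2 b2 f).[t])).
  move=> xi; have xi' : a1 <= x <= b1 by case/andP: xi => ? ?; rewrite !ltW.
  rewrite -UF//; have <- : 2 * pot h x / 2 = (V.[x] + l) / 2 by rewrite -(EL _ (b1in _ xi')) addrC subrK.
  rewrite /lpot /upot /sint /bint /dens /g.
  have -> : Int a1 b1 (fun y => weight y * `|h.[y]| * ln `|x - y|) = Int a1 b1 (fun y => p y * ln `|x - y| * weight y).
    by apply: eq_Int => y yi; rewrite absp ?b1in//; ring.
  have yx y : a2 <= y <= b2 -> ln `|x - y| = ln (y - x).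
    by move=> /andP[ay yb]; rewrite distrC gtr0_norm//; case/andP: xi => ? ?; lra.
  have -> : Int a2 b2 (fun y => weight y * `|h.[y]| * ln `|x - y|) = g x.
    by apply: eq_Int => y yi; rewrite yx// absp// b2in.
  have -> : Int a2 b2 (fun y => p y * ln `|x - y| * weight y) = g x.
    by apply: eq_Int => y yi; rewrite yx//; ring.
  by rewrite /g; field.
(* Differentiating twice the potential [g] of the second band gives V'/2 + [resid], and the
   Stieltjes transform is minus the derivative of [g]; hence the factor -1/2. *)
apply: (@stieltjes_not_poly R a1 b1 a2 b2 h1 h2 h3 p p_cont _ ((- (1/2)) *: ((1/2) *: V^`() + resid a1 b1 a2 b2 f))).
  by move=> y yi; apply/sh/b2in.
move=> x xi.
have [K HK] : exists K : R, forall y, a2 <= y <= b2 -> `|weight y * p y| <= K.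
  have [|z _ Hz] := @EVT_max R (fun y => `|weight y * p y|) a2 b2 (ltW h3).
    by apply: cts_within => y _; have := @w_cont y; have := @p_cont y => c1 c2; cont.
  by exists `|weight z * p z| => y yab; apply: Hz; rewrite in_itv.
have d1 : der x g (Int a2 b2 (fun y => weight y * p y * (- (y - x)^-1))).
  apply: (@Int_derive R a2 b2 a1 b1 x (K * (a2 - b1)^-1) (fun x y => weight y * p y * ln (y - x))
    (fun x y => weight y * p y * (- (y - x)^-1)) xi).
  - move=> z /andP[_ zb] y /andP[ay _]; have yz : 0 < y - z by lra.
    by have := @w_cont y; have := @p_cont y => c1 c2; cont.
  - move=> z y /andP[_ zb] /andP[ay _]; have yz : 0 < y - z by lra.
    apply: der_eq; first by isd.
    by rewrite /=; field; rewrite gt_eqF.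
  move=> z y /andP[_ zb] yi; have yz : 0 < y - z by case/andP: yi => ? ?; lra.
  rewrite normrM normrN; apply: ler_pM => //; first exact: HK.
  by rewrite normfV (gtr0_norm yz) lef_pV2 ?posrE; case/andP: yi => ? ?; lra.
have d2 : der x (fun x => 2 * g x) (V^`().[x] / 2 + (resid a1 b1 a2 b2 f).[x]).
  apply: (is_derive_near_eq xi (f := fun x => (V.[x] + l) / 2 + (upot a1 b1 a2 b2 p a1 + Int a1 x (fun t => (resid a1 b1 a2 b2 f).[t])))).
    by move=> y /gE.
  have dV : der x (horner V) V^`().[x] by exact: is_derive_poly.
  have dI : der x (fun x => Int a1 x (fun t => (resid a1 b1 a2 b2 f).[t])) (resid a1 b1 a2 b2 f).[x].
    by apply: (Int_FTC1 xi) => t _; cont.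
  apply: der_eq; first by isd.
  by rewrite /=; field.
have d3 : der x (fun x => 2 * g x) (2 * Int a2 b2 (fun y => weight y * p y * (- (y - x)^-1))).
  by apply: der_eq; [apply: isdM d1; exact: isdC|rewrite /= mul0r add0r].
have E := is_derive_unique d2 d3.
have ci : cts a2 b2 (fun y => weight y * p y * (- (y - x)^-1)).
  move=> y /andP[ay _]; have yx : y - x != 0 by apply: lt0r_neq0; case/andP: xi => ? ?; lra.
  by have := @w_cont y; have := @p_cont y => c1 c2; cont.
rewrite hornerZ hornerD hornerZ (_ : 1 / 2 * _ + _ = V^`().[x] / 2 + (resid a1 b1 a2 b2 f).[x]); last by rewrite mulrC; ring.
rewrite E (_ : - (1 / 2) * _ = -1 * Int a2 b2 (fun y => weight y * p y * - (y - x)^-1)); last by field.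
rewrite -IntZ; last exact: cts_intg.
by apply: eq_Int => y _; rewrite expr1; ring.
Qed.

(** Thus |h| is a polynomial on each band with signs prescribed by the band, up to one global sign
    [s]; this is what makes absolute values of two such factors add up to the absolute value of a
    polynomial. *)
Lemma opposite_sign h V : two_cut h V -> exists s : R, forall y,
  (a1 <= y <= b1 -> `|h.[y]| = - (s * h.[y])) /\ (a2 <= y <= b2 -> `|h.[y]| = s * h.[y]).
Proof.
move=> H; have h1 := tc_lt1 H; have h2 := tc_lt2 H; have h3 := tc_lt3 H.
have b1in x : a1 <= x <= b1 -> bands x by rewrite bandsE => ->.
have b2in x : a2 <= x <= b2 -> bands x by rewrite bandsE => ->; rewrite orbT.
have [p1|n1] := @poly_const_sign R a1 b1 h (fun y yi => tc_neq0 H (b1in _ yi));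
have [p2|n2] := @poly_const_sign R a2 b2 h (fun y yi => tc_neq0 H (b2in _ yi)).
- exfalso; apply: (same_sign_absurd H (s := 1)); last by rewrite normr1.
  by move=> y /orP[/p1|/p2]; rewrite mul1r.
- exists (-1) => y; split=> [/p1|/n2] yi; rewrite mulN1r ?opprK; first by rewrite gtr0_norm.
  by rewrite ltr0_norm.
- exists 1 => y; split=> [/n1|/p2] yi; rewrite mul1r; first by rewrite ltr0_norm.
  by rewrite gtr0_norm.
exfalso; apply: (same_sign_absurd H (s := -1)); last by rewrite normrN normr1.
by move=> y /orP[/n1|/n2]; rewrite mulN1r oppr_gt0.
Qed.

Lemma bint_lin (u v : R) (f g : R -> R) : intg a1 b1 f -> intg a1 b1 g -> intg a2 b2 f -> intg a2 b2 g ->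
  bint a1 b1 a2 b2 (fun y => u * f y + v * g y) = u * bint a1 b1 a2 b2 f + v * bint a1 b1 a2 b2 g.
Proof.
move=> f1 g1 f2 g2; rewrite /bint !IntD ?IntZ//; try exact: intgZ; ring.
Qed.

Lemma dens_cont h y : {for y, continuous (rho h)}.
Proof. by have := @w_cont y => cw; rewrite /dens; cont. Qed.

(** Adding the factors with their global signs gives a polynomial [k] whose density is the average
    of the two densities on the bands; mass, equality and strict inequality are then averages
    too. *)
Lemma two_cut_convex h V g W (u : R) : two_cut h V -> two_cut g W -> 0 <= u <= 1 ->
  exists k, two_cut k ((1 - u) *: V + u *: W).
Proof.
move=> H G /andP[u0 u1]; have h1 := tc_lt1 H; have h2 := tc_lt2 H; have h3 := tc_lt3 H.
have [s Hs] := opposite_sign H; have [t Ht] := opposite_sign G.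
pose k := ((1 - u) * s) *: h + (u * t) *: g.
have v0 : 0 <= 1 - u by rewrite subr_ge0.
have absk y : bands y -> `|k.[y]| = (1 - u) * `|h.[y]| + u * `|g.[y]|.
  have [s1' s2'] := Hs y; have [t1 t2] := Ht y.
  rewrite /k hornerD !hornerZ; move=> /orP[] yi.
    have e1 := s1' yi; have e2 := t1 yi.
    rewrite [X in `|X|](_ : _ = - ((1 - u) * `|h.[y]| + u * `|g.[y]|)); last by rewrite e1 e2; ring.
    by rewrite normrN ger0_norm// addr_ge0// mulr_ge0.
  have e1 := s2' yi; have e2 := t2 yi.
  rewrite [X in `|X|](_ : _ = (1 - u) * `|h.[y]| + u * `|g.[y]|); last by rewrite e1 e2; ring.
  by rewrite ger0_norm// addr_ge0// mulr_ge0.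
have b1in x : a1 <= x <= b1 -> bands x by rewrite bandsE => ->.
have b2in x : a2 <= x <= b2 -> bands x by rewrite bandsE => ->; rewrite orbT.
have dk y : bands y -> rho k y = (1 - u) * rho h y + u * rho g y.
  by move=> /absk e; rewrite /dens e; ring.
have ci q a b : intg a b (rho q) by apply: cts_intg => y _; exact: dens_cont.
have cl q a b x : intg a b (fun y => rho q y * ln `|x - y|).
  by apply: intg_bounded_ln => y _; exact: dens_cont.
have lk x : pot k x = (1 - u) * pot h x + u * pot g x.
  rewrite /lpot -bint_lin//; congr (_ + _); apply: eq_Int => y yi; rewrite dk; try ring.
    exact: b1in.
  exact: b2in.
have [l [EL1 EL2]] := tc_el H; have [l' [EG1 EG2]] := tc_el G.
exists k; split=> //.
- move=> y yS; rewrite -normr_eq0 absk// gt_eqF//.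
  have p1 : 0 < `|h.[y]| by rewrite normr_gt0 (tc_neq0 H).
  have p2 : 0 < `|g.[y]| by rewrite normr_gt0 (tc_neq0 G).
  have [uu|uu] := lerP u (1/2).
    by rewrite ltr_pwDl ?mulr_ge0 ?mulr_gt0//; lra.
  by rewrite ltr_wpDl ?mulr_ge0 ?mulr_gt0//; lra.
- transitivity ((1 - u) * bint a1 b1 a2 b2 (rho h) + u * bint a1 b1 a2 b2 (rho g)).
    rewrite -bint_lin//; congr (_ + _); apply: eq_Int => y yi; rewrite dk//.
      exact: b1in.
    exact: b2in.
  by rewrite (tc_mass H) (tc_mass G); ring.
exists ((1 - u) * l + u * l'); split=> x xS; rewrite lk hornerD !hornerZ.
  by rewrite -(EL1 x xS) -(EG1 x xS); ring.
have e1 := EL2 x xS; have e2 := EG2 x xS.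
rewrite (_ : 2 * _ - _ = (1 - u) * (2 * pot h x - V.[x]) + u * (2 * pot g x - W.[x])); last by ring.
have [uu|uu] := lerP u (1/2).
  by rewrite ltr_leD// ?ltr_pM2l ?ler_wpM2l ?(ltW e2)//; lra.
by rewrite ler_ltD// ?ltr_pM2l ?ler_wpM2l ?(ltW e1)//; lra.
Qed.

End Combination.

(** * Integrals of extended functions bounded below *)

Section BoundedBelow.
Context d (T : measurableType d) (R : realType) (nu : probability T R).
Implicit Types (f g : T -> \bar R) (k : R).
Local Open Scope ereal_scope.

Lemma integral_prob_cst k : \int[nu]_x (cst k%:E x) = k%:E.
Proof. by rewrite integral_cst// [X in _ * X](@probability_setT _ _ _ nu) mule1. Qed.

(** The integral of [f] may be infinite, but the negative part is bounded by [k], so it has finite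
    integral and can be moved across. *)
Lemma integral_shift f k : measurable_fun setT f -> (forall x, (- k)%:E <= f x) ->
  \int[nu]_x (f x + k%:E) = \int[nu]_x f x + k%:E.
Proof.
move=> mf fk.
(* For negative [k], shift by its absolute value first and compare the two nonnegative functions
   obtained. *)
wlog k0 : k fk / (0 <= k)%R => [H|].
  have fk' x : (- `|k|)%:E <= f x.
    by apply: le_trans (fk x); rewrite lee_fin lerN2 ler_norm.
  have e := H `|k|%R fk' (normr_ge0 _).
  have g0 x : 0 <= f x + k%:E by rewrite -leeBlDr// sub0e; exact: fk.
  have := @ge0_integralD _ _ _ nu setT measurableT (fun x => f x + k%:E) (cst (`|k| - k)%:E).
  move=> /(_ (fun x _ => g0 x) (emeasurable_funD mf (measurable_cst _))).
  have k1 : (0 <= `|k| - k)%R by rewrite subr_ge0 ler_norm.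
  move=> /(_ (fun x _ => ltac:(by rewrite lee_fin)) (measurable_cst _)).
  rewrite integral_prob_cst.
  under eq_integral do rewrite -addeA -EFinD subrKC.
  rewrite e => h.
  have : \int[nu]_x f x + `|k|%:E - (`|k| - k)%:E = \int[nu]_x (f x + k%:E) + (`|k| - k)%:E - (`|k| - k)%:E by rewrite h.
  rewrite -[X in X = _]addeA -EFinB addeK// => <-.
  by congr (_ + _%:E); ring.
have mp := measurable_funepos mf; have mn := measurable_funeneg mf.
have nk x : (f^\- x <= k%:E).
  by rewrite funenegE ge_max lee_fin k0 andbT leeNl; exact: fk.
have fin : \int[nu]_x f^\- x \is a fin_num.
  rewrite ge0_fin_numE ?integral_ge0//.
  apply: (@le_lt_trans _ _ (\int[nu]_x cst k%:E x)); last by rewrite integral_prob_cst ltry.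
  by apply: ge0_le_integral => //.
have g0 x : 0 <= f x + k%:E by rewrite -leeBlDr// sub0e; exact: fk.
have E1 : \int[nu]_x (f x + k%:E) + \int[nu]_x f^\- x = \int[nu]_x f^\+ x + k%:E.
  rewrite -(ge0_integralD _ measurableT)//; last exact: emeasurable_funD.
  rewrite -[X in _ + X]integral_prob_cst -(ge0_integralD _ measurableT)//.
  apply: eq_integral => x _ /=; rewrite addeAC; congr (_ + _).
  have fn : f^\- x \is a fin_num by rewrite ge0_fin_numE//; exact: le_lt_trans (nk x) (ltry _).
  by rewrite (_ : f x = f^\+ x - f^\- x) ?subeK// {1}(funeposneg f).
rewrite [\int[nu]_x f x]integralE addeAC -E1 addeK//.
Qed.

Lemma le_integral_bounded_below f g k : measurable_fun setT f -> measurable_fun setT g ->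
  (forall x, (- k)%:E <= f x) -> (forall x, f x <= g x) -> \int[nu]_x f x <= \int[nu]_x g x.
Proof.
move=> mf mg fk fg; have gk x := le_trans (fk x) (fg x).
rewrite -(@leeD2rE _ k%:E)// -!integral_shift//.
apply: ge0_le_integral => //.
- by move=> x _; rewrite -leeBlDr// sub0e; exact: fk.
- exact: emeasurable_funD.
- exact: emeasurable_funD.
by move=> x _; rewrite leeD2r.
Qed.

Lemma integralD_bounded_below f g k j : measurable_fun setT f -> measurable_fun setT g ->
  (forall x, (- k)%:E <= f x) -> (forall x, (- j)%:E <= g x) ->
  \int[nu]_x (f x + g x) = \int[nu]_x f x + \int[nu]_x g x.
Proof.
move=> mf mg fk gj.
have fgk x : (- (k + j))%:E <= f x + g x by rewrite opprD EFinD leeD.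
have f0 x : 0 <= f x + k%:E by rewrite -leeBlDr// sub0e; exact: fk.
have g0 x : 0 <= g x + j%:E by rewrite -leeBlDr// sub0e; exact: gj.
have := integral_shift (emeasurable_funD mf mg) fgk.
have -> : \int[nu]_x (f x + g x + (k + j)%:E) = (\int[nu]_x f x + k%:E) + (\int[nu]_x g x + j%:E).
  rewrite -!integral_shift// -(ge0_integralD _ measurableT)//; try exact: emeasurable_funD.
  by apply: eq_integral => x _; rewrite EFinD addeACA.
rewrite addeACA -EFinD => h.
by rewrite -[LHS](@addeK _ (k + j)%:E)// -h addeK.
Qed.

Lemma le_integral_pos (f : T -> \bar R) g : measurable_fun setT f -> measurable_fun setT g ->
  (forall x, 0 <= f x) -> {ae nu, forall x, g x <= f x} -> \int[nu]_x g x <= \int[nu]_x f x.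
Proof.
move=> mf mg f0 [N [mN N0 sN]].
apply: (@le_trans _ _ (\int[nu]_x g^\+ x)).
  rewrite [leLHS]integralE -[leRHS]adde0 leeD2l// oppe_le0; exact: integral_ge0.
apply: ae_ge0_le_integral => //; first exact: measurable_funepos.
exists N; split=> // x /= nx; apply: sN => /= gf; apply: nx => _.
by rewrite funeposE ge_max gf f0.
Qed.

Lemma le_integral_ge0 f g : measurable_fun setT f -> measurable_fun setT g ->
  (forall x, 0 <= f x) -> {ae nu, forall x, f x <= g x} -> \int[nu]_x f x <= \int[nu]_x g x.
Proof.
move=> mf mg f0 [N [mN N0 sN]].
have -> : \int[nu]_x g x = \int[nu]_x g^\+ x.
  apply: ae_eq_integral => //; first exact: measurable_funepos.
  exists N; split=> // x /= nx; apply: sN => /= fg; apply: nx => _.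
  by rewrite funeposE; apply/esym/max_idPl; exact: le_trans fg.
apply: ae_ge0_le_integral => //; first exact: measurable_funepos.
exists N; split=> // x /= nx; apply: sN => /= fg; apply: nx => _.
by rewrite funeposE le_max fg.
Qed.

End BoundedBelow.

Ltac mproj := repeat first [exact: measurable_fst | exact: measurable_snd | exact: measurable_id | exact: measurable_cst
  | apply: measurable_fun_pair
  | apply: (measurableT_comp measurable_fst) | apply: (measurableT_comp measurable_snd)].

(** * Positive definite kernels *)

Section PositiveDefinite.
Context d (P : measurableType d) (R : realType) (rho : {sigma_finite_measure set P -> \bar R}).
Variable phi : P * R -> \bar R.
Local Open Scope ereal_scope.
Hypotheses (phi0 : forall z, 0 <= phi z) (mphi : measurable_fun setT phi).
Implicit Types mu nu : probability R R.

Definition pdker (x y : R) : \bar R := \int[rho]_p (phi (p, x) * phi (p, y)).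
Definition feature mu (p : P) : \bar R := \int[mu]_x phi (p, x).

Lemma pdker_ge0 x y : 0 <= pdker x y.
Proof. by apply: integral_ge0 => p _; exact: mule_ge0. Qed.

Lemma measurable_pdker : measurable_fun setT (fun z : R * R => pdker z.1 z.2).
Proof.
apply: (@measurable_fun_fubini_tonelli_F _ _ _ _ _ rho (fun z : (R * R) * P => phi (z.2, z.1.1) * phi (z.2, z.1.2))).
  apply: emeasurable_funM; apply: measurableT_comp => //; mproj.
by move=> z; exact: mule_ge0.
Qed.

Lemma feature_ge0 mu p : 0 <= feature mu p.
Proof. exact: integral_ge0. Qed.

Lemma measurable_feature mu : measurable_fun setT (feature mu).
Proof.
apply: (@measurable_fun_fubini_tonelli_F _ _ _ _ _ mu (fun z : P * R => phi z)) => //.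
Qed.

(** By Tonelli the double integral of the kernel is an inner product of the two feature
    functions. *)
Lemma integral_pdker nu mu : \int[nu]_x \int[mu]_y pdker x y = \int[rho]_p (feature nu p * feature mu p).
Proof.
have m2 x : measurable_fun setT (fun p => phi (p, x)) by exact: measurableT_comp.
transitivity (\int[nu]_x \int[rho]_p (phi (p, x) * feature mu p)).
  apply: eq_integral => x _; rewrite /pdker.
  rewrite (@fubini_tonelli _ _ _ _ _ mu rho (fun z : R * P => phi (z.2, x) * phi (z.2, z.1))); last first.
  - by move=> z; exact: mule_ge0.
  - apply: emeasurable_funM; apply: measurableT_comp => //; mproj.
  apply: eq_integral => p _ /=; rewrite ge0_integralZl//.
  exact: measurableT_comp.
rewrite (@fubini_tonelli _ _ _ _ _ nu rho (fun z : R * P => phi (z.2, z.1) * feature mu z.2)); last first.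
- by move=> z; rewrite mule_ge0// feature_ge0.
- apply: emeasurable_funM; last by apply: measurableT_comp => //; exact: measurable_feature.
  by apply: measurableT_comp => //; mproj.
apply: eq_integral => p _ /=; rewrite ge0_integralZr// ?feature_ge0//.
exact: measurableT_comp.
Qed.

(** Pointwise 2 F G <= F^2 + G^2 for the features. The inequality is not written as a difference,
    since any of the integrals may be infinite. *)
Lemma pdker_positive_definite nu mu :
  2%:E * (\int[nu]_x \int[mu]_y pdker x y) <=
  \int[nu]_x \int[nu]_y pdker x y + \int[mu]_x \int[mu]_y pdker x y.
Proof.
have mf n m : measurable_fun setT (fun p => feature n p * feature m p).
  by apply: emeasurable_funM; exact: measurable_feature.
have f0 n m p : 0 <= feature n p * feature m p by rewrite mule_ge0// feature_ge0.
rewrite !integral_pdker -ge0_integralZl_EFin// -ge0_integralD//.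
apply: ge0_le_integral => //.
- by move=> p _; rewrite mule_ge0.
- exact: measurable_funeM.
- exact: emeasurable_funD.
move=> p _; move: (feature_ge0 nu p) (feature_ge0 mu p).
case: (feature nu p) => [a| |]; case: (feature mu p) => [b| |]//= a0 b0.
- rewrite -!EFinM -EFinD lee_fin; have := sqr_ge0 (a - b)%R; nra.
- by rewrite mulyy addey ?leey.
- by rewrite mulyy addye ?leey.
- by rewrite mulyy addye ?leey.
Qed.

End PositiveDefinite.

(** * The logarithmic kernel as a superposition of intervals *)

Section Plane.
Context {R : realType}.
Notation leb := (@lebesgue_measure R).

Definition plane := (leb \x leb)%E.
HB.instance Definition _ := Measure.copy plane (leb \x leb)%E.

Let plane_sigma_finite : sigma_finite setT plane.
Proof.
have /sigma_finiteP[F [TF ndF Foo]] := sigma_finiteT leb.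
exists (fun n => F n `*` F n).
  rewrite -setXTT TF predeqE => -[x y]; split=> [[/= [n _ Fnx] [k _ Fky]]|[n _ []/= ? ?]]; last by split; exists n.
  exists (maxn n k) => //; split.
    by move: x Fnx; exact/subsetPset/ndF/leq_maxl.
  by move: y Fky; exact/subsetPset/ndF/leq_maxr.
move=> k; have [mF Fk] := Foo k; split; first exact: measurableX.
by rewrite [X in (X < _)%E]product_measure1E// lte_mul_pinfty// ge0_fin_numE.
Qed.

HB.instance Definition _ := Measure_isSigmaFinite.Build _ _ _ plane plane_sigma_finite.
End Plane.

Section LogKernel.
Context {R : realType}.
Variable t : R.
Hypothesis t0 : 0 < t.
Implicit Types x y z s : R.
Notation leb := (@lebesgue_measure R).


(** Indicator of x in ]z, z + s[ with weight 1/s, for the parameter (z, s) with 0 < s < [t]. The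
    weight is written [expR (- ln s)], equal to 1/s for positive s, which makes measurability a
    composition. *)
Definition tent (p : (R * R) * R) : \bar R :=
  if [&& 0 < p.1.2, p.1.2 < t, p.1.1 < p.2 & p.2 < p.1.1 + p.1.2] then (expR (- ln p.1.2))%:E else 0%E.

Definition logtent : R -> R -> \bar R := pdker (@plane R) tent.

Lemma tent_ge0 p : (0 <= tent p)%E.
Proof. by rewrite /tent; case: ifP => // _; rewrite lee_fin expR_ge0. Qed.

Lemma measurable_tent : measurable_fun setT tent.
Proof.
have m1 : measurable_fun setT (fun p : (R * R) * R => p.1.2) by mproj.
have m2 : measurable_fun setT (fun p : (R * R) * R => p.1.1) by mproj.
have m3 : measurable_fun setT (fun p : (R * R) * R => p.2) by mproj.
apply: measurable_fun_ifT => //.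
  apply: measurable_and; first exact: measurable_fun_ltr.
  apply: measurable_and; first exact: measurable_fun_ltr.
  apply: measurable_and; first exact: measurable_fun_ltr.
  by apply: measurable_fun_ltr => //; exact: measurable_funD.
apply/measurable_EFinP; apply: measurableT_comp => //; apply: measurableT_comp => //.
by apply: measurableT_comp m1; exact: measurable_ln.
Qed.

Lemma logtentC x y : logtent x y = logtent y x.
Proof. by apply: eq_integral => p _; rewrite muleC. Qed.

(** Two points at distance d lie in a common interval ]z, z + s[ for a set of z of length s - d if s
    > d, and for no z otherwise. *)
Lemma logtent_itv x y : x < y ->
  logtent x y = (\int[leb]_(s in `](y - x)%R, t[) (expR (- ln s) ^+ 2 * (s - (y - x)))%:E)%E.
Proof.
move=> xy; rewrite /logtent /pdker /plane (fubini_tonelli2 (m1 := leb) (m2 := leb)) /=; last first.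
- by move=> p; rewrite mule_ge0// tent_ge0.
- by apply: emeasurable_funM; apply: measurableT_comp measurable_tent _; mproj.
rewrite [RHS]integral_mkcond; apply: eq_integral => s _ /=.
rewrite /fubini_G/= patchE mem_setE in_itv/=; case: ifPn => [/andP[ds st]|ns].
  have s0 : 0 < s by rewrite (lt_trans _ ds)// subr_gt0.
  have sx : y - s < x by rewrite ltrBlDr -ltrBlDl.
  transitivity (\int[leb]_z ((expR (- ln s) ^+ 2)%:E * (\1_(`](y - s)%R, x[%classic) z)%:E))%E.
    apply: eq_integral => z _; rewrite /tent/= s0 st/= indicE mem_setE in_itv/= ltrBlDr.
    case: (ltP z x) => zx; rewrite /= ?andbF ?mul0e ?mule0//.
    rewrite (lt_trans zx xy)/= andbT; case: (ltP y (z + s)) => yz; rewrite ?mule0//.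
    by rewrite (lt_trans xy yz) mule1 -EFinM expr2.
  rewrite ge0_integralZl_EFin//; last exact/measurable_EFinP.
  rewrite integral_indic// setIT [X in (_ * X)%E](_ : _ = (s - (y - x))%:E) -?EFinM//.
  by rewrite /= lebesgue_measure_itv/= lte_fin sx -EFinB; congr (_%:E); ring.
rewrite [RHS](_ : _ = 0%E)//; apply: integral0_eq => z _; rewrite /tent/=.
case: ifPn => [/and4P[s0 st zx xz]|_]; last by rewrite mul0e.
case: ifPn => [/and4P[_ _ zy yz]|_]; last by rewrite mule0.
by move: ns; rewrite st andbT -leNgt => sd; exfalso; lra.
Qed.

(** For d = |x - y| below the cutoff, integrating (s - d) / s^2 from d to t gives ln (t / d) - 1 + d
    / t exactly. Hence [logtent] is -ln d up to a constant and an error d / t. *)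
Lemma logtent_bounds x y : x != y ->
  ((- ln `|x - y| + ln t - 1)%:E <= logtent x y <= (- ln `|x - y| + ln t - 1 + `|x - y| / t)%:E)%E.
Proof.
wlog xy : x y / x < y => [H|_].
  by rewrite neq_lt => /orP[] h; [|rewrite logtentC distrC]; apply: H => //; rewrite lt_eqF.
rewrite logtent_itv// distrC gtr0_norm ?subr_gt0//; set d := y - x.
have d0 : 0 < d by rewrite subr_gt0.
(* Beyond the cutoff the kernel is 0 and the bounds reduce to ln t <= ln d and ln r <= r - 1. *)
have [td|dt] := leP t d.
  rewrite set_itv_ge ?integral_set0; last by rewrite bnd_simp -leNgt.
  have : ln t <= ln d by rewrite ler_ln.
  have : ln (d / t) <= d / t - 1 by have := expR_ge1Dx (ln (d / t)); rewrite lnK ?posrE ?divr_gt0//; lra.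
  rewrite ln_div ?posrE// => h1 h2; rewrite !lee_fin; apply/andP; split; lra.
have E : (\int[leb]_(s in `]d, t[) (expR (- ln s) ^+ 2 * (s - d))%:E)%E = (- ln d + ln t - 1 + d / t)%:E.
  have mE : measurable_fun setT (fun s => (expR (- ln s) ^+ 2 * (s - d))%:E).
    apply/measurable_EFinP; apply: measurable_funM; last by apply: measurable_funB.
    apply: measurable_funX; apply: measurableT_comp; first exact: measurable_expR. apply: measurableT_comp; first exact: oppr_measurable.
    exact: measurable_ln.
  rewrite integral_itv_obnd_cbnd; last exact: measurable_funTS.
  rewrite integral_itv_bndo_bndc; last exact: measurable_funTS.
  have sE s : d <= s <= t -> expR (- ln s) ^+ 2 * (s - d) = s^-1 - d * s^-1 ^+ 2.
    move=> /andP[ds _]; have s0 : 0 < s by exact: lt_le_trans ds.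
    by rewrite expRN lnK ?posrE//; field; rewrite gt_eqF.
  have cE : cts d t (fun s => s^-1 - d * s^-1 ^+ 2).
    move=> s /andP[ds _]; have s0 : s != 0 by rewrite gt_eqF// (lt_le_trans d0).
    by cont.
  transitivity (Int d t (fun s => expR (- ln s) ^+ 2 * (s - d)))%:E.
    by apply: intgE; apply: eq_intg (cts_intg cE) => s /sE ->.
  congr (_%:E); rewrite (eq_Int (g := fun s => s^-1 - d * s^-1 ^+ 2))//.
  have dF s : d <= s -> der s (fun s => ln s + d * s^-1) (s^-1 - d * s^-1 ^+ 2).
    move=> ds; have s0 : 0 < s by exact: lt_le_trans ds.
    have sn : s != 0 by rewrite gt_eqF.
    by apply: der_eq; [isd => //|rewrite /=; field].
  rewrite (@Int_FTC R _ _ _ (fun s => ln s + d * s^-1) (ltW dt) cE).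
  - by field; rewrite !gt_eqF.
  - by move=> s /andP[ds _]; exact: is_derive_cont (dF _ ds).
  - by move=> s /andP[ds _]; apply: dF; exact: ltW.
rewrite E !lee_fin lexx andbT lerDl divr_ge0// ltW//.
Qed.

End LogKernel.

(** * Measurability of the logarithmic kernels *)

Section Kernels.
Context {R : realType}.
Implicit Types (x y : R) (mu : probability R R).

Lemma measurable_lndist : measurable_fun setT (fun z : R * R => ln `|z.1 - z.2|).
Proof.
apply: (@measurableT_comp _ _ _ _ _ _ (@ln R) _ (fun z : R * R => `|z.1 - z.2|)).
  exact: measurable_ln.
by apply: measurableT_comp => //; apply: measurable_funB; mproj.
Qed.

Lemma measurable_logker : measurable_fun setT (fun z : R * R => logker z.1 z.2).
Proof.
apply: measurable_fun_ifT => //.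
  by apply: measurable_fun_eqr; mproj.
apply/measurable_EFinP; apply: measurableT_comp measurable_lndist.
exact: oppr_measurable.
Qed.

Lemma ae_neq mu x : mu [set x] = 0%E -> {ae mu, forall y, x != y}.
Proof.
by move=> m0; exists [set x]; split=> // y /= /negP; rewrite negbK => /eqP.
Qed.

Lemma logpotE mu x : mu [set x] = 0%E -> logpot mu x = (\int[mu]_y (ln `|x - y|)%:E)%E.
Proof.
move=> m0; have [N [mN N0 sN]] := ae_neq m0.
have m1 : measurable_fun setT (fun y => (ln `|x - y|)%:E : \bar R).
  apply/measurable_EFinP.
  by apply: (measurableT_comp measurable_lndist (g := fun y => (x, y))); mproj.
apply: ae_eq_integral => //.
  apply: measurable_fun_ifT => //.
  by apply: measurable_fun_eqr; mproj.
exists N; split=> // y /= ny; apply: sN => /= xy; apply: ny => _.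
by rewrite /logabs (negbTE xy).
Qed.

End Kernels.

(** * The Euler-Lagrange conditions imply minimality of the energy *)

Section Minimality.
Context {R : realType}.
Variables (mu : probability R R) (V : {poly R}) (Lp : R -> R) (l B M : R) (S : set R).
Hypotheses (M0 : 0 <= M) (mS : measurable S) (SB : forall x, S x -> `|x| <= B) (muS : mu (~` S) = 0%E)
  (mu0 : forall x, mu [set x] = 0%E)
  (pot : forall x, (\int[mu]_y (ln `|x - y|)%:E = (Lp x)%:E)%E)
  (EL_eq : forall x, S x -> 2 * Lp x - V.[x] = l)
  (EL_le : forall x, 2 * Lp x - V.[x] <= l)
  (V_ge : forall x : R, `|x| - M <= V.[x]).
Implicit Types (x y : R) (nu : probability R R).

Let aeS : {ae mu, forall x, S x}.
Proof. by exists (~` S); split=> //; exact: measurableC. Qed.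

Let mV : measurable_fun setT (fun x => V.[x]).
Proof.
by apply: continuous_measurable_fun => x; have : {for x, continuous (fun x => V.[x])} by cont.
Qed.

Let mlog x : measurable_fun setT (fun y => ln `|x - y|).
Proof. by apply: (measurableT_comp measurable_lndist (g := fun y => (x, y))); mproj. Qed.

Let ilog x : mu.-integrable setT (fun y => (ln `|x - y|)%:E).
Proof.
apply/integrableP; split; first exact/measurable_EFinP.
by rewrite integral_fin_num_abs// pot.
Qed.

Let iV : mu.-integrable setT (fun y => V.[y]%:E).
Proof.
apply/integrableP; split; first exact/measurable_EFinP.
have [K HK] : exists K : R, forall y, S y -> `|V.[y]| <= K.
  have [BN|BN] := leP (- B) B; last first.
    exists 0 => y /SB yB; have := le_trans (normr_ge0 y) yB; lra.
  have [|z _ Hz] := @EVT_max R (fun y => `|V.[y]|) (- B) B BN.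
    by apply: cts_within => y _; cont.
  by exists `|V.[z]| => y /SB yB; apply: Hz; rewrite in_itv/= -ler_norml.
have K0 : 0 <= Num.max K 0 by rewrite le_max lexx orbT.
apply: (@le_lt_trans _ _ (\int[mu]_x (cst (Num.max K 0)%:E x))%E); last first.
  by rewrite integral_prob_cst ltry.
apply: ae_ge0_le_integral => //.
- by apply: measurableT_comp => //; exact/measurable_EFinP.
have [N [mN N0 sN]] := aeS.
exists N; split=> // x /= nx; apply: sN => /= Sx; apply: nx => _.
by rewrite lee_fin le_max HK.
Qed.

Let v : R := fine (\int[mu]_x (V.[x])%:E)%E.

Let vE : (\int[mu]_x (V.[x])%:E = v%:E)%E.
Proof. by rewrite fineK// integrable_fin_num. Qed.

Let icst k : mu.-integrable setT (cst (k%:E : \bar R)).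
Proof. exact: finite_measure_integrable_cst. Qed.

Let int_pot x k : (\int[mu]_y (k - ln `|x - y|)%:E = (k - Lp x)%:E)%E.
Proof.
under eq_integral do rewrite EFinB.
rewrite integralB_EFin//=; [|exact: icst|exact: ilog].
by rewrite [X in (_ - X)%E]pot [X in (X - _)%E]integral_prob_cst.
Qed.

Let int_aff a b : (\int[mu]_y (a + b * V.[y])%:E = (a + b * v)%:E)%E.
Proof.
have ib : mu.-integrable setT (fun y => (b * V.[y])%:E).
  by under eq_fun do rewrite EFinM; exact: integrableZl.
under eq_integral do rewrite EFinD.
rewrite integralD_EFin//; [|exact: icst].
rewrite [X in (X + _)%E]integral_prob_cst.
under [X in (_ + X)%E]eq_integral do rewrite /= EFinM.
by rewrite integralZl// vE.
Qed.

Let W x y : \bar R := (logker x y + (V.[x] / 2)%:E + (V.[y] / 2)%:E)%E.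
(** Replacing the logarithm by [logtent] costs |x - y| / t, which the growth of [V] bounds by (V(x)
    + V(y) + 2 M) / t; [a] and [b] collect what remains of the potential and the constants. For t >=
    4 the coefficient [a t] is at least 1/4. *)
Let a t : R := 1 / 2 - t^-1.
Let b t : R := 2 * M / t + ln t - 1.

Let W_ge t x y : 4 <= t -> (logtent t x y + (a t * V.[y])%:E + (a t * V.[x] - b t)%:E <= W x y)%E.
Proof.
move=> t4; have t0 : 0 < t by lra.
rewrite /W /logker; case: eqVneq => [->|xy]; first by rewrite !addye// leey.
have /andP[_ h] := logtent_bounds t0 xy.
rewrite -!EFinD -addeA -EFinD.
apply: le_trans (leeD2r _ h) _; rewrite -EFinD lee_fin.
have d : `|x - y| / t <= (V.[x] + M + V.[y] + M) / t.
  rewrite ler_pM2r ?invr_gt0//; apply: le_trans (ler_normB _ _) _.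
  by have := V_ge x; have := V_ge y; lra.
rewrite /a /b; move: d; rewrite !mulrDl; lra.
Qed.

Let aV_ge t x : 4 <= t -> - M / 2 <= a t * V.[x].
Proof.
move=> t4.
have ti : 0 < t^-1 <= 4^-1 by rewrite invr_gt0 lef_pV2 ?posrE//; lra.
have m0 := M0; have := V_ge x; have := normr_ge0 x; rewrite /a; case/andP: ti; nra.
Qed.

Let mW : measurable_fun setT (fun z : R * R => W z.1 z.2).
Proof.
apply: emeasurable_funD; first apply: emeasurable_funD.
- exact: measurable_logker.
- apply/measurable_EFinP; apply: measurable_funM => //.
  by apply: (measurableT_comp mV); mproj.
- apply/measurable_EFinP; apply: measurable_funM => //.
  by apply: (measurableT_comp mV); mproj.
Qed.

Let mWx x : measurable_fun setT (W x).
Proof. by apply: (measurableT_comp mW (g := fun y => (x, y))); mproj. Qed.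

Let W_lb : exists k, forall x y, ((- k)%:E <= W x y)%E.
Proof.
exists (M + b 4) => x y; have h : 4 <= 4 :> R by [].
apply: le_trans (W_ge x y h).
rewrite -addeA -EFinD -[leLHS]add0e leeD ?pdker_ge0//; first exact: tent_ge0.
by rewrite lee_fin; have := aV_ge x h; have := aV_ge y h; lra.
Qed.

Let mWint nu : measurable_fun setT (fun x => (\int[nu]_y W x y)%E).
Proof.
have [k Wk] := W_lb.
have e x : (\int[nu]_y W x y = \int[nu]_y (W x y + k%:E) - k%:E)%E.
  by rewrite integral_shift// addeK.
under eq_fun do rewrite e.
apply: emeasurable_funD => //.
apply: (@measurable_fun_fubini_tonelli_F _ _ _ _ _ nu (fun z : R * R => W z.1 z.2 + k%:E)%E).
  exact: emeasurable_funD.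
by move=> z; rewrite -leeBlDr// sub0e.
Qed.

(** The inner integral is constant on the support by the Euler-Lagrange equality, and the measure
    lives there. *)
Lemma energy_equilibrium : energy V mu = ((v - l) / 2)%:E.
Proof.
have inner x : S x -> (\int[mu]_y W x y = ((v - l) / 2)%:E)%E.
  move=> Sx.
  transitivity (\int[mu]_y ((V.[x] / 2 + 1 / 2 * V.[y]) - ln `|x - y|)%:E)%E.
    apply: ae_eq_integral => //.
      apply/measurable_EFinP; apply: measurable_funB => //.
      by apply: measurable_funD => //; exact: measurable_funM.
    have [N [mN N0 sN]] := ae_neq (mu0 x).
    exists N; split=> // y /= ny; apply: sN => /= xy; apply: ny => _.
    by rewrite /W /logker (negbTE xy) -!EFinD; congr (_%:E); ring.
  under eq_integral do rewrite EFinB.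
  have iA : mu.-integrable setT (fun y => (V.[x] / 2 + 1 / 2 * V.[y])%:E).
    have i1 : mu.-integrable setT (fun y => (1 / 2 * V.[y])%:E).
      by under eq_fun do rewrite EFinM; exact: integrableZl.
    exact: (integrableD _ (icst (V.[x] / 2)) i1).
  rewrite integralB_EFin//=; last exact: ilog.
  rewrite [X in (_ - X)%E]pot [X in (X - _)%E]int_aff -EFinB; congr (_%:E).
  by have := EL_eq Sx; lra.
rewrite /energy -[RHS](integral_prob_cst mu); apply: ae_eq_integral => //.
  exact: mWint.
have [N [mN N0 sN]] := aeS.
exists N; split=> // x /= nx; apply: sN => /= Sx; apply: nx => _.
exact: inner.
Qed.

Let mF t nu : measurable_fun setT (fun x => (\int[nu]_y logtent t x y)%E).
Proof.
apply: (@measurable_fun_fubini_tonelli_F _ _ _ _ _ nu (fun z : R * R => logtent t z.1 z.2)).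
  by apply: measurable_pdker; [exact: tent_ge0|exact: measurable_tent].
by move=> z; apply: pdker_ge0; exact: tent_ge0.
Qed.

Let mFx t x : measurable_fun setT (logtent t x).
Proof.
have m := measurable_pdker (@plane R) (@tent_ge0 R t) (@measurable_tent R t).
by apply: (measurableT_comp m (g := fun y => (x, y))); mproj.
Qed.

Let F_ge0 t x y : (0 <= logtent t x y)%E.
Proof. by apply: pdker_ge0; exact: tent_ge0. Qed.

Let IF_ge0 t nu x : (0 <= \int[nu]_y logtent t x y)%E.
Proof. by apply: integral_ge0 => y _; exact: F_ge0. Qed.

Let F_lower t x : 0 < t -> ((ln t - 1 - Lp x)%:E <= \int[mu]_y logtent t x y)%E.
Proof.
move=> t0; rewrite -int_pot; apply: le_integral_pos => //.
  by apply/measurable_EFinP; exact: measurable_funB.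
have [N [mN N0 sN]] := ae_neq (mu0 x).
exists N; split=> // y /= ny; apply: sN => /= xy; apply: ny.
have /andP[h _] := logtent_bounds t0 xy; apply: le_trans h.
by rewrite lee_fin; lra.
Qed.

Let F_upper t x : 0 < t -> S x -> (\int[mu]_y logtent t x y <= (ln t - 1 + 2 * B / t - Lp x)%:E)%E.
Proof.
move=> t0 Sx; rewrite -int_pot; apply: le_integral_ge0 => //.
  by apply/measurable_EFinP; exact: measurable_funB.
apply: filterS2 aeS (ae_neq (mu0 x)) => y Sy xy.
have /andP[_ h] := logtent_bounds t0 xy; apply: le_trans h _.
have d : `|x - y| / t <= 2 * B / t.
  rewrite ler_pM2r ?invr_gt0//; apply: le_trans (ler_normB _ _) _.
  by have := SB Sx; have := SB Sy; lra.
by rewrite lee_fin; lra.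
Qed.

Let Y_upper t : 0 < t -> (\int[mu]_x \int[mu]_y logtent t x y <= (ln t - 1 + 2 * B / t - (v + l) / 2)%:E)%E.
Proof.
move=> t0; have := int_aff (ln t - 1 + 2 * B / t - l / 2) (- (1 / 2)).
rewrite [X in (_ = X%:E)%E](_ : _ = ln t - 1 + 2 * B / t - (v + l) / 2); last by field; rewrite gt_eqF.
move=> <-; apply: le_integral_ge0 => //.
  apply/measurable_EFinP; apply: measurable_funD => //; exact: measurable_funM.
apply: filterS aeS => x Sx; apply: le_trans (F_upper t0 Sx) _.
by rewrite lee_fin; have := EL_eq Sx; lra.
Qed.

Section Competitor.
Variable nu : probability R R.
Hypothesis nuV : nu.-integrable setT (fun y => V.[y]%:E).
Let w : R := fine (\int[nu]_x (V.[x])%:E)%E.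

Let int_aff' p q : (\int[nu]_y (p + q * V.[y])%:E = (p + q * w)%:E)%E.
Proof.
have ib : nu.-integrable setT (fun y => (q * V.[y])%:E).
  by under eq_fun do rewrite EFinM; exact: integrableZl.
under eq_integral do rewrite EFinD.
rewrite integralD_EFin//; [|exact: finite_measure_integrable_cst].
rewrite [X in (X + _)%E]integral_prob_cst.
under [X in (_ + X)%E]eq_integral do rewrite /= EFinM.
by rewrite integralZl// EFinD EFinM /w fineK// integrable_fin_num.
Qed.

Let Z_lower t : 0 < t -> ((ln t - 1 - (w + l) / 2)%:E <= \int[nu]_x \int[mu]_y logtent t x y)%E.
Proof.
move=> t0; have := int_aff' (ln t - 1 - l / 2) (- (1 / 2)).
rewrite [X in (_ = X%:E)%E](_ : _ = ln t - 1 - (w + l) / 2); last by field.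
move=> <-; apply: le_integral_pos => //.
  apply/measurable_EFinP; apply: measurable_funD => //; exact: measurable_funM.
apply: aeW => x; apply: le_trans (F_lower x t0).
by rewrite lee_fin; have := EL_le x; lra.
Qed.

(** Positive definiteness reads X >= 2 Z - Y for the interactions X of [nu] with itself, Z of [nu]
    with [mu], and Y of [mu] with itself. Z is bounded below by the inequality on the whole line, Y
    above by the equality on [S]. *)
Let X_lower t : 0 < t ->
  ((ln t - 1 - w - l / 2 + v / 2 - 2 * B / t)%:E <= \int[nu]_x \int[nu]_y logtent t x y)%E.
Proof.
move=> t0.
have := pdker_positive_definite (@plane R) (@tent_ge0 R t) (@measurable_tent R t) nu mu.
rewrite -/(logtent t) => h.
rewrite -(@leeD2rE _ (ln t - 1 + 2 * B / t - (v + l) / 2)%:E)//.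
apply: le_trans (leeD2l _ (Y_upper t0)); apply: le_trans h.
apply: (@le_trans _ _ (2%:E * (ln t - 1 - (w + l) / 2)%:E)%E); last by rewrite lee_wpmul2l// Z_lower.
rewrite -EFinM -EFinD lee_fin; lra.
Qed.

(** The terms ln t cancel, so the energy of [nu] is at least that of [mu] up to an error of order
    1/t. *)
Lemma energy_lower t : 4 <= t ->
  (((v - l) / 2 - 2 * (B + w + M) / t)%:E <= energy V nu)%E.
Proof.
move=> t4; have t0 : 0 < t by lra.
have aVm x : measurable_fun setT (fun y => (a t * V.[y])%:E : \bar R).
  by apply/measurable_EFinP; exact: measurable_funM.
apply: (@le_trans _ _ (\int[nu]_x (\int[nu]_y logtent t x y + (a t * w + (a t * V.[x] - b t))%:E))%E).
  have aVl x : ((- (M / 2 + `|a t * w - b t|))%:E <= (a t * w + (a t * V.[x] - b t))%:E)%E.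
    by rewrite lee_fin; have := aV_ge x t4; have := ler_norm (- (a t * w - b t)); rewrite normrN; lra.
  have mA : measurable_fun setT (fun x => (a t * w + (a t * V.[x] - b t))%:E).
    apply/measurable_EFinP; apply: measurable_funD => //; apply: measurable_funB => //; exact: measurable_funM.
  rewrite (@integralD_bounded_below _ _ _ nu _ _ 0 (M / 2 + `|a t * w - b t|))//; last first.
    by move=> x; rewrite oppr0.
  have -> : (\int[nu]_x (a t * w + (a t * V.[x] - b t))%:E = (2 * a t * w - b t)%:E)%E.
    transitivity (\int[nu]_x (a t * w - b t + a t * V.[x])%:E)%E.
      by apply: eq_integral => x _; congr (_%:E); ring.
    by rewrite int_aff'; congr (_%:E); ring.
  apply: le_trans (leeD2r _ (X_lower t0)).
  rewrite -EFinD lee_fin le_eqVlt; apply/orP; left; apply/eqP; rewrite /a /b.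
  by move: (ln t) w v => z1 z2 z3; field; rewrite gt_eqF.
apply: (@le_integral_bounded_below _ _ _ nu _ _ (M / 2 + `|a t * w - b t|)) => //.
- apply: emeasurable_funD => //; apply/measurable_EFinP; apply: measurable_funD => //.
  by apply: measurable_funB => //; exact: measurable_funM.
- exact: mWint.
- move=> x; rewrite -[leLHS]add0e leeD// lee_fin.
  by have := aV_ge x t4; have := ler_norm (- (a t * w - b t)); rewrite normrN; lra.
move=> x.
have -> : (a t * w + (a t * V.[x] - b t))%:E = ((0 + a t * w)%:E + (a t * V.[x] - b t)%:E)%E.
  by rewrite add0r EFinD.
rewrite -int_aff'.
have aV0 y : ((- (M / 2))%:E <= (0 + a t * V.[y])%:E)%E.
  by rewrite lee_fin add0r; have := aV_ge y t4; lra.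
have F0 y : ((- 0)%:E <= logtent t x y)%E by rewrite oppr0.
have maV : measurable_fun setT (fun y => (0 + a t * V.[y])%:E : \bar R).
  by under eq_fun do rewrite add0r; exact: aVm.
rewrite addeA -(@integralD_bounded_below _ _ _ nu _ _ 0 (M / 2))//.
pose k := M / 2 + `|a t * V.[x] - b t|.
have lb y : ((- k)%:E <= logtent t x y + (0 + a t * V.[y])%:E)%E.
  rewrite -[leLHS]add0e leeD// lee_fin /k.
  by have := aV_ge y t4; have := normr_ge0 (a t * V.[x] - b t); lra.
rewrite -[X in (_ + X <= _)%E](integral_prob_cst nu) -(@integralD_bounded_below _ _ _ nu _ _ k `|a t * V.[x] - b t|)//.
- apply: (@le_integral_bounded_below _ _ _ nu _ _ (k + `|a t * V.[x] - b t|)) => //.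
  + by apply: emeasurable_funD => //; exact: emeasurable_funD.
  + exact: mWx.
  + by move=> y; rewrite opprD EFinD leeD//= lee_fin lerNl ler_normr lexx orbT.
  by move=> y /=; rewrite add0r; exact: W_ge.
- exact: emeasurable_funD.
by move=> y; rewrite lee_fin lerNl ler_normr lexx orbT.
Qed.

End Competitor.

(** The kernel dominates a positive multiple of V(y) plus a constant depending on x, so every inner
    integral is already infinite. *)
Lemma energy_infinite nu : (\int[nu]_x (V.[x])%:E = +oo)%E -> energy V nu = +oo%E.
Proof.
move=> Voo; have h : 4 <= 4 :> R by [].
have aE : a 4 = 1 / 4 by rewrite /a; lra.
have aVm : measurable_fun setT (fun y => (a 4 * V.[y])%:E : \bar R).
  by apply/measurable_EFinP; exact: measurable_funM.
have inner x : (\int[nu]_y W x y = +oo)%E.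
  pose c := a 4 * V.[x] - b 4.
  have aV1 y : ((- (M / 2))%:E <= (a 4 * V.[y])%:E)%E by rewrite lee_fin -mulNr aV_ge.
  have lb y : ((- (M / 2 + `|c|))%:E <= (a 4 * V.[y])%:E + cst c%:E y)%E.
    by rewrite opprD EFinD leeD//= lee_fin lerNl ler_normr lexx orbT.
  have VM : (\int[nu]_y (a 4 * V.[y])%:E = +oo)%E.
    have VB y : ((- M)%:E <= (V.[y])%:E)%E by rewrite lee_fin; have := V_ge y; have := normr_ge0 y; lra.
    have m1 : measurable_fun setT (fun y => (V.[y])%:E : \bar R) by exact/measurable_EFinP.
    have m2 : measurable_fun setT (fun y => (V.[y])%:E + M%:E : \bar R)%E by exact: emeasurable_funD.
    have : (\int[nu]_y ((a 4)%:E * ((V.[y])%:E + M%:E)) = +oo)%E.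
      rewrite ge0_integralZl_EFin//; last 2 first.
      - by move=> y _; rewrite -leeBlDr// sub0e.
      - by rewrite aE; lra.
      by rewrite integral_shift// Voo addye// gt0_muley// lte_fin aE; lra.
    have -> : (\int[nu]_y ((a 4)%:E * ((V.[y])%:E + M%:E)) = \int[nu]_y ((a 4 * V.[y])%:E + cst (a 4 * M)%:E y))%E.
      by apply: eq_integral => y _ /=; rewrite -!EFinD -EFinM mulrDr.
    rewrite (@integralD_bounded_below _ _ _ nu _ _ (M / 2) `|a 4 * M|)//; last first.
      by move=> y; rewrite lee_fin lerNl ler_normr lexx orbT.
    by rewrite integral_prob_cst; case: (\int[nu]_y _)%E.
  apply/eqP; rewrite -leye_eq.
  have : (\int[nu]_y ((a 4 * V.[y])%:E + cst c%:E y) = +oo)%E.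
    rewrite (@integralD_bounded_below _ _ _ nu _ _ (M / 2) `|c|)//; last first.
      by move=> y; rewrite lee_fin lerNl ler_normr lexx orbT.
    by rewrite integral_prob_cst VM addye.
  move=> <-; apply: (@le_integral_bounded_below _ _ _ nu _ _ (M / 2 + `|c|)) => //.
    by apply: emeasurable_funD => //; exact: measurable_cst.
  move=> y; apply: le_trans (W_ge x y h); rewrite -addeA -[leLHS]add0e leeD//.
rewrite /energy; under eq_integral do rewrite inner.
by rewrite integral_cst// [X in (_ * X)%E](@probability_setT _ _ _ nu) mule1.
Qed.

Lemma equilibrium : is_equilibrium V mu.
Proof.
move=> nu; rewrite energy_equilibrium.
have m1 : measurable_fun setT (fun y => (V.[y])%:E : \bar R) by exact/measurable_EFinP.
have VB y : ((- M)%:E <= (V.[y])%:E)%E by rewrite lee_fin; have := V_ge y; have := normr_ge0 y; have m0 := M0; lra.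
have : ((- M)%:E <= \int[nu]_x (V.[x])%:E)%E.
  by rewrite -(integral_prob_cst nu); exact: (@le_integral_bounded_below _ _ _ nu _ _ M).
case E : (\int[nu]_x (V.[x])%:E)%E => [w| |]// _; last by rewrite energy_infinite ?leey.
have nuV : nu.-integrable setT (fun y => (V.[y])%:E).
  by apply/integrableP; split=> //; rewrite integral_fin_num_abs// E.
have H t t4 := @energy_lower nu nuV t t4; rewrite E /= in H.
case: (energy V nu) H => [e| |] H; [|by rewrite leey|by have := H 4 (lexx _)].
rewrite lee_fin leNgt; apply/negP => lt; pose d := (v - l) / 2 - e.
have d0 : 0 < d by rewrite subr_gt0.
pose K := `|2 * (B + w + M)|.
have K0 : 0 <= K by exact: normr_ge0.
(* Large enough that [K / t] < [d], contradicting an energy lower by [d]. *)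
pose t := 4 + 2 * K / d.
have t4 : 4 <= t by rewrite lerDl; apply: divr_ge0; [exact: mulr_ge0|exact: ltW].
have := H t t4; rewrite lee_fin leNgt => /negP; apply.
have t0 : 0 < t by lra.
suff : 2 * (B + w + M) / t < d by rewrite /d; lra.
rewrite ltr_pdivrMr//; apply: le_lt_trans (ler_norm _) _; rewrite -/K /t mulrDr.
rewrite mulrCA divff ?mulr1 ?gt_eqF//; nra.
Qed.

End Minimality.

(** * Measures given by a density *)

Section Density.
Context {R : realType}.
Notation leb := (@lebesgue_measure R).
Variables (mu : {measure set (measurableTypeR R) -> \bar R}) (q : R -> R).
Hypotheses (mq : measurable_fun setT q) (q0 : forall x, 0 <= q x)
  (muE : forall A, measurable A -> mu A = (\int[leb]_(x in A) (q x)%:E)%E).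
Local Open Scope ereal_scope.

Import HBNNSimple.

Let mqE : measurable_fun setT (EFin \o q). Proof. exact/measurable_EFinP. Qed.

Let integral_density_nnsfun (f : {nnsfun (measurableTypeR R) >-> R}) :
  \int[mu]_x (f x)%:E = \int[leb]_x ((f x)%:E * (q x)%:E).
Proof.
under [LHS]eq_integral do rewrite fimfunE -fsumEFin//.
rewrite [LHS]ge0_integral_fsum//; last 2 first.
- by move=> r; exact/measurable_EFinP/measurableT_comp.
- by move=> n x _; rewrite EFinM nnfun_muleindic_ge0.
under [RHS]eq_integral.
  move=> x xD; rewrite fimfunE -fsumEFin// muleC ge0_mule_fsumr; last first.
    by move=> r; rewrite EFinM nnfun_muleindic_ge0.
  over.
rewrite [RHS]ge0_integral_fsum//; last 2 first.
- move=> r; apply: emeasurable_funM => //; apply/measurable_EFinP; exact: measurable_funM.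
- by move=> n x _; apply: mule_ge0; [rewrite lee_fin|rewrite EFinM nnfun_muleindic_ge0].
apply: eq_fsbigr => r _; rewrite integralZl_indic_nnsfun//= integral_indic// setIT.
rewrite muE// integral_mkcond; have [r0|r0] := leP 0%R r.
  rewrite -ge0_integralZl_EFin//.
  - apply: eq_integral => x _; rewrite patchE indicE; case: ifPn => _.
      by rewrite mulr1 muleC.
    by rewrite mulr0 !mule0.
  - by move=> x _; apply: erestrict_ge0 => y _; rewrite lee_fin.
  - by apply/(measurable_restrictT _ _).1 => //; exact: measurable_funTS.
rewrite preimage_nnfun0//= [in LHS]integral0_eq ?mule0; last by move=> x _; rewrite patch_set0.
by rewrite integral0_eq// => x _; rewrite indic0 mulr0 mule0.
Qed.

Lemma ge0_integral_density (f : measurableTypeR R -> \bar R) : measurable_fun setT f -> (forall x, 0 <= f x) ->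
  \int[mu]_x f x = \int[leb]_x (f x * (q x)%:E).
Proof.
move=> mf f0; pose g := nnsfun_approx measurableT mf.
transitivity (lim (\int[mu]_x (g n x)%:E @[n --> \oo])).
  rewrite -monotone_convergence//=.
  - apply: eq_integral => ? /[!inE] xD; apply/esym/cvg_lim => //=.
    exact: cvg_nnsfun_approx.
  - by move=> n; exact/measurable_EFinP/measurable_funTS.
  - by move=> n ? _; rewrite lee_fin.
  - by move=> ? _ ? ? mn; rewrite lee_fin; exact/lefP/nd_nnsfun_approx.
transitivity (lim (\int[leb]_x ((g n x)%:E * (q x)%:E) @[n --> \oo])).
  by apply: congr_lim; apply/funext => n /=; exact: integral_density_nnsfun.
rewrite -monotone_convergence//=.
- apply: eq_integral => x /[!inE] xD; apply/cvg_lim => //.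
  under eq_fun do rewrite muleC; rewrite muleC; apply: cvgeZl => //.
  exact: cvg_nnsfun_approx.
- by move=> n; apply: emeasurable_funM => //; apply/measurable_EFinP/measurable_funTS.
- by move=> n x _; rewrite mule_ge0// lee_fin.
- by move=> x _ m n mn; apply: lee_wpmul2r; rewrite lee_fin//; exact/lefP/nd_nnsfun_approx.
Qed.

End Density.

Section RealDensity.
Context {R : realType}.
Notation leb := (@lebesgue_measure R).
Variables (mu : {measure set R -> \bar R}) (q : R -> R).
Hypotheses (mq : measurable_fun setT q) (q0 : forall x, 0 <= q x)
  (muE : forall A : set R, measurable A -> mu A = (\int[leb]_(x in A) (q x)%:E)%E).
Local Open Scope ereal_scope.

Let ge0_integral_densityR (f : R -> \bar R) : measurable_fun setT f -> (forall x, 0 <= f x) ->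
  \int[mu]_x f x = \int[leb]_x (f x * (q x)%:E).
Proof.
move=> mf f0.
(* [R] and [measurableTypeR R] are the same measurable space under two names; the pushforward by the
   identity carries the result from one to the other. *)
have mid : measurable_fun setT (idfun : R -> measurableTypeR R) by move=> _ A mA; rewrite setTI.
transitivity (\int[pushforward mu (idfun : R -> measurableTypeR R)]_x f x).
  apply/esym; have := @ge0_integral_pushforward _ _ R (measurableTypeR R) R _ mid mu setT f measurableT mf.
  by apply=> x _; exact: f0.
exact: (@ge0_integral_density R (pushforward mu (idfun : R -> measurableTypeR R)) q mq q0).
Qed.

Lemma integral_density (f : R -> \bar R) : measurable_fun setT f ->
  \int[mu]_x f x = \int[leb]_x (f x * (q x)%:E).
Proof.
move=> mf; rewrite integralE [RHS]integralE; congr (_ - _).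
  rewrite ge0_integral_densityR//; last exact: measurable_funepos.
  apply: eq_integral => x _; have q1 : 0 <= (q x)%:E by rewrite lee_fin. by rewrite !funeposE maxe_pMl// mul0e.
rewrite ge0_integral_densityR//; last exact: measurable_funeneg.
apply: eq_integral => x _; have q1 : 0 <= (q x)%:E by rewrite lee_fin. by rewrite !funenegE maxe_pMl// mul0e mulNe.
Qed.

End RealDensity.

Section DensityProbability.
Context {R : realType}.
Notation leb := (@lebesgue_measure R).
Local Open Scope ereal_scope.

(** The proofs are arguments so that the measure and probability structures can be attached to this
    constant. *)
Definition density_prob (q : R -> R) (mq : measurable_fun setT q) (q0 : forall x, (0 <= q x)%R)
    (q1 : \int[leb]_x (q x)%:E = 1) : set R -> \bar R :=
  fun A => \int[leb]_(x in A) (q x)%:E.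

Variables (q : R -> R) (mq : measurable_fun setT q) (q0 : forall x, (0 <= q x)%R)
  (q1 : \int[leb]_x (q x)%:E = 1).
Local Notation dp := (density_prob mq q0 q1).

Let dp0 : dp set0 = 0. Proof. exact: integral_set0. Qed.

Let dp_ge0 A : 0 <= dp A.
Proof. by apply: integral_ge0 => x _; rewrite lee_fin. Qed.

Let dp_sigma_additive : semi_sigma_additive dp.
Proof.
move=> /= F mF tF mUF; rewrite /density_prob; apply: cvg_toP.
  apply: ereal_nondecreasing_is_cvgn => m n mn.
  apply: lee_sum_nneg_natr => // k _ _.
  by apply: integral_ge0 => /= x Fkx; rewrite lee_fin.
rewrite ge0_integral_bigcup//=.
- by apply: measurable_funTS; exact: measurableT_comp.
- by move=> x _; rewrite lee_fin.
Qed.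

HB.instance Definition _ := isMeasure.Build _ R R dp dp0 dp_ge0 dp_sigma_additive.

HB.instance Definition _ := @Measure_isProbability.Build _ R R dp q1.

End DensityProbability.

(** * Measures supported on the two bands *)

Section BandMeasure.
Context {R : realType}.
Notation leb := (@lebesgue_measure R).
Variables (a1 b1 a2 b2 : R) (h : {poly R}).
Hypotheses (h1 : a1 < b1) (h2 : b1 < a2) (h3 : a2 < b2).
Local Notation S := [set x : R | bands a1 b1 a2 b2 x].
Local Notation p := (dens a1 b1 a2 b2 h).

Definition bdens x : R := if bands a1 b1 a2 b2 x then p x else 0.

Lemma bands_setE : S = `[a1, b1]%classic `|` `[a2, b2]%classic.
Proof.
apply/seteqP; split=> x /=; rewrite !in_itv /bands /=; first by case/orP => ?; [left|right].
by case=> ?; apply/orP; [left|right].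
Qed.

Lemma measurable_bands : measurable S.
Proof. by rewrite bands_setE; apply: measurableU. Qed.

Lemma dens_ge0 x : 0 <= p x.
Proof. by rewrite /dens /weight mulr_ge0 ?sqrtr_ge0. Qed.

Lemma bdens_ge0 x : 0 <= bdens x.
Proof. by rewrite /bdens; case: ifP => // _; exact: dens_ge0. Qed.

Lemma measurable_dens : measurable_fun setT p.
Proof. by apply: continuous_measurable_fun => x; exact: (@dens_cont R a1 b1 a2 b2 h x). Qed.

Lemma mem_bands x : (x \in S) = bands a1 b1 a2 b2 x.
Proof. by apply/idP/idP => [/set_mem|/mem_set]. Qed.

Lemma bdensE x : (EFin \o p) \_ S x = (bdens x)%:E.
Proof. by rewrite patchE mem_bands /bdens; case: ifP. Qed.

Lemma measurable_bdens : measurable_fun setT bdens.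
Proof.
apply/measurable_EFinP; have -> : EFin \o bdens = (EFin \o p) \_ S by apply/funext => x; rewrite bdensE.
apply/(measurable_restrictT _ _).1; first exact: measurable_bands.
by apply: measurable_funTS; apply/measurable_EFinP; exact: measurable_dens.
Qed.

Lemma integral_bdens A : measurable A ->
  (\int[leb]_(x in A) (bdens x)%:E = \int[leb]_(x in A `&` S) (p x)%:E)%E.
Proof. by move=> mA; rewrite integral_mkcondr; apply: eq_integral => x _; rewrite -bdensE. Qed.

Lemma integral_bands (f : R -> R) : measurable_fun setT f ->
  intg a1 b1 (fun y => p y * f y) -> intg a2 b2 (fun y => p y * f y) ->
  (\int[leb]_x ((f x)%:E * (bdens x)%:E) = (bint a1 b1 a2 b2 (fun y => (p y * f y)%R))%:E)%E.
Proof.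
move=> mf i1 i2.
transitivity (\int[leb]_(x in S) (p x * f x)%:E)%E.
  rewrite [RHS]integral_mkcond; apply: eq_integral => x _.
  rewrite patchE mem_bands /bdens; case: ifP => _; first by rewrite -EFinM mulrC.
  by rewrite mule0.
rewrite bands_setE integral_setU//.
- by rewrite !intgE.
- apply/measurable_funTS/measurable_EFinP; apply: measurable_funM => //; exact: measurable_dens.
apply/disj_setPS => x [] /=; rewrite !in_itv/= => /andP[_ xb] /andP[ax _]; have H2 := h2; lra.
Qed.

Variable mu : probability R R.
Hypothesis muE : forall A : set R, measurable A -> mu A = (\int[leb]_(x in A `&` S) (p x)%:E)%E.

Lemma band_measure_integral (f : R -> R) : measurable_fun setT f ->
  intg a1 b1 (fun y => p y * f y) -> intg a2 b2 (fun y => p y * f y) ->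
  (\int[mu]_x (f x)%:E = (bint a1 b1 a2 b2 (fun y => (p y * f y)%R))%:E)%E.
Proof.
move=> mf i1 i2; rewrite -integral_bands//.
have E A : measurable A -> mu A = (\int[leb]_(x in A) (bdens x)%:E)%E by move=> mA; rewrite muE// integral_bdens.
have mfE : measurable_fun setT (EFin \o f) by exact/measurable_EFinP.
have := @integral_density R mu bdens measurable_bdens bdens_ge0 E (EFin \o f) mfE.
exact.
Qed.

Lemma band_measure_set1 x : mu [set x] = 0%E.
Proof. by rewrite muE// -integral_bdens// integral_set1. Qed.

Lemma band_measureC : mu (~` S) = 0%E.
Proof. by rewrite muE ?setICl ?integral_set0//; apply: measurableC; exact: measurable_bands. Qed.

Lemma band_measure_mass : bint a1 b1 a2 b2 p = 1.
Proof.
have i a b : intg a b p by apply: cts_intg => y _; exact: dens_cont.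
have := @band_measure_integral (cst 1) (measurable_cst _).
have E a b : intg a b (fun y => p y * cst 1 y) by apply: eq_intg (i a b) => y _; rewrite mulr1.
move=> /(_ (E _ _) (E _ _)); rewrite [X in X = _ -> _](integral_prob_cst mu) => -[->].
by rewrite /bint; congr (_ + _); apply: eq_Int => y _; rewrite mulr1.
Qed.

Lemma band_measure_ln x : (\int[mu]_y (ln `|x - y|)%:E)%E = (lpot a1 b1 a2 b2 h x)%:E.
Proof.
rewrite band_measure_integral//.
- by apply: (measurableT_comp measurable_lndist (g := fun y => (x, y))); mproj.
- by apply: intg_bounded_ln => y _; exact: dens_cont.
- by apply: intg_bounded_ln => y _; exact: dens_cont.
Qed.

Lemma band_measure_logpot x : logpot mu x = (lpot a1 b1 a2 b2 h x)%:E.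
Proof. by rewrite logpotE ?band_measure_ln// band_measure_set1. Qed.

End BandMeasure.

(** * Passage between [k_cut_regular 2] and [two_cut] *)

Section KCut.
Context {R : realType}.
Notation leb := (@lebesgue_measure R).
Implicit Types (V h : {poly R}).

Lemma prod_ord2 (a b : 'I_2 -> R) x :
  \prod_(j < 2) ((x - a j) * (x - b j)) = (x - a ord0) * (x - b ord0) * ((x - a ord_max) * (x - b ord_max)).
Proof. by rewrite big_ord_recl big_ord1; congr (_ * ((_ - a _) * (_ - b _))); exact/val_inj. Qed.

Lemma bigcup_ord2 (F : 'I_2 -> set R) : \bigcup_(j in [set: 'I_2]) F j = F ord0 `|` F ord_max.
Proof.
apply/seteqP; split=> x; last by case=> ?; [exists ord0|exists ord_max].
case=> -[[|[|//]] i2] _ /= Fx; [left|right]; rewrite (_ : ord0 = Ordinal i2) || rewrite (_ : ord_max = Ordinal i2) => //; exact/val_inj.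
Qed.

Lemma two_cut_of_measure (a1 b1 a2 b2 c l : R) h V (mu : probability R R) :
  a1 < b1 -> b1 < a2 -> a2 < b2 -> 0 < c ->
  (forall x, bands a1 b1 a2 b2 x -> h.[x] != 0) ->
  (forall A : set R, measurable A ->
     mu A = (\int[leb]_(x in A `&` [set x | bands a1 b1 a2 b2 x]) (c^-1 * weight a1 b1 a2 b2 x * `|h.[x]|)%:E)%E) ->
  (forall x, bands a1 b1 a2 b2 x -> (2%:E * logpot mu x - (V.[x])%:E = l%:E)%E) ->
  (forall x, ~ bands a1 b1 a2 b2 x -> (2%:E * logpot mu x - (V.[x])%:E < l%:E)%E) ->
  two_cut a1 b1 a2 b2 (c^-1 *: h) V.
Proof.
move=> h1 h2 h3 c0 hn muE EL1 EL2.
have muE' (A : set R) : measurable A -> mu A = (\int[leb]_(x in A `&` [set x | bands a1 b1 a2 b2 x])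
    (dens a1 b1 a2 b2 (c^-1 *: h) x)%:E)%E.
  move=> mA; rewrite muE//; apply: eq_integral => x _; congr (_%:E).
  by rewrite /dens hornerZ normrM gtr0_norm ?invr_gt0//; ring.
have lp x := band_measure_logpot h2 muE' x.
split=> //.
- by move=> y /hn hy; rewrite hornerZ mulf_neq0// invr_eq0 gt_eqF.
- exact: (band_measure_mass h2 muE').
exists l; split=> x xS.
  by have := EL1 x xS; rewrite lp -EFinM -EFinB => -[].
by have := EL2 x (negP xS); rewrite lp -EFinM -EFinB lte_fin.
Qed.

(** The intervals indexed by 'I_2 come in no particular order, so the two possible orders are
    treated by the same argument [key]. *)
Lemma two_cut_of_k_cut V : k_cut_regular 2 V -> exists a1 b1 a2 b2 h, two_cut a1 b1 a2 b2 h V.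
Proof.
move=> [mu [_ [a [b [c [h [l [[ab dis _ c0 hn] [muE EL1 EL2]]]]]]]]].
set S := \bigcup_(j in _) _ in hn muE EL1 EL2.
have key (i j : 'I_2) : b i < a j -> S = `[a i, b i]%classic `|` `[a j, b j]%classic ->
    (forall x, \prod_(j < 2) ((x - a j) * (x - b j)) = (x - a i) * (x - b i) * ((x - a j) * (x - b j))) ->
    two_cut (a i) (b i) (a j) (b j) (c^-1 *: h) V.
  move=> ij SE pE; have SE' : S = [set x | bands (a i) (b i) (a j) (b j) x] by rewrite bands_setE.
  rewrite SE' in hn muE EL1 EL2.
  apply: (two_cut_of_measure (mu := mu) (l := l)) => // A mA.
  rewrite muE//; apply: eq_integral => x _; congr ((_ * Num.sqrt `|_| * _)%:E).
  by rewrite pE quartE; ring.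
have [lt|lt] := dis ord0 ord_max isT.
  exists (a ord0), (b ord0), (a ord_max), (b ord_max), (c^-1 *: h); apply: key => //.
    exact: bigcup_ord2.
  by move=> x; exact: prod_ord2.
exists (a ord_max), (b ord_max), (a ord0), (b ord0), (c^-1 *: h); apply: key => //.
  by rewrite setUC; exact: bigcup_ord2.
by move=> x; rewrite prod_ord2 mulrC.
Qed.


Lemma integral_bdens1 a1 b1 a2 b2 h V : two_cut a1 b1 a2 b2 h V ->
  (\int[leb]_x (bdens a1 b1 a2 b2 h x)%:E = 1)%E.
Proof.
move=> H; have i a b : intg a b (fun y => dens a1 b1 a2 b2 h y * cst 1 y).
  by apply: (@eq_intg _ _ _ (dens a1 b1 a2 b2 h)) => [y _|]; [rewrite mulr1|apply: cts_intg => y _; exact: dens_cont].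
have := integral_bands (tc_lt2 H) (measurable_cst (1 : R)) (i a1 b1) (i a2 b2).
under eq_integral do rewrite mul1e.
move=> ->; congr (_%:E); rewrite -[RHS](tc_mass H).
by rewrite /bint; congr (_ + _); apply: eq_Int => y _; rewrite /= mulr1.
Qed.

Lemma band_measure_msupp a1 b1 a2 b2 h V (mu : probability R R) : two_cut a1 b1 a2 b2 h V ->
  (forall A : set R, measurable A ->
     mu A = (\int[leb]_(x in A `&` [set x | bands a1 b1 a2 b2 x]) (dens a1 b1 a2 b2 h x)%:E)%E) ->
  msupp mu = [set x | bands a1 b1 a2 b2 x].
Proof.
move=> H muE; have h1 := tc_lt1 H; have h2 := tc_lt2 H; have h3 := tc_lt3 H.
have pos (x u v : R) e : u < v -> u <= x <= v -> 0 < e ->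
    (forall y, u <= y <= v -> bands a1 b1 a2 b2 y) ->
    (forall y, u < y < v -> (a1 < y < b1) || (a2 < y < b2)) -> (0 < mu (ball x e))%E.
  move=> uv /andP[ux xv] e0 inB inO.
  (* The part of the band within e / 2 of [x] is a nondegenerate segment, even when [x] is an
     endpoint. *)
  pose u' := Num.max u (x - e / 2); pose v' := Num.min v (x + e / 2).
  have uv' : u' < v' by rewrite lt_min !gt_max uv /=; apply/andP; split; [lra|apply/andP; split; lra].
  have sub : `[u', v'] `<=` ball x e.
    move=> y /=; rewrite in_itv/= ge_max le_min => /andP[/andP[_ y1] /andP[_ y2]].
    by rewrite /ball/= ltr_distlC; lra.
  have mi : measurable (`[u', v']%classic : set R) by [].
  have mb : measurable (ball x e : set R) by exact: measurable_ball.
  suff lt0 : (0 < mu `[u', v']%classic)%E by exact: lt_le_trans lt0 (le_measure mu (mem_set mi) (mem_set mb) sub).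
  rewrite muE// (_ : `[u', v'] `&` _ = `[u', v']%classic); last first.
    apply/setIidPl => y /=; rewrite in_itv/= ge_max le_min => /andP[/andP[y1 _] /andP[y2 _]].
    by apply: inB; rewrite y1 y2.
  have cp : cts u' v' (dens a1 b1 a2 b2 h) by move=> y _; exact: dens_cont.
  have := intgE (cts_intg cp); rewrite /= => ->; rewrite lte_fin; apply: Int_gt0 => // y /andP[].
  rewrite gt_max lt_min => /andP[y1 _] /andP[y2 _].
  have yO := inO y; rewrite y1 y2 in yO; have {}yO := yO isT.
  apply: mulr_gt0; last by rewrite normr_gt0 (tc_neq0 H)// inB// !ltW.
  by rewrite sqrtr_gt0 normr_gt0 ltr0_neq0//; apply: quart_lt0.
apply/seteqP; split=> x /=; last first.
  move=> /orP[] xi e e0.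
    apply: (pos x a1 b1) => // y yi; first by rewrite /bands /band1 yi.
    by rewrite yi.
  apply: (pos x a2 b2) => // y yi; first by rewrite /bands /band2 yi orbT.
  by rewrite yi orbT.
move=> xs; apply/negPn/negP => nx.
have cS : closed [set x : R | bands a1 b1 a2 b2 x].
  by rewrite bands_setE; apply: closedU; exact: interval_closed.
have : nbhs x (~` [set x : R | bands a1 b1 a2 b2 x]).
  by apply: open_nbhs_nbhs; split; [exact: closed_openC|exact/negP].
move=> /nbhs_ballP[e /= e0 se]; have := xs e e0.
rewrite muE; last exact: measurable_ball.
by rewrite (_ : _ `&` _ = set0) ?integral_set0 ?ltxx//; apply/disjoints_subset.
Qed.

(** The measure is built from the density; the linear growth of [V] is what the minimality argument
    requires, and the normalising constant is taken to be 1. *)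
Lemma k_cut_of_two_cut a1 b1 a2 b2 h V (M : R) : 0 <= M -> (forall x : R, `|x| - M <= V.[x]) ->
  two_cut a1 b1 a2 b2 h V -> k_cut_regular 2 V.
Proof.
move=> M0 VM H; have h1 := tc_lt1 H; have h2 := tc_lt2 H; have h3 := tc_lt3 H.
pose mu : probability R R := density_prob (measurable_bdens a1 b1 a2 b2 h) (bdens_ge0 a1 b1 a2 b2 h) (integral_bdens1 H).
have muE (A : set R) : measurable A ->
    mu A = (\int[leb]_(x in A `&` [set x | bands a1 b1 a2 b2 x]) (dens a1 b1 a2 b2 h x)%:E)%E.
  by move=> mA; rewrite -integral_bdens.
have [l [EL1 EL2]] := tc_el H.
have lp x := band_measure_logpot h2 muE x.
have EL x : 2 * lpot a1 b1 a2 b2 h x - V.[x] <= l.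
  by have [xS|xS] := boolP (bands a1 b1 a2 b2 x); [rewrite EL1|exact: ltW (EL2 _ xS)].
have SB x : bands a1 b1 a2 b2 x -> `|x| <= `|a1| + `|b2|.
  have := ler_norm (- a1); have := ler_norm b2; have := normr_ge0 a1; have := normr_ge0 b2; rewrite normrN.
  by move=> ? ? ? ? /orP[] /andP[? ?]; rewrite ler_norml; apply/andP; split; lra.
exists mu; split.
  apply: (@equilibrium R mu V (lpot a1 b1 a2 b2 h) l (`|a1| + `|b2|) M [set x | bands a1 b1 a2 b2 x]) => //.
  - exact: measurable_bands.
  - exact: band_measureC muE.
  - exact: band_measure_set1 muE.
  - exact: band_measure_ln muE.
exists (fun i => if i == ord0 then a1 else a2), (fun i => if i == ord0 then b1 else b2), 1, h, l.
have -> : \bigcup_(j in [set: 'I_2]) `[if j == ord0 then a1 else a2, if j == ord0 then b1 else b2]%classic =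
    [set x | bands a1 b1 a2 b2 x] by rewrite bigcup_ord2 bands_setE.
split; split=> //.
- by move=> j; case: ifP.
- move=> i j ij; case: eqP => [i0|/eqP i0]; case: eqP => [j0|/eqP j0]; [|by left|by right|].
    by rewrite i0 j0 eqxx in ij.
  by case: i j ij i0 j0 => -[|[|//]] ? [] [|[|//]] ?.
- exact: (band_measure_msupp H muE).
- by move=> x xS; exact: (tc_neq0 H xS).
- move=> A mA; rewrite muE//; apply: eq_integral => x _; congr (_%:E).
  by rewrite prod_ord2 /= invr1 mul1r /dens /weight quartE !mulrA.
- by move=> x xS; rewrite lp -EFinM -EFinB EL1.
- by move=> x /negP xS; rewrite lp -EFinM -EFinB lte_fin EL2.
Qed.

End KCut.

(** * The class P_m and its coefficient vectors *)

Section Potentials.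
Context {R : realType}.
Implicit Types (p q V : {poly R}) (m : nat).

Lemma eventually_ge p : (2 < size p)%N -> 0 < lead_coef p -> exists n : R, forall x, n <= x -> x <= p.[x].
Proof.
move=> sp lp; have sX : (size (- 'X : {poly R}) < size p)%N by rewrite size_polyN size_polyX.
have [|n Hn] := @poly_pinfty_gt_lc R (p - 'X); first by rewrite lead_coefDl.
exists n => x /Hn; rewrite lead_coefDl// hornerD hornerN hornerX => h.
by rewrite -subr_ge0 (le_trans _ h)// ltW.
Qed.

Lemma in_P_size m V : in_P m V -> (2 < size V)%N.
Proof.
case=> ev _ lV V0; case sV : (size V) ev => [|[|[|k]]]// _.
  by move/eqP: sV; rewrite size_poly_eq0 => /eqP sV; move: lV; rewrite sV lead_coef0 ltxx.
have := size1_polyC (eq_leq sV) => VC; move: lV V0; rewrite VC lead_coefC hornerC => lt E.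
by rewrite E ltxx in lt.
Qed.

(** The degree is even and, because of V(0) = 0 and the positive leading coefficient, at least 2. So
    V(x) and V(-x) both exceed x for large x, and compactness covers the rest. *)
Lemma in_P_growth m V : in_P m V -> exists2 M : R, 0 <= M & forall x : R, `|x| - M <= V.[x].
Proof.
move=> VP; have s2 := in_P_size VP; have [ev _ lV V0] := VP.
have [n Hn] := eventually_ge s2 lV.
pose W := V \Po (- 'X).
have sW : size W = size V by rewrite size_comp_poly2// size_polyN size_polyX.
have lW : lead_coef W = lead_coef V.
  rewrite lead_coef_comp ?size_polyN ?size_polyX// lead_coefN lead_coefX -signr_odd (negbTE ev) expr0 mulr1//.
have [n' Hn'] : exists n : R, forall x, n <= x -> x <= W.[x] by apply: eventually_ge; rewrite ?sW ?lW.
pose N := Num.max (Num.max n n') 0.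
have N0 : 0 <= N by rewrite le_max lexx orbT.
have NN : - N <= N by lra.
have [|z _ Hz] := @EVT_min R (fun y => V.[y] - `|y|) (- N) N NN.
  by apply: cts_within => y _; cont.
exists `|V.[z] - `|z| |; first exact: normr_ge0.
move=> x; have a0 := normr_ge0 (V.[z] - `|z|); have a1 := ler_norm (- (V.[z] - `|z|)); rewrite normrN in a1.
have [xN|Nx] := leP `|x| N.
  have := Hz x; rewrite in_itv/= -ler_norml xN => /(_ isT) h; lra.
have [x0|x0] := leP 0 x.
  rewrite ger0_norm// in Nx *.
  have : x <= V.[x] by apply: Hn; apply: le_trans (ltW Nx); rewrite !le_max lexx.
  lra.
rewrite ltr0_norm// in Nx *.
have : - x <= W.[- x] by apply: Hn'; apply: le_trans (ltW Nx); rewrite !le_max lexx orbT.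
rewrite /W horner_comp hornerN hornerX opprK; lra.
Qed.

Lemma in_PZ m (c : R) V : 0 < c -> in_P m V -> in_P m (c *: V).
Proof.
move=> c0 [ev sV lV V0]; split; rewrite ?size_scale ?gt_eqF//; first by rewrite lead_coefZ mulr_gt0.
by rewrite hornerZ V0 mulr0.
Qed.

Lemma in_PD m V W : in_P m V -> in_P m W -> in_P m (V + W).
Proof.
wlog : V W / (size W <= size V)%N => [H VP WP|].
  by have [/H|/ltnW/H] := leqP (size W) (size V); [apply|rewrite addrC; apply].
rewrite leq_eqVlt => /orP[/eqP sE|lt] [ev sV lV V0] [_ sW lW W0].
  have lc : (V + W)`_(size V).-1 = lead_coef V + lead_coef W by rewrite coefD /lead_coef sE.
  have pos : 0 < (V + W)`_(size V).-1 by rewrite lc addr_gt0.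
  have sVW : size (V + W) = size V.
    apply/eqP; rewrite eqn_leq (leq_trans (size_polyD _ _)) ?sE ?maxnn//=.
    have V1 : (0 < size V)%N by rewrite lt0n size_poly_eq0 -lead_coef_eq0 gt_eqF.
    rewrite -(prednK V1) ltnNge; apply/negP => /leq_sizeP/(_ _ (leqnn _)) E.
    by rewrite E ltxx in pos.
  by split; rewrite ?sVW// ?/lead_coef ?sVW// hornerD V0 W0 addr0.
by split; rewrite ?size_polyDl ?lead_coefDl// hornerD V0 W0 addr0.
Qed.

Lemma in_P_convex m V W (u : R) : 0 <= u <= 1 -> in_P m V -> in_P m W -> in_P m ((1 - u) *: V + u *: W).
Proof.
move=> /andP[]; rewrite le_eqVlt => /predU1P[<- _ VP _|u0]; first by rewrite subr0 scale1r scale0r addr0.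
rewrite le_eqVlt => /predU1P[-> _ WP|u1 VP WP]; first by rewrite subrr scale1r scale0r add0r.
by apply: in_PD; apply: in_PZ => //; rewrite subr_gt0.
Qed.

Definition quartic (v1 v2 v3 v4 : R) : {poly R} := v4 *: 'X^4 + v3 *: 'X^3 + v2 *: 'X^2 + v1 *: 'X.

Lemma in_P_quartic m v1 v2 v3 v4 : (4 <= m)%N -> 0 < v4 -> in_P m (quartic v1 v2 v3 v4).
Proof.
move=> m4 v0.
have s4 : size (v4 *: 'X^4 : {poly R}) = 5 by rewrite size_scale ?gt_eqF// size_polyXn.
have s3 : (size (v3 *: 'X^3 + v2 *: 'X^2 + v1 *: 'X : {poly R})%R < 5)%N.
  rewrite -(_ : \poly_(i < 4) [:: 0; v1; v2; v3]`_i = v3 *: 'X^3 + v2 *: 'X^2 + v1 *: 'X).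
    by rewrite ltnS size_poly.
  rewrite poly_def !big_ord_recl big_ord0 /= scale0r add0r addr0 expr1.
  by rewrite addrC [v2 *: _ + _]addrC.
rewrite /quartic -!addrA (addrA (v3 *: _)).
split.
- by rewrite size_polyDl s4.
- by rewrite size_polyDl s4.
- by rewrite lead_coefDl ?s4// lead_coefZ lead_coefXn mulr1.
- by rewrite !hornerD !hornerZ !hornerXn hornerX !expr0n/= !mulr0 !addr0.
Qed.

(** Coefficients relative to the base point x^4 - 4 x^2, hence the shifts by 4 and -1; entries
    beyond the fourth are 0, the default of [nth]. *)
Definition tvec m (v1 v2 v3 v4 : R) : 'rV[R]_m := \row_(j < m) [:: v1; v2 + 4; v3; v4 - 1]`_j.

Lemma Vt_tvec m v1 v2 v3 v4 : (4 <= m)%N -> Vt (tvec m v1 v2 v3 v4) = quartic v1 v2 v3 v4.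
Proof.
case: m => [|[|[|[|m]]]]// _; rewrite /Vt !big_ord_recl big1; last first.
  by move=> j _; rewrite mxE /= nth_nil scale0r.
rewrite !mxE /= /quartic addr0 expr1 !scalerDl scaleNr scale1r -!mul_polyC polyC1 /bump /= !add1n; ring.
Qed.

Lemma Vt_convex m (t s : 'rV[R]_m) (u : R) : Vt ((1 - u) *: t + u *: s) = (1 - u) *: Vt t + u *: Vt s.
Proof.
rewrite /Vt !scalerDr !scaler_sumr.
have -> : \sum_(j < m) ((1 - u) *: t + u *: s) ord0 j *: 'X^(j.+1) =
   \sum_(j < m) (1 - u) *: (t ord0 j *: 'X^(j.+1)) + \sum_(j < m) u *: (s ord0 j *: 'X^(j.+1)) :> {poly R}.
  rewrite -big_split; apply: eq_bigr => j _; by rewrite /= !mxE [LHS]scalerDl !scalerA.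
set p := \sum_(_ < _) _; set q := \sum_(_ < _) _.
rewrite -!mul_polyC polyCB polyC1; ring.
Qed.

Lemma cvg_rV (m : nat) (g : R -> 'rV[R]_m) (x : R) :
  (forall j, {for x, continuous (fun y => g y ord0 j)}) -> {for x, continuous g}.
Proof.
move=> cg A [P HP HA].
have H : \forall y \near x, forall j : 'I_m, P ord0 j (g y ord0 j).
  near=> y; near: y; apply: filter_forall => j.
  by apply: cg; exact: HP.
by apply: filterS H => y Hy; apply: HA => i j; rewrite (ord1 i).
Unshelve. all: by end_near. Qed.

End Potentials.

(** * Integrals over the gap *)

Section OddIntegral.
Context {R : realType}.

(** For a primitive E of an odd function, E(x) - E(-x) has zero derivative; the primitive starts at
    -2r so that r and -r are interior. *)
Lemma Int_odd (r : R) (f : R -> R) : 0 < r -> (forall x, {for x, continuous f}) ->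
  (forall x, f (- x) = - f x) -> Int (- r) r f = 0.
Proof.
move=> r0 cf fN; pose E x := Int (- (2 * r)) x f.
have dE x : - (2 * r) < x < 2 * r -> der x E (f x).
  by move=> xi; apply: (Int_FTC1 xi) => y _; exact: cf.
have dD x : - (2 * r) < x < 2 * r -> der x (fun x => E x - E (- x)) 0.
  move=> xi; have xi' : - (2 * r) < - x < 2 * r by case/andP: xi => ? ?; apply/andP; split; lra.
  have d2 : der x (fun x => E (- x)) (f x).
    have dN : der x (fun x : R => - x) (-1) by apply: der_eq; [isd|].
    apply: der_eq (@isdcomp R x E (fun x : R => - x) _ _ (dE _ xi') dN) _.
    by rewrite fN; ring.
  by apply: der_eq; [isd => //; exact: dE|rewrite /= subrr].
have e := @derive0_const R _ _ _ dD r 0.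
have {}e : E r - E (- r) = 0.
  by rewrite e ?oppr0 ?subrr//; apply/andP; split; lra.
have i a b : intg a b f by apply: cts_intg => y _; exact: cf.
have := @Int_split R (- (2 * r)) (- r) r f _ _ (i _ _); rewrite -/(E r) -/(E (- r)) => h.
by have := h ltac:(lra) ltac:(lra); move: e => /eqP; rewrite subr_eq0 => /eqP ->; lra.
Qed.

End OddIntegral.

Section GapIntegral.
Context {R : realType}.

(** The k-th gap integral rescaled to [0, 1], so that the domain stays fixed when the endpoints move
    and continuity under the integral sign applies. *)
Definition gapn k (a1 b1 a2 b2 : R) : R := Int 0 1 (fun v =>
  (b1 + (a2 - b1) * v) ^+ k * Num.sqrt (quart (sym1 a1 b1 a2 b2) (sym2 a1 b1 a2 b2) (sym3 a1 b1 a2 b2)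
    (sym4 a1 b1 a2 b2) (b1 + (a2 - b1) * v))).

Lemma gapnE k a1 b1 a2 b2 : b1 < a2 ->
  Int b1 a2 (fun x => x ^+ k * Num.sqrt (quart (sym1 a1 b1 a2 b2) (sym2 a1 b1 a2 b2) (sym3 a1 b1 a2 b2)
    (sym4 a1 b1 a2 b2) x)) = (a2 - b1) * gapn k a1 b1 a2 b2.
Proof.
move=> ba; set Q := quart _ _ _ _.
have cQ x : {for x, continuous Q} by exact: quart_cont.
have sb : 0 < a2 - b1 by rewrite subr_gt0.
have cF x : {for x, continuous (fun v : R => b1 + (a2 - b1) * v)} by cont.
have H1 : cts 0 1 (fun v : R => b1 + (a2 - b1) * v) by move=> x _; exact: cF.
have H2 : cts 0 1 (fun _ : R => a2 - b1) by move=> x _; cont.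
have H3 x : 0 < x < 1 -> der x (fun v : R => b1 + (a2 - b1) * v) (a2 - b1).
  by move=> _; apply: der_eq; [isd|rewrite /=; ring].
have H4 a b : cts a b (fun x => x ^+ k * Num.sqrt (Q x)).
  by move=> x _; have := @cQ x => c1; cont.
have := Int_subst ltr01 H1 H2 H3 (fun _ _ => sb) (H4 _ _).
rewrite mulr0 addr0 mulr1 subrKC => ->.
rewrite /gapn -/Q -IntZ; last first.
  apply: cts_intg => x _; have c1 := @cF x.
  have c2 : {for x, continuous (fun v => Q (b1 + (a2 - b1) * v))}.
    exact: (@contcomp R x Q (fun v => b1 + (a2 - b1) * v)).
  by cont.
by apply: eq_Int => x _; rewrite mulrC.
Qed.

Lemma gapc_ratio a1 b1 a2 b2 : a1 < b1 -> b1 < a2 -> a2 < b2 ->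
  0 < gapn 0 a1 b1 a2 b2 /\ gapc a1 b1 a2 b2 = gapn 1 a1 b1 a2 b2 / gapn 0 a1 b1 a2 b2.
Proof.
move=> h1 h2 h3; have sb : 0 < a2 - b1 by rewrite subr_gt0.
have e1 := gapnE 1 a1 b2 h2; have e0 := gapnE 0 a1 b2 h2.
have g0 := gap_int_gt0 h1 h2 h3.
have {}e0 : Int b1 a2 (fun x => Num.sqrt (quart (sym1 a1 b1 a2 b2) (sym2 a1 b1 a2 b2) (sym3 a1 b1 a2 b2)
    (sym4 a1 b1 a2 b2) x)) = (a2 - b1) * gapn 0 a1 b1 a2 b2.
  by rewrite -e0; apply: eq_Int => x _; rewrite expr0 mul1r.
have p0 : 0 < gapn 0 a1 b1 a2 b2 by move: g0; rewrite e0 pmulr_rgt0.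
split=> //; rewrite /gapc e0.
have -> : Int b1 a2 (fun x => x * Num.sqrt (quart (sym1 a1 b1 a2 b2) (sym2 a1 b1 a2 b2) (sym3 a1 b1 a2 b2)
    (sym4 a1 b1 a2 b2) x)) = (a2 - b1) * gapn 1 a1 b1 a2 b2.
  by rewrite -e1; apply: eq_Int => x _; rewrite expr1.
by move: (gapn 1 _ _ _ _) (gapn 0 _ _ _ _) p0 => x y y0; field; rewrite !gt_eqF.
Qed.

End GapIntegral.

(** * The path of quartics with moving endpoints *)

Section Path.
Context {R : realType}.

Lemma gapn_bound k (L a1 b1 a2 b2 v : R) : `|a1| <= L -> `|b1| <= L -> `|a2| <= L -> `|b2| <= L -> 0 <= v <= 1 ->
  `|(b1 + (a2 - b1) * v) ^+ k * Num.sqrt (quart (sym1 a1 b1 a2 b2) (sym2 a1 b1 a2 b2) (sym3 a1 b1 a2 b2)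
    (sym4 a1 b1 a2 b2) (b1 + (a2 - b1) * v))| <= L ^+ k * (2 * L) ^+ 2.
Proof.
move=> La1 Lb1 La2 Lb2 /andP[v0 v1]; set x := b1 + _.
have L0 : 0 <= L by exact: le_trans (normr_ge0 _) La1.
have xL : `|x| <= L.
  have -> : x = (1 - v) * b1 + v * a2 by rewrite /x; ring.
  apply: le_trans (ler_normD _ _) _; rewrite !normrM (ger0_norm v0) ger0_norm ?subr_ge0//.
  have -> : L = (1 - v) * L + v * L by ring.
  by apply: lerD; apply: ler_wpM2l => //; rewrite subr_ge0.
have d y : `|y| <= L -> `|x - y| <= 2 * L.
  by move=> yL; apply: le_trans (ler_normB _ _) _; lra.
rewrite normrM normrX; apply: ler_pM; rewrite ?exprn_ge0//.
  by apply: lerXn2r; rewrite ?nnegrE.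
rewrite ger0_norm ?sqrtr_ge0//.
have L2 : 0 <= 2 * L by rewrite mulr_ge0.
rewrite -[leRHS]ger0_norm ?exprn_ge0// -sqrtr_sqr ler_wsqrtr//.
apply: le_trans (ler_norm _) _; rewrite quartE !normrM.
have -> : ((2 * L) ^+ 2) ^+ 2 = 2 * L * (2 * L) * (2 * L) * (2 * L) by ring.
by do 3! (apply: ler_pM; rewrite ?mulr_ge0 ?d//).
Qed.

Variables a1 b1 a2 b2 : R.
Hypotheses (h1 : a1 < b1) (h2 : b1 < a2) (h3 : a2 < b2).
Local Notation r3 := (Num.sqrt 3 : R).

Definition pa1 u : R := (1 - u) * - r3 + u * a1.
Definition pb1 u : R := (1 - u) * -1 + u * b1.
Definition pa2 u : R := (1 - u) * 1 + u * a2.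
Definition pb2 u : R := (1 - u) * r3 + u * b2.

Let r31 : 1 < r3.
Proof. by rewrite -[X in X < _]sqrtr1 ltr_sqrt// ltr1n. Qed.

Lemma path_order u : 0 <= u <= 1 -> [/\ pa1 u < pb1 u, pb1 u < pa2 u & pa2 u < pb2 u].
Proof.
have r := r31; have l1 := h1; have l2 := h2; have l3 := h3.
have conv (x y x' y' : R) : x < y -> x' < y' -> 0 <= u <= 1 -> (1 - u) * x + u * x' < (1 - u) * y + u * y'.
  move=> xy xy' /andP[u0 u1]; have [uu|uu] := lerP u (1/2).
    by rewrite ltr_leD ?ltr_pM2l ?ler_wpM2l//; lra.
  by rewrite ler_ltD ?ltr_pM2l ?ler_wpM2l//; lra.
by move=> ui; split; apply: conv => //; lra.
Qed.

(** The parameter ranges over ]-1, 2[, a neighbourhood of [0, 1], where the endpoints may lose their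
    order; the integrand is still continuous and bounded there. *)
Lemma gapn_path_cont k u : 0 <= u <= 1 ->
  {for u, continuous (fun u => gapn k (pa1 u) (pb1 u) (pa2 u) (pb2 u))}.
Proof.
move=> /andP[u0 u1].
pose L := 2 * (r3 + 1 + `|a1| + `|b1| + `|a2| + `|b2|).
have r := r31.
have bound (p q x : R) : -1 < x < 2 -> `|p| <= r3 -> `|q| <= `|a1| + `|b1| + `|a2| + `|b2| ->
    `|(1 - x) * p + x * q| <= L.
  move=> /andP[x1 x2] hp hq; apply: le_trans (ler_normD _ _) _; rewrite !normrM.
  have k1 : `|1 - x| <= 2 by rewrite ler_norml; apply/andP; split; lra.
  have k2 : `|x| <= 2 by rewrite ler_norml; apply/andP; split; lra.
  have m1 : `|1 - x| * `|p| <= 2 * r3 by apply: ler_pM.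
  have m2 : `|x| * `|q| <= 2 * (`|a1| + `|b1| + `|a2| + `|b2|) by apply: ler_pM.
  by rewrite /L; lra.
have n1 := normr_ge0 a1; have n2 := normr_ge0 b1; have n3 := normr_ge0 a2; have n4 := normr_ge0 b2.
have nr : `|r3| = r3 by rewrite ger0_norm// sqrtr_ge0.
apply: (@Int_continuous R 0 1 (-1) 2 u (L ^+ k * (2 * L) ^+ 2)).
- by apply/andP; split; lra.
- by move=> x _ y _; rewrite /quart; cont.
- by move=> x y _ _; rewrite /quart /sym1 /sym2 /sym3 /sym4 /pa1 /pb1 /pa2 /pb2; cont.
move=> x y xi yi; apply: gapn_bound => //; apply: bound => //; rewrite ?normrN ?nr ?normr1; lra.
Qed.

(** Equal to [gapc] by [gapc_ratio], the length of the gap cancelling; in this form continuity in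
    [u] is visible. *)
Definition pc u : R := gapn 1 (pa1 u) (pb1 u) (pa2 u) (pb2 u) / gapn 0 (pa1 u) (pb1 u) (pa2 u) (pb2 u).
Definition pmass u : R := qmass (pa1 u) (pb1 u) (pa2 u) (pb2 u) (pc u).
Definition pv4 u : R := (2 * pmass u)^-1.
Definition pv3 u : R := - (2 / 3 * (pc u + sym1 (pa1 u) (pb1 u) (pa2 u) (pb2 u) / 2) / pmass u).
Definition pv2 u : R := qlin (pa1 u) (pb1 u) (pa2 u) (pb2 u) (pc u) / pmass u.
Definition pv1 u : R := 2 * qcst (pa1 u) (pb1 u) (pa2 u) (pb2 u) (pc u) / pmass u.

Lemma path_two_cut u : 0 <= u <= 1 -> 0 < pmass u /\
  two_cut (pa1 u) (pb1 u) (pa2 u) (pb2 u) (qh (pa1 u) (pb1 u) (pa2 u) (pb2 u)) (quartic (pv1 u) (pv2 u) (pv3 u) (pv4 u)).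
Proof.
move=> ui; have [l1 l2 l3] := path_order ui; have [_ cE] := gapc_ratio l1 l2 l3.
have := quartic_two_cut l1 l2 l3; have := qmass_gt0 l1 l2 l3; rewrite /qpotential cE -/(pc u) -/(pmass u) => ? ?.
by split=> //; rewrite /quartic /pv3 scaleNr.
Qed.

Lemma path_cont u : 0 <= u <= 1 ->
  [/\ {for u, continuous pv1}, {for u, continuous pv2}, {for u, continuous pv3} & {for u, continuous pv4}].
Proof.
move=> ui; have [l1 l2 l3] := path_order ui; have [g0 _] := gapc_ratio l1 l2 l3.
have [m0 _] := path_two_cut ui; have mn := lt0r_neq0 m0; have gn := lt0r_neq0 g0.
have cg0 := @gapn_path_cont 0 u ui; have cg1 := @gapn_path_cont 1 u ui.
have cc : {for u, continuous pc} by rewrite /pc; cont.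
have ca1 : {for u, continuous pa1} by rewrite /pa1; cont.
have cb1 : {for u, continuous pb1} by rewrite /pb1; cont.
have ca2 : {for u, continuous pa2} by rewrite /pa2; cont.
have cb2 : {for u, continuous pb2} by rewrite /pb2; cont.
have cm : {for u, continuous pmass}.
  by rewrite /pmass /qmass /mu5 /mu4 /qf4 /qf3 /qf2 /qf1 /sym1 /sym2 /sym3 /sym4; cont.
split.
- by rewrite /pv1 /qcst /mu5 /mu4 /qf4 /qf3 /qf2 /qf1 /sym1 /sym2 /sym3 /sym4; cont.
- by rewrite /pv2 /qlin /mu5 /mu4 /qf4 /qf3 /qf2 /qf1 /sym1 /sym2 /sym3 /sym4; cont.
- by rewrite /pv3 /sym1; cont.
by rewrite /pv4; cont; rewrite mulf_neq0.
Qed.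

(** The initial bands are symmetric, so [gapc] is 0 by oddness, and all coefficients follow from the
    symmetric functions 0, -4, 0, 3. *)
Lemma path_start : [/\ pv1 0 = 0, pv2 0 = -4, pv3 0 = 0 & pv4 0 = 1].
Proof.
have r := r31.
have rr : r3 ^+ 2 = 3 by rewrite sqr_sqrtr.
have [e1 e2 e3 e4] : [/\ pa1 0 = - r3, pb1 0 = -1, pa2 0 = 1 & pb2 0 = r3].
  by rewrite /pa1 /pb1 /pa2 /pb2; split; ring.
have S1 : sym1 (- r3) (-1) 1 r3 = 0 by rewrite /sym1; ring.
have S2 : sym2 (- r3) (-1) 1 r3 = -4 by rewrite /sym2; move: rr; rewrite expr2 => rr; lra.
have S3 : sym3 (- r3) (-1) 1 r3 = 0 by rewrite /sym3; ring.
have S4 : sym4 (- r3) (-1) 1 r3 = 3 by rewrite /sym4; move: rr; rewrite expr2 => rr; lra.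
have c0 : pc 0 = 0.
  have [|l1 l2 l3] := @path_order 0; first by rewrite lexx ler01.
  have [_] := gapc_ratio l1 l2 l3; rewrite -/(pc 0) => <-.
  rewrite /gapc e1 e2 e3 e4 Int_odd ?mul0r//.
  - by move=> x; have := @quart_cont R (sym1 (- r3) (-1) 1 r3) (sym2 (- r3) (-1) 1 r3) (sym3 (- r3) (-1) 1 r3) (sym4 (- r3) (-1) 1 r3) x => cq; cont.
  by move=> x; rewrite S1 S2 S3 S4 /quart mulNr; congr (- (_ * Num.sqrt _)); ring.
have m0 : pmass 0 = 1/2.
  by rewrite /pmass c0 e1 e2 e3 e4 /qmass /qf1 /qf2 /qf3 /qf4 /mu5 /mu4 S1 S2 S3 S4; lra.
rewrite /pv1 /pv2 /pv3 /pv4 m0 c0 e1 e2 e3 e4 /qcst /qlin /qf2 /qf3 /qf4 /mu4 S1 S2 S3 ?S4.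
by split; lra.
Qed.

End Path.

(** * Concatenation of the two legs *)

Section Clamp.
Context {R : realType}.

(** Freezing each leg outside its time interval gives one formula, continuous on the whole line. *)
Definition clamp (x : R) : R := Num.max 0 (Num.min x 1).

Lemma clamp_itv x : 0 <= clamp x <= 1.
Proof. by rewrite /clamp le_max lexx /= ge_max ler01 ge_min lexx orbT. Qed.

Lemma clamp_le0 x : x <= 0 -> clamp x = 0.
Proof. by move=> x0; rewrite /clamp max_l// ge_min x0. Qed.

Lemma clamp_ge1 x : 1 <= x -> clamp x = 1.
Proof. by move=> x1; rewrite /clamp (min_r x1) max_r. Qed.

Lemma clamp_cont (x : R) (f : R -> R) : {for x, continuous f} -> {for x, continuous (fun y => clamp (f y))}.
Proof.
by move=> cf; apply: continuous_max; [exact: cst_continuous|apply: continuous_min => //; exact: cst_continuous].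
Qed.

End Clamp.

Theorem theorem2p4 (R : realType) (m : nat) (hm : (4 <= m)%N) (t : 'rV[R]_m) :
  in_Pk m 2 (Vt t) ->
  exists gamma : R -> 'rV[R]_m,
    [/\ {within `[0, 1], continuous gamma},
        gamma 0 = 0,
        gamma 1 = t &
        forall tau : R, 0 <= tau <= 1 -> in_Pk m 2 (Vt (gamma tau))].
Proof.
move=> [tP tk]; have [a1 [b1 [a2 [b2 [h H]]]]] := two_cut_of_k_cut tk.
have h1 := tc_lt1 H; have h2 := tc_lt2 H; have h3 := tc_lt3 H.
pose s (u : R) : 'rV[R]_m := tvec m (pv1 a1 b1 a2 b2 u) (pv2 a1 b1 a2 b2 u) (pv3 a1 b1 a2 b2 u) (pv4 a1 b1 a2 b2 u).
have sP (u : R) : 0 <= u <= 1 -> in_P m (Vt (s u)).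
  move=> /(path_two_cut h1 h2 h3)[m0 _]; rewrite Vt_tvec//; apply: in_P_quartic => //.
  by rewrite /pv4 invr_gt0 mulr_gt0.
have regular (V : {poly R}) (x1 y1 x2 y2 : R) k : in_P m V -> two_cut x1 y1 x2 y2 k V -> in_Pk m 2 V.
  by move=> VP TV; have [M M0 VM] := in_P_growth VP; split=> //; exact: (k_cut_of_two_cut M0 VM TV).
(* For tau <= 1/2 the second term vanishes and the quartic moves; afterwards the first term stays at
   [s 1] and the segment to [t] is traversed. *)
pose g (tau : R) := s (clamp (2 * tau)) + clamp (2 * tau - 1) *: (t - s 1).
have g_cont (tau : R) : {for tau, continuous g}.
  apply: cvg_rV => j.
  have [k1 k2 k3 k4] := path_cont h1 h2 h3 (clamp_itv (2 * tau)).
  have cl : {for tau, continuous (fun y : R => clamp (2 * y))} by apply: (@clamp_cont R tau (fun y : R => 2 * y)); cont.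
  have cl' : {for tau, continuous (fun y : R => clamp (2 * y - 1))} by apply: (@clamp_cont R tau (fun y : R => 2 * y - 1)); cont.
  have cs : {for tau, continuous (fun y : R => s (clamp (2 * y)) ord0 j)}.
    have -> : (fun y : R => s (clamp (2 * y)) ord0 j) = (fun y : R => [:: pv1 a1 b1 a2 b2 (clamp (2 * y));
        pv2 a1 b1 a2 b2 (clamp (2 * y)) + 4; pv3 a1 b1 a2 b2 (clamp (2 * y)); pv4 a1 b1 a2 b2 (clamp (2 * y)) - 1]`_j).
      by apply/funext => y; rewrite mxE.
    have cmp (f : R -> R) : {for clamp (2 * tau), continuous f} -> {for tau, continuous (fun y : R => f (clamp (2 * y)))}.
      by move=> cf; exact: (@contcomp R tau f (fun y => clamp (2 * y)) cf cl).
    have p1 := cmp _ k1; have p2 := cmp _ k2; have p3 := cmp _ k3; have p4 := cmp _ k4.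
    by case: (nat_of_ord j) => [|[|[|[|i]]]] /=; rewrite ?nth_nil; cont.
  have -> : (fun y : R => g y ord0 j) =
      (fun y : R => s (clamp (2 * y)) ord0 j + clamp (2 * y - 1) * (t ord0 j - s 1 ord0 j)).
    by apply/funext => y; rewrite !mxE.
  by cont.
exists g; rewrite {}/g in g_cont *; split.
- exact: continuous_subspaceT.
- have [e1 e2 e3 e4] := path_start h1 h2 h3.
  have c0 : clamp (2 * 0) = 0 :> R by apply: clamp_le0; lra.
  have c1 : clamp (2 * 0 - 1) = 0 :> R by apply: clamp_le0; lra.
  rewrite c0 c1 scale0r addr0; apply/rowP => j; rewrite !mxE e1 e2 e3 e4 addNr subrr.
  by case: (nat_of_ord j) => [|[|[|[|i]]]] //=; rewrite nth_nil.
- have c0 : clamp (2 * 1) = 1 :> R by apply: clamp_ge1; lra.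
  have c1 : clamp (2 * 1 - 1) = 1 :> R by apply: clamp_ge1; lra.
  by rewrite c0 c1 scale1r subrKC.
move=> tau /andP[t0 t1]; have [th|th] := leP (2 * tau) 1.
  rewrite (@clamp_le0 _ (2 * tau - 1)) ?subr_le0// scale0r addr0.
  have ui := clamp_itv (2 * tau); have [_ HT] := path_two_cut h1 h2 h3 ui.
  by apply: regular (sP _ ui) _; rewrite Vt_tvec//; exact: HT.
have ui := clamp_itv (2 * tau - 1); move: (clamp _) ui => u ui.
rewrite clamp_ge1 ?ltW//.
have -> : s 1 + u *: (t - s 1) = (1 - u) *: s 1 + u *: t.
  by rewrite scalerBr scalerBl scale1r addrA addrAC.
rewrite Vt_convex.
have i1 : 0 <= (1 : R) <= 1 by rewrite ler01 lexx.
have [_ HT] := path_two_cut h1 h2 h3 i1.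
have [e1 e2 e3 e4] : [/\ pa1 a1 1 = a1, pb1 b1 1 = b1, pa2 a2 1 = a2 & pb2 b2 1 = b2].
  by rewrite /pa1 /pb1 /pa2 /pb2; split; ring.
rewrite e1 e2 e3 e4 -(Vt_tvec _ _ _ _ hm) -/(s 1) in HT.
(* At u = 1 the bands of the quartic are those of [Vt t], so the two densities live on the same set
   and can be averaged. *)
have [k Hk] := two_cut_convex HT H ui.
by apply: regular Hk; apply: in_P_convex => //; exact: sP.
Qed.
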